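(* Define functions $s_1,s_2$ on the positive integers by $$s_1(d)=\begin{cases}\frac1{18}d^2+\frac5{18}d&\text{if }d\equiv 0,4\pmod 9\\ \frac1{18}d^2+\frac5{18}d+\frac29&\text{if }d\equiv 2,5,8\pmod 9\\ \frac1{18}d^2+\frac5{18}d+\frac23&\text{if }d\equiv 1,3\pmod 9\\ \frac1{18}d^2+\frac5{18}d+\frac13&\text{if }d\equiv 6,7\pmod 9\end{cases}$$ and $$s_2(d)=\begin{cases}\frac1{18}d^2+\frac13d+1&\text{if }d\equiv 0\pmod 6\\ \frac1{18}d^2+\frac13d+\frac12&\text{if }d\equiv 3\pmod 6\\ \frac1{18}d^2+\frac7{18}d+\frac59&\text{if }d\equiv 1,4,7\pmod 9\\ \frac1{18}d^2+\frac7{18}d+1&\text{if }d\equiv 2\pmod 9\\ \frac1{18}d^2+\frac7{18}d+\frac23&\text{if }d\equiv 5\pmod 9\\ \frac1{18}d^2+\frac7{18}d+\frac13&\text{if }d\equiv 8\pmod 9.\end{cases}$$ Let $s,d$ be positive integers. If $s\le s_1(d)$, then $\sigma_s(\mathrm{Split}_d(\mathbb P^n))$ is nondefective for every $n\ge 3$. If $s\ge s_2(d)$, then $\sigma_s(\mathrm{Split}_d(\mathbb P^3))$ is nondefective.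
   Context: $\Bbbk$ is an algebraically closed field of characteristic zero, $R=\Bbbk[x_0,\dots,x_n]$, and $R_d$ is the vector space of degree $d$ forms in $R$, so $\mathbb P R_d=\mathbb P^{\binom{n+d}{d}-1}$. The variety of completely decomposable forms is $\mathrm{Split}_d(\mathbb P^n)=\{[f]\in\mathbb P R_d: f \text{ is a product of } d \text{ linear forms}\}$; it has dimension $dn$. For a projective variety $X\subset\mathbb P^N$, the $s$th secant variety $\sigma_s(X)$ is the Zariski closure of the union of all $(s-1)$-planes spanned by $s$ generic points of $X$. The secant variety $\sigma_s(\mathrm{Split}_d(\mathbb P^n))$ is called nondefective if $\dim\sigma_s(\mathrm{Split}_d(\mathbb P^n))=\min\{s(dn+1),\binom{n+d}{d}\}-1$, and defective otherwise. *)

(* Defs.v *)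
From HB Require Import structures.
From mathcomp Require Import all_boot all_order all_algebra.
From mathcomp Require Export mpoly.

Set Implicit Arguments.
Unset Strict Implicit.
Unset Printing Implicit Defensive.

Import Order.TTheory GRing.Theory Num.Theory.
Local Open Scope ring_scope.

Section ProjectiveSpace.

Context {k : fieldType} (V : vectType k).

Local Notation N := (\dim {:V}).

(* The projective space P(V): its points are the lines through the origin. *)
Definition ppoint := {L : {vspace V} | \dim L == 1}.

(* Homogeneous coordinates of p, read on one nonzero representative. They are
   only used below in ways that do not depend on the representative. *)
Definition hcoord (p : ppoint) : 'I_N -> k :=
  fun i => coord (vbasis {:V}) i (vpick (val p)).

Definition zclosed (C : ppoint -> Prop) : Prop :=
  exists S : {mpoly k[N]} -> Prop,
    (forall F, S F -> exists e : nat, F \is e.-homog) /\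
    (forall p, C p <-> forall F, S F -> F.@[hcoord p] = 0).

Definition zclosure (A : ppoint -> Prop) : ppoint -> Prop :=
  fun q => forall C, zclosed C -> (forall p, A p -> C p) -> C q.

(* Zariski topology of the s-fold product P(V)^s: the closed sets are the zero
   loci of multihomogeneous polynomials. The variable of index mxvec_index i j
   is the j-th homogeneous coordinate on the i-th factor. *)
Definition multihomog (s : nat) (F : {mpoly k[s * N]}) : Prop :=
  exists e : 'I_s -> nat,
    forall m, m \in msupp F ->
    forall i, (\sum_(j < N) m (mxvec_index i j))%N = e i.

Definition hcoord_prod (s : nat) (p : 'I_s -> ppoint) : 'I_(s * N) -> k :=
  fun h => mxvec (\matrix_(i < s, j < N) hcoord (p i) j) 0 h.

Definition zclosed_prod (s : nat) (C : ('I_s -> ppoint) -> Prop) : Prop :=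
  exists S : {mpoly k[s * N]} -> Prop,
    (forall F, S F -> multihomog F) /\
    (forall p, C p <-> forall F, S F -> F.@[hcoord_prod p] = 0).

Definition zopen_prod (s : nat) (O : ('I_s -> ppoint) -> Prop) : Prop :=
  zclosed_prod (fun p => ~ O p).

(* O cuts out a dense open subset of X^s (subspace topology from P(V)^s). *)
Definition dense_open_power (X : ppoint -> Prop) (s : nat)
    (O : ('I_s -> ppoint) -> Prop) : Prop :=
  zopen_prod O /\
  (forall O', zopen_prod O' ->
     (exists p, (forall i, X (p i)) /\ O' p) ->
     exists p, [/\ forall i, X (p i), O p & O' p]).

(* The s-th secant variety: the closure of the union of the linear spans of s
   generic points of X. A family of s-tuples contains the generic ones when it
   contains a dense open subset of X^s. For irreducible X all dense open subsets
   give the same closure, so that the quantification over O only expresses that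
   any nonempty genericity condition may be imposed on the s points. When s
   exceeds dim V, s generic points span less than an (s-1)-plane, and it is
   their linear span which is meant. *)
Definition secant (X : ppoint -> Prop) (s : nat) : ppoint -> Prop :=
  fun q => forall O : ('I_s -> ppoint) -> Prop, dense_open_power X O ->
    zclosure (fun r => exists p : 'I_s -> ppoint,
      [/\ forall i, X (p i), O p & (val r <= \sum_(i < s) val (p i))%VS]) q.

(* X carries m algebraically independent rational functions F_i / G, where the
   F_i and G are forms of the same degree (finitely many rational functions can
   always be given a common denominator). *)
Definition alg_indep_on (X : ppoint -> Prop) (m : nat) : Prop :=
  exists (e : nat) (G : {mpoly k[N]}) (F : 'I_m -> {mpoly k[N]}),
    [/\ G \is e.-homog,
        forall i, F i \is e.-homog
      & forall P : {mpoly k[m]}, P != 0 ->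
        exists p, [/\ X p, G.@[hcoord p] != 0
          & P.@[fun i => (F i).@[hcoord p] / G.@[hcoord p]] != 0]].

(* dim X = m, as the transcendence degree over k of the function field of X (X
   irreducible, as secant varieties of irreducible varieties are). *)
Definition has_pdim (X : ppoint -> Prop) (m : nat) : Prop :=
  alg_indep_on X m /\ ~ alg_indep_on X m.+1.

End ProjectiveSpace.

(* dhomog n.+1 k d is the space R_d of forms of degree d in x_0, ..., x_n. *)
Definition split_variety (k : fieldType) (n d : nat) :
    ppoint (dhomog n.+1 k d) -> Prop :=
  fun p => exists (f : dhomog n.+1 k d) (l : 'I_d -> dhomog n.+1 k 1),
    val p = <[f]>%VS /\ val f = \prod_(i < d) val (l i).

Definition nondefective (k : fieldType) (n d s : nat) : Prop :=
  has_pdim (secant (@split_variety k n d) s)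
    (minn (s * (d * n + 1)) 'C(n + d, d) - 1).

Definition s1 (d : nat) : rat :=
  let x : rat := d%:R in
  if (d %% 9 \in [:: 0; 4])%N then 1 / 18 * x ^+ 2 + 5 / 18 * x
  else if (d %% 9 \in [:: 2; 5; 8])%N then
    1 / 18 * x ^+ 2 + 5 / 18 * x + 2 / 9
  else if (d %% 9 \in [:: 1; 3])%N then
    1 / 18 * x ^+ 2 + 5 / 18 * x + 2 / 3
  else (* d %% 9 is 6 or 7 *) 1 / 18 * x ^+ 2 + 5 / 18 * x + 1 / 3.

Definition s2 (d : nat) : rat :=
  let x : rat := d%:R in
  if (d %% 6 == 0)%N then 1 / 18 * x ^+ 2 + 1 / 3 * x + 1
  else if (d %% 6 == 3)%N then 1 / 18 * x ^+ 2 + 1 / 3 * x + 1 / 2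
  else if (d %% 9 \in [:: 1; 4; 7])%N then
    1 / 18 * x ^+ 2 + 7 / 18 * x + 5 / 9
  else if (d %% 9 == 2)%N then 1 / 18 * x ^+ 2 + 7 / 18 * x + 1
  else if (d %% 9 == 5)%N then 1 / 18 * x ^+ 2 + 7 / 18 * x + 2 / 3
  else (* d %% 9 is 8 *) 1 / 18 * x ^+ 2 + 7 / 18 * x + 1 / 3.

(* Main.v *)
(* By Terracini, the dimension of the secant variety is the dimension of a sum
   of s spaces T(f) = sum_i (f / l_i) R_1, where f = l_1 ... l_d. Lower bounds
   for such sums, enlarged by spaces g R_1 with g a product of d - 1 linear
   forms, are proved by specialising some of the factors to a hyperplane h and
   adding the ranks of trace and residue: T(h g) has trace g R_1 and residue
   T(g), while T(f) with f general has trace T(f|h) and residue the span of the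
   f / l_i. That this last span is as independent as possible of any given
   subspace is a separate lemma. In the plane the induction starts from products of
   tangent lines of a conic, where independence is an interpolation statement.
   In P^3 the induction on d is purely numerical, and P^n, n > 3, follows by
   letting no factor contain the hyperplane. *)

Require Import Defs.
From HB Require Import structures.
From mathcomp Require Import all_boot all_order all_algebra.
From mathcomp Require Import mpoly qpoly.
From mathcomp Require Import zify ring.
From Stdlib Require Import Classical.
Set Implicit Arguments.
Unset Strict Implicit.
Unset Printing Implicit Defensive.
Import Order.TTheory GRing.Theory.
Import VectorInternalTheory.
Local Open Scope ring_scope.

(** * Spans of forms along lines of parameters *)

(** The span of the f / l_i must be independent of a subspace [U] that comes from a residue and of
    which only the dimension is known, so it cannot be specialised together with [U]. The factors
    are instead moved off one form l. The cofactors of the l + t m_i all tend to l^e, so the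
    information is spread over all orders in t; it is measured by the spaces U + l^(e - r) R_r, for
    an l that makes them as large as possible.

    In the plane, the products of the base case share a pool of e + 2 tangent lines: each omits its
    own block of four and adds two other lines. At the meeting point of two tangents only the
    products omitting one of them contribute, so a linear relation splits into small systems
    involving one or two blocks. Four nodes per block are what determines a cubic in one parameter.

    In P^3 the residue is the tight side of the induction below s1, and the trace is the tight side
    above s2. *)

Lemma rank_open (k : fieldType) m n (M : 'M[{poly k}]_(m, n)) a :
  exists2 q : {poly k}, q.[a] != 0 & forall t, q.[t] != 0 ->
    (\rank (map_mx (horner_eval a) M) <= \rank (map_mx (horner_eval t) M))%N.
Proof.
set M0 := map_mx _ M; set r := \rank M0.
have /row_fullP[A hA] := col_base_full M0.
have /row_freeP[B hB] := row_base_free M0.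
have hAB : A *m M0 *m B = 1%:M.
  have: A *m (col_base M0 *m row_base M0) *m B = 1%:M by rewrite mulmxA hA mul1mx.
  by rewrite mulmx_base.
pose cst p q (X : 'M[k]_(p, q)) : 'M[{poly k}]_(p, q) := map_mx polyC X.
have cstK p q (X : 'M[k]_(p, q)) t : map_mx (horner_eval t) (cst _ _ X) = X.
  by apply/matrixP=> i j; rewrite !mxE /horner_eval hornerC.
(* A nonvanishing minor in coordinate-free form: [A] and [B] are one-sided inverses of the column
   and row bases of [M0], so this determinant is 1 at [a]. *)
exists (\det (cst _ _ A *m M *m cst _ _ B)) => [|t].
  by rewrite -/(horner_eval a _) -det_map_mx !map_mxM !cstK hAB det1 oner_neq0.
rewrite -/(horner_eval t _) -det_map_mx !map_mxM !cstK => nz.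
have: row_free (A *m map_mx (horner_eval t) M *m B).
  by rewrite row_free_unit unitmxE unitfE.
move=> /eqP h; rewrite -[r]h.
by apply: leq_trans (mxrankM_maxl _ _) (mxrankM_maxr _ _).
Qed.

Lemma dim_span_mx (k : fieldType) (V : vectType k) (X : seq V) :
  \dim <<X>> = \rank (\matrix_(i < size X) v2r X`_i).
Proof.
rewrite /dimv [@span _ _]unlock /span_expanded_def mx2vsK; congr (\rank _).
by apply/matrixP=> i j; rewrite !mxE (tnth_nth 0).
Qed.

Section Forms.
Variables (k : fieldType) (n : nat).
Implicit Types (e : nat).

Notation H e := (dhomog n.+1 k e).

(** Taking the homogeneous component makes this a total linear map, so generators can be carried as
    bare polynomials; homogeneity is supplied only where a value is read back through [hpK]. *)
Definition hp e (p : {mpoly k[n.+1]}) : H e := DHomog (pihomogP mdeg e p).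

Lemma hp_is_linear e : linear (hp e).
Proof. by move=> c p q; apply/val_inj; rewrite /= linearP. Qed.
HB.instance Definition _ e :=
  GRing.isLinear.Build k {mpoly k[n.+1]} (H e) _ (hp e) (hp_is_linear e).

Lemma hpK e (p : {mpoly k[n.+1]}) : p \is e.-homog -> val (hp e p) = p.
Proof. by move=> hom; rewrite /= pihomog_dE. Qed.

Lemma valK_hp e (u : H e) : hp e (val u) = u.
Proof. by apply/val_inj; rewrite /= pihomog_dE //; exact: dhomog_is_dhomog. Qed.

Definition hspan e (s : seq {mpoly k[n.+1]}) : {vspace H e} := <<map (hp e) s>>%VS.

Lemma hspan_open e (s : seq {poly {mpoly k[n.+1]}}) a :
  exists2 q : {poly k}, q.[a] != 0 & forall t, q.[t] != 0 ->
    (\dim (hspan e [seq p.[a%:MP] | p <- s]) <=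
     \dim (hspan e [seq p.[t%:MP] | p <- s]))%N.
Proof.
pose M : 'M[{poly k}]_(size s, dim (H e)) :=
  \matrix_(i, j) map_poly (fun b => v2r (hp e b) 0 j) s`_i.
have ME t : \dim (hspan e [seq p.[t%:MP] | p <- s])
    = \rank (map_mx (horner_eval t) M).
  rewrite /hspan dim_span_mx !size_map; congr (\rank _).
  apply/matrixP=> i j; rewrite !mxE -map_comp (nth_map 0) //= /horner_eval.
  rewrite /map_poly horner_poly horner_coef !linear_sum /= summxE.
  apply: eq_bigr => l _; rewrite -rmorphXn mulrC mul_mpolyC.
  by rewrite !linearZ /= !mxE mulrC.
have [q q0 hq] := rank_open M a.
by exists q => // t /hq; rewrite !ME.
Qed.
End Forms.

Section Char0.
Variables (k : fieldType) (hk : [pchar k] =i pred0).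

Lemma natr_neq0 i : (i.+1%:R : k) != 0.
Proof. by rewrite ((pcharf0P k).1 hk). Qed.

Lemma poly_nonroot (q : {poly k}) : q != 0 -> exists t, q.[t] != 0.
Proof.
move=> q0; pose rs := [seq i%:R : k | i <- iota 0 (size q)].
have urs : uniq rs.
  rewrite map_inj_in_uniq ?iota_uniq // => i j _ _ /eqP.
  wlog le_ij : i j / (i <= j)%N => [wl|].
    by case: (leqP i j) => [/wl//|/ltnW/wl h] /eqP/esym/eqP/h.
  rewrite -(subnK le_ij) natrD -subr_eq0 opprD addrCA subrr addr0 oppr_eq0.
  by rewrite ((pcharf0P k).1 hk) subn_eq0 => /eqP; lia.
have /allPn[t _ ht] : ~~ all (root q) rs.
  by apply/negP=> /(max_poly_roots q0)/(_ urs); rewrite size_map size_iota ltnn.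
by exists t.
Qed.

(** The projection to a complement along [W] serves as the quotient map modulo [W] from here on. *)
Lemma modv_eq0 (V : vectType k) (W : {vspace V}) v :
  (daddv_pi (W^C)%VS W v == 0) = (v \in W).
Proof.
set P := daddv_pi _ _.
have vE : v = daddv_pi W (W^C) v + P v.
  by rewrite daddv_pi_add ?capv_compl // addv_complf memvf.
apply/eqP/idP=> [Pv0|vW].
  by rewrite vE Pv0 addr0 memv_pi.
have : P v \in (W :&: W^C)%VS.
  rewrite memv_cap memv_pi andbT.
  have -> : P v = v - daddv_pi W (W^C) v by rewrite [X in X - _]vE addrC addKr.
  by rewrite memvB // memv_pi.
by rewrite capv_compl memv0 => /eqP.
Qed.

(** Modulo [W] the coordinates of the curve are polynomials in t without nonzero values, hence zero
    because the field is infinite. *)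
Lemma curve_coef_mem (V : vectType k) (W : {vspace V}) (c : nat -> V) N :
  (forall t : k, \sum_(i < N) t ^+ i *: c i \in W) ->
  forall i, (i < N)%N -> c i \in W.
Proof.
move=> h i iN; pose P := daddv_pi (W^C)%VS W.
rewrite -modv_eq0 -(inj_eq (@v2r_inj _ _)) linear0; apply/eqP/rowP=> j; rewrite mxE.
pose q : {poly k} := \poly_(i < N) v2r (P (c i)) 0 j.
suff : q = 0 by move/polyP/(_ i); rewrite coef_poly iN coef0.
apply/eqP/negP=> /negP/poly_nonroot[t]; apply/negP; rewrite negbK.
rewrite horner_poly.
have := h t; rewrite -modv_eq0 -(inj_eq (@v2r_inj _ _)) linear0 => /eqP/rowP/(_ j).
rewrite !linear_sum summxE mxE => /eqP; congr (_ == _).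
by apply: eq_bigr => l _; rewrite !linearZ mxE mulrC.
Qed.

Lemma max_attained (T : Type) (x : T) (f : T -> nat) B :
  (forall y, f y <= B)%N -> exists x0, forall y, (f y <= f x0)%N.
Proof.
move=> hB; have [m] : exists m, (B - f x <= m)%N by exists (B - f x)%N.
elim: m x => [|m IH] x hm.
  by exists x => y; have := hB y; lia.
case: (classic (exists y, f x < f y)%N) => [[y hy]|no].
  by apply: (IH y); have := hB y; lia.
by exists x => y; rewrite leqNgt; apply/negP=> hy; apply: no; exists y.
Qed.

End Char0.

Section Mul.
Variables (k : fieldType) (n : nat).
Notation R := {mpoly k[n.+1]}.
Notation H e := (dhomog n.+1 k e).

Definition mulh e r (g : R) (u : H r) : H e := hp e (g * val u).

Lemma mulh_is_linear e r g : linear (@mulh e r g).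
Proof.
move=> c u v; rewrite /mulh linearP mulrDr -scalerAr.
by rewrite linearP.
Qed.
HB.instance Definition _ e r g :=
  GRing.isLinear.Build k (H r) (H e) _ (@mulh e r g) (@mulh_is_linear e r g).

Definition mulf e r g : 'Hom(H r, H e) := linfun (@mulh e r g).

Lemma mulfE e r g u : mulf e r g u = hp e (g * val u).
Proof. by rewrite lfunE. Qed.

Lemma limg_mulf e r g :
  limg (mulf e r g) = hspan e [seq g * val u | u <- vbasis {:H r}].
Proof.
rewrite -[X in (_ @: X)%VS](span_basis (vbasisP _)) limg_span /hspan -map_comp.
by congr <<_>>%VS; apply: eq_map => u /=; rewrite mulfE.
Qed.

Lemma hspan_vbasis e (U : {vspace H e}) : hspan e [seq val u | u <- vbasis U] = U.
Proof.
rewrite /hspan -map_comp -[RHS](span_basis (vbasisP U)); congr <<_>>%VS.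
by rewrite -[RHS]map_id; apply: eq_map => u /=; rewrite valK_hp.
Qed.

Lemma hspan_cat e s1 s2 : hspan e (s1 ++ s2) = (@hspan k n e s1 + hspan e s2)%VS.
Proof. by rewrite /hspan map_cat span_cat. Qed.

Lemma mem_limg_mulf e r (g p : R) : p \is r.-homog ->
  hp e (g * p) \in limg (mulf e r g).
Proof.
by move=> hom; rewrite -(hpK hom) -mulfE memv_img ?memvf.
Qed.

Lemma limg_mulf_ex e r (g : R) v : v \in limg (mulf e r g) ->
  exists2 q : R, q \is r.-homog & v = hp e (g * q).
Proof.
case/memv_imgP=> u _ ->; exists (val u); first exact: dhomog_is_dhomog.
by rewrite mulfE.
Qed.
End Mul.

Section Powers.
Variables (k : fieldType) (hk : [pchar k] =i pred0) (n : nat).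
Notation R := {mpoly k[n.+1]}.
Notation H e := (dhomog n.+1 k e).

Lemma poly_curve_mem e (W : {vspace H e}) (p : {poly R}) :
  (forall t, hp e p.[t%:MP] \in W) -> forall i, hp e p`_i \in W.
Proof.
move=> h i; case: (ltnP i (size p)) => [ip|/(nth_default 0)->]; last first.
  by rewrite linear0 mem0v.
apply: (@curve_coef_mem _ hk _ W (fun i => hp e p`_i) (size p)) => // t.
have := h t; rewrite horner_coef linear_sum /=; congr (_ \in W).
by apply: eq_bigr => l _; rewrite -rmorphXn mulrC mul_mpolyC linearZ.
Qed.

Lemma monomial_homog_ind r (P : R -> Prop) :
  (forall p q, P p -> P q -> P (p + q)) -> (forall c p, P p -> P (c *: p)) ->
  P 0 -> (forall ls : seq R, size ls = r -> all (fun l => l \is 1.-homog) ls ->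
    P (\prod_(l <- ls) l)) ->
  forall p, p \is r.-homog -> P p.
Proof.
move=> PD PZ P0 Pm p hom; rewrite [p]mpolyE big_seq.
elim/big_ind: _ => // m mp; apply: PZ.
have dm : mdeg m = r by exact: (dhomog_mf hom mp).
rewrite -(s2mK m); have sz := size_m2s m; rewrite dm in sz.
have -> : 'X_[s2m (m2s m)] = \prod_(l <- [seq 'X_i | i <- m2s m]) l :> R.
  elim: (m2s m) => [|i s IH].
    by rewrite big_nil -mpolyX0; congr 'X_[_]; apply/mnmP=> i; rewrite !mnmE.
  rewrite /= big_cons -IH -mpolyXD; congr 'X_[_]; apply/mnmP=> j.
  by rewrite !mnmE /= eq_sym.
apply: Pm; first by rewrite size_map.
by apply/allP=> l /mapP[i _ ->]; rewrite dhomogX; apply/eqP; exact: mdeg1.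
Qed.

(** Polarisation: moving m to m + t l in g l_1 ... l_a m^(r - a) and taking the coefficient of t
    trades one factor m for l, with the coefficient r - a, which is invertible in characteristic
    zero. After r trades an arbitrary product of linear forms is reached. *)
Lemma powers_span e r (g : R) (W : {vspace H e}) :
  (forall m, m \is 1.-homog -> hp e (g * m ^+ r) \in W) ->
  forall p, p \is r.-homog -> hp e (g * p) \in W.
Proof.
move=> hm; apply: monomial_homog_ind.
- by move=> p q hp hq; rewrite mulrDr linearD memvD.
- by move=> c p hp; rewrite -scalerAr linearZ memvZ.
- by rewrite mulr0 linear0 mem0v.
move=> ls sz homs.
suff: forall a (s : seq R) m, size s = a -> (a <= r)%N ->
    all (fun l => l \is 1.-homog) s -> m \is 1.-homog ->
    hp e (g * (\prod_(l <- s) l * m ^+ (r - a))) \in W.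
  move/(_ r ls 0 sz (leqnn r) homs); rewrite subnn expr0 mulr1; apply.
  by rewrite rpred0.
elim=> [|a IH] s m.
  by move/size0nil=> -> _ _ /hm; rewrite big_nil mul1r subn0.
case: s => [//|l s] /= [sa] ar.
case/andP=> hl hs hmm.
pose p : {poly R} := (g * \prod_(l <- s) l)%:P * (m%:P + l *: 'X) ^+ (r - a).
have pW t : hp e p.[t%:MP] \in W.
  rewrite !hornerE -mulrA; apply: IH; rewrite ?sa ?(ltnW ar) //.
  by rewrite rpredD // mulrC mul_mpolyC rpredZ.
have p1 : p`_1 = (r - a)%:R *: (g * (\prod_(j <- l :: s) j * m ^+ (r - a.+1))).
  have -> : p`_1 = p^`().[0] by rewrite horner_coef0 coef_deriv mulr1n.
  rewrite /p derivM derivC mul0r add0r deriv_exp derivD derivC add0r.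
  rewrite derivZ derivX.
  rewrite !hornerE big_cons scaler_nat -subnS subnS.
  rewrite !(hornerMn, hornerE) /= mulrnAr; congr (_ *+ _); ring.
have := poly_curve_mem pW 1; rewrite p1 linearZ /= rpredZeq.
by rewrite -[(r - a)%N]prednK ?subn_gt0 // (negPf (natr_neq0 hk _)).
Qed.
End Powers.

(** * The span of the quotients F / l_i is independent of a given subspace *)

Lemma homogS (k : fieldType) n (l q : {mpoly k[n]}) r :
  l \is 1.-homog -> q \is r.-homog -> l * q \is r.+1.-homog.
Proof. exact: dhomogM. Qed.

Lemma ltn_sum_one (f g : nat -> nat) N b : (b < N)%N -> (f b < g b)%N ->
  (forall r, (r < N)%N -> (f r <= g r)%N) ->
  (\sum_(r < N) f r < \sum_(r < N) g r)%N.
Proof.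
move=> bN fg h; rewrite (bigD1 (Ordinal bN)) //= [X in (_ < X)%N](bigD1 (Ordinal bN)) //=.
by rewrite -addSn leq_add // leq_sum // => i _; exact: h.
Qed.

Section Flag.
Variables (k : fieldType) (hk : [pchar k] =i pred0) (n e : nat).
Notation R := {mpoly k[n.+1]}.
Notation H e := (dhomog n.+1 k e).
Variable U : {vspace H e}.

(* Step r.+1 of the flag is U + l^(e - r) R_r; step 0 is U and step e.+1 is
   everything. *)
Definition flag (l : R) r :=
  if r is r'.+1 then (U + limg (mulf e r' (l ^+ (e - r'))))%VS else U.

Lemma flag_top l : flag l e.+1 = fullv.
Proof.
apply/vspaceP=> v; rewrite memvf /= subnn expr0.
apply: (subvP (addvSr _ _)); rewrite -(valK_hp v) -[val v]mul1r.
by apply: mem_limg_mulf; exact: dhomog_is_dhomog.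
Qed.

Lemma flag_sub l r : l \is 1.-homog -> (r <= e)%N -> (flag l r <= flag l r.+1)%VS.
Proof.
move=> hl re; case: r re => [|r] re /=; first exact: addvSl.
rewrite subv_add addvSl /=; apply/subvP=> v /limg_mulf_ex[q hq ->].
apply: (subvP (addvSr _ _)).
have -> : (e - r = (e - r.+1).+1)%N by lia.
by rewrite exprSr -mulrA; apply: mem_limg_mulf; exact: homogS.
Qed.

Lemma mem_flag l r p : p \is r.-homog -> hp e (l ^+ (e - r) * p) \in flag l r.+1.
Proof.
by move=> hp0; apply: (subvP (addvSr _ _)); apply: mem_limg_mulf.
Qed.

Lemma sub_flag l r : (U <= flag l r)%VS.
Proof. by case: r => [|r] /=; [exact: subvv | exact: addvSl]. Qed.

Lemma flag_curve l m r : exists s : seq {poly R},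
  forall t : k, flag (l + t *: m) r = hspan e [seq p.[t%:MP] | p <- s].
Proof.
pose sU := [seq (val u)%:P : {poly R} | u <- vbasis U].
have sUE t : hspan e [seq p.[t%:MP] | p <- sU] = U.
  rewrite -[RHS]hspan_vbasis -map_comp; congr (hspan _ _).
  by apply: eq_map => u /=; rewrite hornerC.
case: r => [|r] /=; first by exists sU.
pose lc : {poly R} := l%:P + m *: 'X.
exists (sU ++ [seq lc ^+ (e - r) * (val u)%:P | u <- vbasis {:H r}]) => t.
rewrite map_cat hspan_cat sUE limg_mulf -map_comp; congr (_ + hspan _ _)%VS.
apply: eq_map => u /=; rewrite !hornerE; congr (_ ^+ _ * _).
by rewrite [m * _]mulrC mul_mpolyC.
Qed.

Lemma flag0 l : flag l 0 = U. Proof. by []. Qed.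

Lemma flagS l r : flag l r.+1 = (U + limg (mulf e r (l ^+ (e - r))))%VS.
Proof. by []. Qed.

Opaque flag.

Lemma flag_open l m N : exists2 q : {poly k}, q.[0] != 0 &
  forall t, q.[t] != 0 -> forall r, (r < N)%N ->
    (\dim (flag l r) <= \dim (flag (l + t *: m) r))%N.
Proof.
elim: N => [|N [q q0 hq]].
  by exists 1%:P => [|t _ r rN]; [rewrite hornerC oner_neq0 | exfalso; move: rN; rewrite ltn0].
have [s hs] := flag_curve l m N; have [q' q'0 hq'] := hspan_open e s 0.
exists (q * q') => [|t]; first by rewrite hornerM mulf_neq0.
rewrite hornerM mulf_eq0 negb_or => /andP[qt q't] r.
rewrite ltnS leq_eqVlt => /predU1P[->|rN]; last exact: hq.
have := hs 0; rewrite scale0r addr0 hs => ->; exact: hq'.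
Qed.

(* For such l no step of the flag can grow when l moves along l + t m. *)
Definition flag_max l := l \is 1.-homog /\ forall l', l' \is 1.-homog ->
  (\sum_(r < e.+2) \dim (flag l' r) <= \sum_(r < e.+2) \dim (flag l r))%N.

Lemma flag_max_exists : exists l, flag_max l.
Proof.
pose f (u : H 1) := (\sum_(r < e.+2) \dim (flag (val u) r))%N.
have [u|u hu] := @max_attained _ (0 : H 1) f (\sum_(r < e.+2) \dim {:H e}).
  by apply: leq_sum => i _; exact: dimvS (subvf _).
exists (val u); split; first exact: dhomog_is_dhomog.
by move=> l' hl'; have := hu (hp 1 l'); rewrite /f hpK.
Qed.

(** After subtracting a multiple of l from p one may assume l^(e - b) p in [U]. The difference
    quotient of (l + t m)^(e - b) p then lies in step [b.+1] of the flag of l + t m for t nonzero,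
    and its limit at t = 0 is a nonzero multiple of the claimed element. Were the limit outside the
    step for l, that step would be strictly larger at a general t while no other drops, against
    maximality. *)
Lemma flag_closure l b m p : flag_max l -> (b < e)%N -> m \is 1.-homog ->
  p \is b.-homog -> hp e (l ^+ (e - b) * p) \in flag l b ->
  hp e (l ^+ (e - b.+1) * (m * p)) \in flag l b.+1.
Proof.
move=> [hl lmax] be hm hp0 hJ.
have [p1 [q [hp1 hq pE p1U]]] : exists p1 q, [/\ p1 \is b.-homog,
    m * q \is b.-homog, p = p1 + l * q & hp e (l ^+ (e - b) * p1) \in U].
  case: b be hp0 hJ => [|b] be hp0; rewrite ?flag0 ?flagS => hJ.
    by exists p, 0; rewrite !mulr0 addr0; split => //; rewrite rpred0.
  have [u uU [w hw uw]] := memv_addP hJ.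
  have [q hq wE] := limg_mulf_ex hw.
  exists (p - l * q), q; split=> //.
  - by rewrite rpredB // homogS.
  - exact: homogS.
  - by rewrite subrK.
  have lq : l ^+ (e - b.+1) * (l * q) = l ^+ (e - b) * q.
    by rewrite mulrA -exprSr (subnSK (ltnW be)).
  by rewrite mulrBr linearB /= uw lq -wE addrK.
rewrite pE !mulrDr linearD /= memvD //; last first.
  have -> : l ^+ (e - b.+1) * (m * (l * q)) = l ^+ (e - b) * (m * q).
    by rewrite -[in RHS](subnSK be) exprS; ring.
  exact: mem_flag.
set N := (e - b)%N; have NE : N = (e - b.+1).+1 by rewrite /N; lia.
pose lc : {poly R} := l%:P + m *: 'X.
(* The difference quotient written as a polynomial in t, so that it can be evaluated at t = 0. *)
pose D : {poly R} := (\sum_(i < N) lc ^+ (N.-1 - i) * l%:P ^+ i) * (m * p1)%:P.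
have lcE t : lc.[t%:MP] = l + t *: m.
  by rewrite !hornerE [m * _]mulrC mul_mpolyC.
have hlt t : l + t *: m \is 1.-homog by rewrite rpredD ?rpredZ.
have DE t : t *: D.[t%:MP] = (l + t *: m) ^+ N * p1 - l ^+ N * p1.
  rewrite -mulrBl subrXX addrAC subrr add0r -!scalerAl; congr (_ *: _).
  rewrite hornerM hornerC horner_sum.
  under eq_bigr => i _ do rewrite hornerM !horner_exp lcE hornerC -subn1.
  under [in RHS]eq_bigr => i _ do rewrite -subn1.
  by rewrite mulrCA mulrA.
have DJ t : t != 0 -> hp e D.[t%:MP] \in flag (l + t *: m) b.+1.
  move=> t0; rewrite -(scale1r (hp _ _)) -(mulVf t0) -scalerA memvZ //.
  have -> : t *: hp e D.[t%:MP] = hp e (t *: D.[t%:MP]) by rewrite linearZ.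
  rewrite DE linearB; apply: memvB; first exact: mem_flag.
  exact: (subvP (sub_flag _ _) _ p1U).
have D0 : D.[0%:MP] = N%:R *: (l ^+ (e - b.+1) * (m * p1)).
  rewrite hornerM hornerC horner_sum scalerAl; congr (_ * _).
  rewrite (eq_bigr (fun _ => l ^+ (e - b.+1))) => [|i _].
    by rewrite sumr_const card_ord scaler_nat.
  rewrite hornerM !horner_exp lcE scale0r addr0 hornerC -exprD.
  by congr (_ ^+ _); have := ltn_ord i; lia.
apply/negPn/negP=> notJ.
have [s hs] := flag_curve l m b.+1.
have [q1 q10 hq1] := hspan_open e (rcons s D) 0.
have [q2 q20 hq2] := flag_open l m e.+2.
(* The factor X keeps t away from 0, where [DJ] says nothing. *)
have qn0 : q1 * q2 * 'X != 0.
  rewrite !mulf_neq0 ?polyX_eq0 //.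
    by apply: contraNneq q10 => ->; rewrite horner0.
  by apply: contraNneq q20 => ->; rewrite horner0.
have [t] := poly_nonroot hk qn0.
rewrite !hornerE !mulf_eq0 !negb_or -andbA => /and3P[q1t q2t t0].
have := lmax _ (hlt t); apply/negP; rewrite -ltnNge.
have aN : (b.+1 < e.+2)%N by rewrite ltnS ltnW.
apply: (@ltn_sum_one (fun r => \dim (flag l r)) (fun r => \dim (flag (l + t *: m) r)) _ _ aN
  _ (hq2 _ q2t)).
have hspanR u : hspan e [seq p0.[u%:MP] | p0 <- rcons s D]
    = (flag (l + u *: m) b.+1 + <[hp e D.[u%:MP]]>)%VS.
  by rewrite map_rcons -cats1 hspan_cat -hs /hspan /= span_seq1.
have := hq1 _ q1t; rewrite !hspanR scale0r addr0 => h1.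
have <- : (flag (l + t *: m) b.+1 + <[hp e D.[t%:MP]]>)%VS = flag (l + t *: m) b.+1.
  by apply/addv_idPl; rewrite -memvE DJ.
apply: leq_trans h1.
have notJ0 : hp e D.[0%:MP] \notin flag l b.+1.
  by rewrite D0 linearZ rpredZeq NE (negPf (natr_neq0 hk _)).
rewrite dimv_disjoint_sum ?dim_vline.
  by case: eqP notJ0 => [->|_ _]; rewrite ?mem0v // addn1.
apply/eqP; rewrite -subv0; apply/subvP=> v; rewrite memv_cap memv0.
case/andP=> vJ /vlineP[c vE]; move: vJ; rewrite vE rpredZeq (negPf notJ0).
by rewrite orbF => /eqP->; rewrite scale0r.
Qed.
End Flag.

(** The quotients f / l_i without division: this makes sense for zero or repeated factors and
    commutes with ring morphisms. *)
Fixpoint cofactors (A : comNzRingType) (ls : seq A) : seq A :=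
  if ls is x :: ls' then \prod_(y <- ls') y :: [seq x * g | g <- cofactors ls'] else [::].

Lemma size_cofactors (A : comNzRingType) (ls : seq A) : size (cofactors ls) = size ls.
Proof. by elim: ls => //= x ls IH; rewrite size_map IH. Qed.

Lemma nth_cofactors (A : comNzRingType) (ls : seq A) i : (i < size ls)%N ->
  ls`_i * (cofactors ls)`_i = \prod_(y <- ls) y.
Proof.
elim: ls i => // x ls IH [|i] /= hi; rewrite big_cons //.
by rewrite (nth_map 0) ?size_cofactors // mulrCA IH.
Qed.

Lemma map_cofactors (A B : comNzRingType) (f : {rmorphism A -> B}) (ls : seq A) :
  map f (cofactors ls) = cofactors (map f ls).
Proof.
elim: ls => //= x ls IH; rewrite -IH -!map_comp big_map rmorph_prod; congr (_ :: _).
by apply: eq_map => g /=; rewrite rmorphM.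
Qed.

Section Homogenize.
Variables (A : comNzRingType) (l : A).
Implicit Types (ms : seq A) (P Q : {poly A}).

(** [P] is [Q] homogenised in degree [N] by powers of [l]. The size bounds make the coefficients of
    index [N.+1] vanish, which the product rule [relM] needs. *)
Let rel N P Q := (size Q <= N.+1)%N /\ (forall r, (r <= N)%N -> P`_r = l ^+ (N - r) * Q`_r)
   /\ (size P <= N.+1)%N.

Let relM N P Q m : rel N P Q -> rel N.+1 ((l%:P + m *: 'X) * P) ((1 + m *: 'X) * Q).
Proof.
move=> [sQ [h sP]].
have szM c (R0 : {poly A}) : (size R0 <= N.+1)%N -> (size ((c%:P + m *: 'X) * R0)%R <= N.+2)%N.
  move=> sR; apply: (leq_trans (size_polyMleq _ _)).
  have : (size (c%:P + m *: 'X)%R <= 2)%N.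
    rewrite (leq_trans (size_polyD _ _)) // geq_max.
    by rewrite (leq_trans (size_polyC_leq1 _)) // (leq_trans (size_scale_leq _ _)) ?size_polyX.
  by lia.
split; first by rewrite -polyC1 szM.
split; last exact: szM.
move=> r rN; rewrite !mulrDl !coefD -!scalerAl !coefZ !coefXM coefCM mul1r.
case: r rN => [|r] rN /=.
  by rewrite h // !subn0 exprS !mulr0 !addr0 mulrA.
rewrite (h r) // subSS; case: (ltnP r N) => rN'.
  by rewrite (h r.+1) // -(subnSK rN') exprS; ring.
have -> : r = N by apply/eqP; rewrite eqn_leq rN' -ltnS rN.
rewrite ![_`_N.+1]nth_default // subnn; ring.
Qed.

Lemma prod_homogenize ms :
  rel (size ms) (\prod_(m <- ms) (l%:P + m *: 'X)) (\prod_(m <- ms) (1 + m *: 'X)).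
Proof.
elim: ms => [|m ms IH]; last by rewrite !big_cons; apply: relM.
by rewrite !big_nil; split; rewrite ?size_poly1 //; split=> // -[|//] _; rewrite mul1r.
Qed.

Lemma cofactors_homogenize e ms i : size ms = e.+1 -> (i < e.+1)%N ->
  forall r, (r <= e)%N ->
  ((cofactors [seq l%:P + m *: 'X | m <- ms])`_i)`_r =
  l ^+ (e - r) * ((cofactors [seq 1 + m *: 'X | m <- ms])`_i)`_r.
Proof.
suff : size ms = e.+1 -> (i < e.+1)%N ->
    rel e ((cofactors [seq l%:P + m *: 'X | m <- ms])`_i) ((cofactors [seq 1 + m *: 'X | m <-
      ms])`_i).
  by move=> h /h{}h /h[_ []].
elim: ms e i => [|m ms IH] e i //= [sz]; case: i => [|i] /=.
  by rewrite !big_map -sz => _; exact: prod_homogenize.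
case: e sz => [|e] sz; rewrite ltnS // => ie.
rewrite !(nth_map 0) ?size_cofactors ?size_map ?sz //; apply: relM; exact: IH.
Qed.

(** Truncated geometric series of 1 / (1 + m_i X). It separates the omitted factor, which enters
    through its powers only, from the product common to all i. *)
Lemma cofactors_geometric ms i r : (i < size ms)%N ->
  ((cofactors [seq 1 + m *: 'X | m <- ms])`_i)`_r =
  \sum_(s < r.+1) (- ms`_i) ^+ s * (\prod_(m <- ms) (1 + m *: 'X))`_(r - s).
Proof.
move=> hi; set P := \prod_(m <- ms) _; set G := (cofactors _)`_i.
have GE : (1 + ms`_i *: 'X) * G = P.
  have := @nth_cofactors _ [seq 1 + m *: 'X | m <- ms] i; rewrite size_map big_map.
  by rewrite (nth_map 0) //; apply.
elim: r => [|r IH].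
  rewrite big_ord1 expr0 mul1r subn0 -GE mulrDl mul1r coefD -scalerAl coefZ coefXM.
  by rewrite mulr0 addr0.
rewrite big_ord_recl expr0 mul1r subn0.
have : P`_r.+1 = G`_r.+1 + ms`_i * G`_r.
  by rewrite -GE mulrDl mul1r coefD -scalerAl coefZ coefXM.
move=> ->; rewrite IH mulr_sumr.
under [X in _ + X]eq_bigr => s _ do rewrite lift0 exprS subSS -mulrA mulNr.
by rewrite sumrN addrK.
Qed.
End Homogenize.

Section Delta.
Variables (k : fieldType) (V : vectType k) (N : nat) (r : 'I_N).

Definition delta_ffun (v : V) : {ffun 'I_N -> V} :=
  [ffun r' => if r' == r then v else 0].

Lemma delta_ffun_linear : linear delta_ffun.
Proof.
move=> c u v; apply/ffunP=> r'; rewrite !ffunE; case: eqP => // _.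
by rewrite scaler0 addr0.
Qed.
HB.instance Definition _ :=
  GRing.isLinear.Build k V {ffun 'I_N -> V} _ delta_ffun delta_ffun_linear.

Lemma delta_ffun_ker : lker (linfun delta_ffun) == 0%VS.
Proof.
apply/lker0P=> u v; rewrite !lfunE => /ffunP/(_ r).
by rewrite !ffunE eqxx.
Qed.
End Delta.

Section GenericPoints.
Variables (k : fieldType) (hk : [pchar k] =i pred0) (n e : nat).
Notation R := {mpoly k[n.+1]}.
Notation H e := (dhomog n.+1 k e).
Notation Y := {ffun 'I_e.+1 -> H e}.
Variables (U : {vspace H e}) (l : R).
Hypothesis hl : l \is 1.-homog.

Let modJ r := daddv_pi ((flag U l r)^C)%VS (flag U l r).

Let Gam (m : R) : Y :=
  [ffun r : 'I_e.+1 => modJ r (hp e (l ^+ (e - r) * m ^+ r))].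

Let del (r : 'I_e.+1) : 'Hom(H e, Y) := (linfun (delta_ffun r) \o modJ r)%VF.

Lemma delE r v r' : del r v r' = if r' == r then modJ r v else 0.
Proof. by rewrite comp_lfunE lfunE ffunE. Qed.

(** Replacing m by t m separates the components r, since component r of [Gam] has degree r in m. By
    polarisation [S] then contains all of l^(e - r) R_r modulo step r, that is, a copy of step r + 1
    modulo step r, for each r; the dimensions telescope to that of [H e] modulo [U]. *)
Lemma graded_span (S : {vspace Y}) :
  (forall m, m \is 1.-homog -> Gam m \in S) -> (\dim {:H e} <= \dim U + \dim S)%N.
Proof.
move=> hS.
have delS r p : p \is (val r).-homog -> del r (hp e (l ^+ (e - r) * p)) \in S.
  rewrite memv_preim; move: p; apply: (powers_span hk) => m hm.
  rewrite -memv_preim.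
  pose c i := del (inord i) (hp e (l ^+ (e - i) * m ^+ i)).
  have := @curve_coef_mem _ hk _ S c e.+1 _ r (ltn_ord r).
  rewrite /c inord_val; apply => t.
  have := hS (t *: m) (dhomogZ t hm); congr (_ \in S).
  apply/ffunP=> j; rewrite sum_ffunE !ffunE.
  rewrite (bigD1 j) //= big1 ?addr0 => [|i ij]; rewrite ffunE delE inord_val.
    by rewrite eqxx exprZn -scalerAr !linearZ.
  by rewrite eq_sym (negPf ij) scaler0.
suff Hr r : (r <= e.+1)%N -> exists B : {vspace Y}, [/\ (B <= S)%VS,
    forall v, v \in B -> forall r' : 'I_e.+1, (r <= r')%N -> v r' = 0
    & (\dim U + \dim B)%N = \dim (flag U l r)].
  have [B [BS _ BJ]] := Hr _ (leqnn _); rewrite -(flag_top U l) -BJ.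
  by rewrite leq_add2l dimvS.
elim: r => [|r IH] re.
  by exists 0%VS; split=> [||]; rewrite ?sub0v ?dimv0 ?addn0 ?flag0 // => v;
    rewrite memv0 => /eqP-> r' _; rewrite ffunE.
have [B [BS Bz Bd]] := IH (ltnW re).
pose i := Ordinal re; pose A := (del i @: flag U l r.+1)%VS.
have Az v : v \in A -> forall r', r' != i -> v r' = 0.
  by case/memv_imgP=> u _ -> r' /negPf ne; rewrite delE ne.
exists (B + A)%VS; split.
- rewrite subv_add BS /=; apply/subvP=> v /memv_imgP[u].
  rewrite flagS => /memv_addP[u1 u1U [w /limg_mulf_ex[q hq ->] ->]] ->.
  rewrite linearD /= memvD ?delS //.
  rewrite comp_lfunE; have -> : modJ i u1 = 0.
    by apply/eqP; rewrite modv_eq0 (subvP (sub_flag _ _ _)).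
  by rewrite linear0 mem0v.
- move=> v /memv_addP[b bB [a' aA ->]] r' rr'; rewrite ffunE.
  rewrite (Bz b bB) ?(ltnW rr') // (Az _ aA) ?addr0 //.
  by apply: contraTneq rr' => ->; rewrite -leqNgt.
rewrite dimv_disjoint_sum; last first.
  apply/eqP; rewrite -subv0; apply/subvP=> v; rewrite memv_cap memv0.
  case/andP=> vB vA; apply/eqP/ffunP=> r'; rewrite [RHS]ffunE.
  by case: (r' =P i) => [->|/eqP/(Az _ vA)//]; exact: (Bz _ vB).
rewrite addnA Bd /A limg_comp limg_dim_eq; last first.
  by rewrite (eqP (delta_ffun_ker _ _)) capv0.
rewrite -[RHS](limg_ker_dim (modJ r)); congr (_ + _)%N.
have -> : lker (modJ r) = flag U l r.
  by apply/vspaceP=> v; rewrite memv_ker modv_eq0.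
by congr (\dim _); apply/esym/capv_idPr; exact: flag_sub.
Qed.

(** The m_i are chosen greedily with independent [Gam]; [graded_span] says that this can go on until
    the codimension of [U] is reached. The conclusion is this independence, read component by
    component. *)
Lemma generic_points : exists2 ms : seq R,
    size ms = (\dim {:H e} - \dim U)%N /\ all (fun m => m \is 1.-homog) ms
  & forall c : nat -> k,
    (forall r, (r <= e)%N -> hp e (l ^+ (e - r) * \sum_(i < size ms) c i *: ms`_i ^+ r)
      \in flag U l r) -> forall i, (i < size ms)%N -> c i = 0.
Proof.
suff Hi i : (i <= \dim {:H e} - \dim U)%N -> exists2 ms : seq R,
    size ms = i /\ all (fun m => m \is 1.-homog) ms & free (map Gam ms).
  have [ms [sz hom] fr] := Hi _ (leqnn _); exists ms => // c hc i im.
  have hfr : forall b : 'I_(size (map Gam ms)) -> k,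
      \sum_j b j *: (map Gam ms)`_j = 0 -> forall j, b j = 0.
    by have /freeP := fr : free (in_tuple (map Gam ms)).
  have im' : (i < size (map Gam ms))%N by rewrite size_map.
  rewrite -[c i]/((fun j : 'I_(size (map Gam ms)) => c j) (Ordinal im')).
  apply: hfr; apply/ffunP=> r; rewrite sum_ffunE ffunE.
  transitivity (modJ r (hp e (l ^+ (e - r) * \sum_(j < size ms) c j *: ms`_j ^+ r))).
    rewrite mulr_sumr !linear_sum size_map; apply: eq_bigr => j _.
    by rewrite ffunE (nth_map 0) // ffunE -scalerAr !linearZ.
  by apply/eqP; rewrite modv_eq0; exact: (hc r (ltn_ord r)).
elim: i => [|i IH] hi; first by exists [::] => //; rewrite nil_free.
have [ms [sz hom] fr] := IH (ltnW hi).
case: (classic (exists2 m, m \is 1.-homog & Gam m \notin <<map Gam ms>>%VS)).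
  case=> m hm mS; exists (m :: ms); first by rewrite /= sz hm hom.
  by rewrite /= free_cons mS fr.
move=> no; have : (\dim {:H e} <= \dim U + \dim <<map Gam ms>>)%N.
  apply: graded_span => m hm; apply/negPn/negP=> mS; apply: no; by exists m.
have := dim_span (map Gam ms); rewrite size_map sz; move: (\dim _) => x.
move: hi; move: (\dim U) (\dim _) => y z; lia.
Qed.
End GenericPoints.

(** A nonzero kernel vector over k[X], divided by the largest power of X common to its entries. *)
Lemma kernel_vector_at0 (k : fieldType) N (M : 'M[{poly k}]_N) : \det M = 0 ->
  exists2 v : 'rV[{poly k}]_N, v *m M = 0 & exists i, (v 0 i)`_0 != 0.
Proof.
move/eqP/det0P=> [v v0 vM].
have [i vi] : exists i, v 0 i != 0.
  apply/existsP; apply: contraNT v0; rewrite negb_exists => /forallP h.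
  by apply/eqP/rowP=> i; rewrite mxE; apply/eqP; have := h i; rewrite negbK.
have [s] : exists s, (size (v 0%R i) <= s)%N by exists (size (v 0 i)).
elim: s v {v0} vM vi => [|s IH] v vM vi hs.
  by move: vi; rewrite -size_poly_gt0 lt0n -leqn0 hs.
case: (boolP [exists j, (v 0 j)`_0 != 0]) => [/existsP h|].
  by exists v.
rewrite negb_exists => /forallP h.
pose w : 'rV[{poly k}]_N := \row_j drop_poly 1 (v 0 j).
have vw : v = 'X *: w.
  apply/rowP=> j; rewrite !mxE; have := h j; rewrite negbK => /eqP v0.
  apply/polyP=> -[|u]; first by rewrite coefXM v0.
  by rewrite coefXM coef_drop_poly addn1.
apply: (IH w).
- apply/rowP=> j; move/rowP/(_ j): vM; rewrite vw -scalemxAl !mxE => /eqP.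
  by rewrite mulf_eq0 polyX_eq0 => /eqP.
- by apply: contraNneq vi => w0; rewrite vw mxE w0 mulr0.
by rewrite mxE size_drop_poly; lia.
Qed.

Lemma coef_prod_homog (k : fieldType) n (ms : seq {mpoly k[n]}) :
  all (fun m => m \is 1.-homog) ms ->
  forall u, (\prod_(m <- ms) (1 + m *: 'X))`_u \is u.-homog.
Proof.
elim: ms => [|m ms IH] /=.
  by move=> _ u; rewrite big_nil coef1; case: u => [|u]; rewrite ?dhomog1 ?rpred0.
case/andP=> hm hms u; rewrite big_cons mulrDl mul1r coefD -scalerAl coefZ coefXM.
rewrite rpredD ?IH //; case: u => [|u] /=; first by rewrite mulr0 rpred0.
by apply: homogS => //; exact: IH.
Qed.

Section StarCore.
Variables (k : fieldType) (hk : [pchar k] =i pred0) (n e : nat).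
Notation R := {mpoly k[n.+1]}.
Notation H e := (dhomog n.+1 k e).
Variables (U : {vspace H e}).

Lemma flag_mono l r s : l \is 1.-homog -> (r <= s)%N -> (s <= e.+1)%N ->
  (flag U l r <= flag U l s)%VS.
Proof.
move=> hl; elim: s => [|s IH]; first by rewrite leqn0 => /eqP->; rewrite subvv.
rewrite leq_eqVlt => /predU1P[->|rs] se; first exact: subvv.
by apply: subv_trans (IH rs (ltnW se)) (flag_sub _ hl _).
Qed.

Lemma flag_closure_iter l w b E p : flag_max U l -> (w + b <= e)%N ->
  E \is b.-homog -> p \is w.-homog -> hp e (l ^+ (e - w) * p) \in flag U l w ->
  hp e (l ^+ (e - (w + b)) * (E * p)) \in flag U l (w + b).
Proof.
move=> hl; move: E; move=> E abe hE hp0 hJ; move: E hE.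
apply: monomial_homog_ind.
- by move=> E1 E2 h1 h2; rewrite mulrDl mulrDr linearD memvD.
- by move=> c E1 h1; rewrite -!scalerAl -scalerAr linearZ memvZ.
- by rewrite mul0r mulr0 linear0 mem0v.
move=> ls sz; elim: ls b sz w p abe hp0 hJ => [|x ls IH] b /= <- w p abe hp0 hJ.
  by rewrite big_nil mul1r addn0.
case/andP=> hx hls; rewrite big_cons [x * _]mulrC -mulrA addnS -addSn.
apply: IH => //.
- by rewrite addSn -addnS.
- exact: homogS.
by apply: flag_closure => //; move: abe; rewrite addnS => /(leq_trans _) -> //;
  rewrite ltnS leq_addr.
Qed.

(* The ls are l + t m_i with l and the m_i given by flag_max_exists and
   generic_points. If they failed for every t, there would be a linear relation
   with coefficients in k[t] modulo U between the cofactors, nonzero at t = 0;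
   its coefficient of t^r shows inductively that the values at 0 satisfy the
   r-th condition of generic_points. *)
Lemma star_core : (\dim U + e.+1)%N = \dim {:H e} ->
  exists2 ls : seq R, size ls = e.+1 /\ all (fun m => m \is 1.-homog) ls
  & (U + hspan e (cofactors ls))%VS = fullv.
Proof.
move=> dU.
have [l hl] := flag_max_exists U; have hl1 := hl.1.
have [ms [sz hom] hgen] := generic_points hk U hl1.
have {}sz : size ms = e.+1 by rewrite sz -dU addKn.
pose lcs : seq {poly R} := [seq l%:P + m *: 'X | m <- ms].
pose P := daddv_pi (U^C)%VS U.
have dUC : \dim (U^C)%VS = e.+1 by rewrite dimv_compl -dU addKn.
pose X : e.+1.-tuple (H e) := tcast dUC (vbasis (U^C)%VS).
have hX : basis_of (U^C)%VS X by rewrite /X val_tcast vbasisP.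
have PX v : P v = 0 <-> forall j, coord X j (P v) = 0.
  split=> [-> j|h]; first by rewrite linear0.
  rewrite (coord_basis hX (memv_pi _ _ v)) big1 // => j _.
  by rewrite h scale0r.
pose M : 'M[{poly k}]_e.+1 :=
  \matrix_(i, j) map_poly (fun b => coord X j (P (hp e b))) (cofactors lcs)`_i.
case: (eqVneq (\det M) 0) => [/kernel_vector_at0[v vM [i0 vi0]]|dM].
  exfalso; pose c i := (v 0 (inord i))`_0.
  pose sg r := \sum_(i < e.+1) (v 0 i)`_0 *: ms`_i ^+ r.
  have hms i : (i < e.+1)%N -> ms`_i \is 1.-homog.
    by move=> ie; apply: (allP hom); rewrite mem_nth ?sz.
  have homsg s : sg s \is s.-homog.
    rewrite rpred_sum // => i _; rewrite rpredZ //.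
    by have := dhomogMn s (hms _ (ltn_ord i)); rewrite mul1n.
  pose G (i : 'I_e.+1) := (cofactors lcs)`_i.
  pose G1 (i : 'I_e.+1) := (cofactors [seq 1 + m *: 'X | m <- ms])`_i.
  pose E0 := \prod_(m <- ms) (1 + m *: 'X).
  have GE i r : (r <= e)%N -> (G i)`_r = l ^+ (e - r) * (G1 i)`_r.
    by move=> re; exact: (cofactors_homogenize l sz (ltn_ord i) re).
  have G1E i r : (G1 i)`_r = \sum_(s < r.+1) (- ms`_i) ^+ s * E0`_(r - s).
    by rewrite /G1 cofactors_geometric ?sz.
  have G1h i r : (G1 i)`_r \is r.-homog.
    rewrite G1E rpred_sum // => s _.
    have h1 : (- ms`_i) ^+ s \is (val s).-homog.
      by have := dhomogMn s (_ : - ms`_i \is 1.-homog);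
        rewrite mul1n; apply; rewrite rpredN hms.
    have := dhomogM h1 (coef_prod_homog hom (r - s)).
    by rewrite (subnKC (ltn_ord s : (s <= r)%N)).
  (* The coefficient of t^r of the relation. Its terms with w < r carry the factor l^(e - w), so
     they lie in step r of the flag, and the term w = r, which is [A r] below, must lie there
     too. *)
  have idr r : hp e (\sum_i \sum_(w < r.+1) (v 0 i)`_(r - w) *: (G i)`_w) \in U.
    rewrite -modv_eq0; apply/eqP; apply/(PX _).2 => j.
    have := congr1 (fun A : 'rV[{poly k}]_e.+1 => (A 0 j)`_r) vM.
    rewrite !mxE coef0 coef_sum => h0; apply: etrans h0; rewrite !linear_sum /=.
    apply: eq_bigr => i _; rewrite coefMr !linear_sum /=; apply: eq_bigr => w _.
    rewrite mxE coef_map_id0 ?linear0 //.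
    by rewrite !linearZ.
  have K : forall r, (r <= e)%N -> hp e (l ^+ (e - r) * sg r) \in flag U l r.
    move=> r; elim/ltn_ind: r => r IH re.
    pose A w := \sum_i (v 0 i)`_(r - w) *: (G i)`_w.
    have hA w : (w < r)%N -> hp e (A w) \in flag U l r.
      move=> wr; rewrite /A linear_sum; apply: memv_suml => i _.
      rewrite linearZ; apply: memvZ.
      have we : (w <= e)%N by exact: leq_trans (ltnW wr) re.
      rewrite (GE i w we); apply: (subvP (flag_mono hl1 wr (leqW re))).
      by apply: mem_flag; exact: G1h.
    have h1 : hp e (A r) \in flag U l r.
      have := subvP (sub_flag U l r) _ (idr r).
      rewrite exchange_big big_ord_recr /= linearD linear_sum => h.
      have hs : \sum_(w < r) hp e (A w) \in flag U l r.
        by apply: memv_suml => w _; exact: hA (ltn_ord w).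
      rewrite -[hp e (A r)](addKr (\sum_(w < r) hp e (A w))) addrC.
      exact: memvB h hs.
    (* [A r] regrouped by the power of m_i in the geometric series. For w < r the induction
       hypothesis, multiplied by the coefficient of degree r - w of [E0], puts [B w] in step r; what
       remains is [sg r] times l^(e - r), up to sign, as [E0] has constant term 1. *)
    pose B w := (-1) ^+ w *: hp e (l ^+ (e - r) * (E0`_(r - w) * sg w)).
    have AE : hp e (A r) = \sum_(w < r.+1) B w.
      rewrite /A subnn.
      rewrite (eq_bigr (fun i => \sum_(w < r.+1) (v 0 i)`_0 *:
         (l ^+ (e - r) * ((- ms`_i) ^+ w * E0`_(r - w))))); last first.
        by move=> i _; rewrite (GE i r re) G1E mulr_sumr scaler_sumr.
      rewrite exchange_big linear_sum; apply: eq_bigr => w _.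
      rewrite /B /sg !mulr_sumr !linear_sum; apply: eq_bigr => i _.
      rewrite -[RHS]linearZ /=; congr (hp e _).
      rewrite -scaleN1r exprZn -scalerAl -!scalerAr !scalerA mulrC.
      by congr (_ *: (_ * _)); rewrite mulrC.
    have hB w : (w < r)%N -> B w \in flag U l r.
      move=> wr; rewrite /B; apply: memvZ.
      have E1 : (w + (r - w) = r)%N by exact: subnKC (ltnW wr).
      have := @flag_closure_iter l w (r - w) (E0`_(r - w)) (sg w) hl.
      rewrite E1; apply=> //; first exact: coef_prod_homog.
      by apply: IH => //; exact: leq_trans (ltnW wr) re.
    have : B r \in flag U l r.
      move: h1; rewrite AE big_ord_recr /= => h.
      have hs : \sum_(w < r) B w \in flag U l r.
        by apply: memv_suml => w _; exact: hB (ltn_ord w).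
      rewrite -[B r](addKr (\sum_(w < r) B w)) addrC.
      exact: memvB h hs.
    have E00 : E0`_0 = 1 by rewrite /E0 coef0_prod big1 // => m _;
      rewrite coefD coef1 coefZ coefX mulr0 addr0.
    by rewrite /B subnn E00 mul1r rpredZsign.
  move: hgen; rewrite sz => hgen.
  have hc r : (r <= e)%N -> hp e (l ^+ (e - r) * \sum_(i < e.+1) c i *: ms`_i ^+ r) \in flag
    U l r.
    have -> : \sum_(i < e.+1) c i *: ms`_i ^+ r = sg r; last exact: K.
    by apply: eq_bigr => i _; rewrite /c inord_val.
  by have := hgen c hc i0 (ltn_ord i0); rewrite /c inord_val; exact/eqP.
have [t] := poly_nonroot hk dM; rewrite -/(horner_eval t _) -det_map_mx => dMt.
pose ls := [seq l + t *: m | m <- ms].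
have lsE : ls = map (horner_eval t%:MP) lcs.
  rewrite -map_comp; apply: eq_map => m; rewrite /= /horner_eval !hornerE.
  by rewrite [m * _]mulrC mul_mpolyC.
have sls : size ls = e.+1 by rewrite size_map.
exists ls; first split=> //.
  by apply/allP=> y /mapP[m mm ->]; rewrite rpredD ?rpredZ // (allP hom).
pose Q := (U + hspan e (cofactors ls))%VS.
apply/eqP; rewrite eqEdim subvf /= -/Q -dU.
have ker : lker P = U by apply/vspaceP=> v; rewrite memv_ker modv_eq0.
rewrite -(limg_ker_dim P Q) ker; apply: leq_add.
  by apply: dimvS; rewrite subv_cap addvSl subvv.
pose Y := [tuple P (hp e (cofactors ls)`_i) | i < e.+1].
have frY : free Y.
  apply/freeP=> b hb.
  have : (\row_i b i) *m map_mx (horner_eval t) M = 0.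
    apply/rowP=> j; rewrite !mxE; move/(congr1 (coord X j)): hb.
    rewrite linear0 linear_sum => h0; apply: etrans h0; apply: eq_bigr => i _.
    rewrite !mxE -tnth_nth tnth_mktuple linearZ /=; congr (_ * _).
    rewrite lsE -map_cofactors (nth_map 0); last first.
      by rewrite size_cofactors size_map sz.
    rewrite /= /horner_eval /map_poly horner_poly horner_coef !linear_sum /=.
    apply: eq_bigr => u _; rewrite -rmorphXn mulrC [in RHS]mulrC mul_mpolyC.
    by rewrite !linearZ.
  have uM : map_mx (horner_eval t) M \in unitmx by rewrite unitmxE unitfE.
  move/(canRL (mulmxK uM)); rewrite mul0mx => /rowP b0 i.
  by have := b0 i; rewrite !mxE.
have := frY; rewrite /free size_tuple => /eqP <-.
apply: dimvS; apply/span_subvP=> y /tnthP[i ->]; rewrite tnth_mktuple memv_img //.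
apply: (subvP (addvSr _ _)); apply: memv_span; rewrite map_f // mem_nth //.
by rewrite size_cofactors sls.
Qed.
End StarCore.

Lemma dim_homog (k : fieldType) n e : \dim {:dhomog n.+1 k e} = 'C(e + n, n).
Proof. by rewrite dimvf -[RHS]bin_sub ?leq_addl // addnK. Qed.

Lemma subspace_between (k : fieldType) (V : vectType k) (U : {vspace V}) m :
  (\dim U <= m)%N -> (m <= \dim {:V})%N ->
  exists2 W : {vspace V}, (U <= W)%VS & \dim W = m.
Proof.
move=> Um mV; pose W := <<take m (vbasis U ++ vbasis (U^C))>>%VS.
have fr : free (vbasis U ++ vbasis (U^C)).
  rewrite cat_free !(basis_free (vbasisP _)) /=.
  by apply/directv_addP; rewrite !(span_basis (vbasisP _)) capv_compl.
exists W.
  rewrite /W take_cat size_tuple ltnNge Um /= span_cat (span_basis (vbasisP _)).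
  exact: addvSl.
rewrite /W; have fr' : free (take m (vbasis U ++ vbasis (U^C))).
  by move: fr; rewrite -{1}(cat_take_drop m (vbasis U ++ vbasis (U^C))) => /catl_free.
move: fr'; rewrite /free => /eqP ->; rewrite size_takel // size_cat !size_tuple.
by rewrite dimv_compl subnKC // dimvS ?subvf.
Qed.

Lemma subspace_below (k : fieldType) (V : vectType k) (U : {vspace V}) m :
  (m <= \dim U)%N -> exists2 W : {vspace V}, (W <= U)%VS & \dim W = m.
Proof.
move=> mU; exists <<take m (vbasis U)>>%VS.
  have h : (<<take m (vbasis U)>> <= <<vbasis U>>)%VS.
    by apply: sub_span => x; exact: mem_take.
  by apply: subv_trans h _; rewrite (span_basis (vbasisP U)) subvv.
have: free (take m (vbasis U)).
  by have := basis_free (vbasisP U); rewrite -{1}(cat_take_drop m (vbasis U)) => /catl_free.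
by rewrite /free => /eqP ->; rewrite size_takel // size_tuple.
Qed.

Lemma leq_binS e n : (e.+1 <= 'C(e + n.+1, n.+1))%N.
Proof.
elim: n => [|n IH]; first by rewrite bin1 addn1.
by rewrite addnS binS; exact: leq_trans IH (leq_addl _ _).
Qed.

Section Stars.
Variables (k : fieldType) (hk : [pchar k] =i pred0) (n e : nat).
Notation R := {mpoly k[n.+2]}.
Notation H e := (dhomog n.+2 k e).

(** Reduction to dim U + e + 1 = dim H: a larger [U] is replaced by a subspace, a smaller one by a
    larger space [W]; in the latter case the sum with [W] is direct, hence so is the sum with [U].
    With at least two variables, dim H is at least e + 1. *)
Lemma star_general (U : {vspace H e}) : exists2 ls : seq R,
  size ls = e.+1 /\ all (fun m => m \is 1.-homog) ls
  & (minn (\dim {:H e}) (\dim U + e.+1) <= \dim (U + hspan e (cofactors ls)))%N.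
Proof.
have hD : (e.+1 <= \dim {:H e})%N.
  by rewrite dim_homog; exact: leq_binS.
case: (leqP (\dim {:H e}) (\dim U + e.+1)) => [le1|/ltnW le1].
  have [W WU dW] : exists2 W : {vspace H e}, (W <= U)%VS & \dim W = (\dim {:H e} - e.+1)%N.
    by apply: subspace_below; rewrite leq_subLR addnC.
  have [ls hls full] := star_core hk (etrans (congr1 (addn^~ _) dW) (subnK hD)).
  exists ls => //; rewrite -full; apply: dimvS; exact: addvS.
have [W UW dW] : exists2 W : {vspace H e}, (U <= W)%VS & \dim W = (\dim {:H e} - e.+1)%N.
  apply: subspace_between; last exact: leq_subr.
  by rewrite leq_subRL // addnC.
have hW := etrans (congr1 (addn^~ e.+1) dW) (subnK hD).
have [ls hls full] := star_core hk hW.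
exists ls => //.
have sB : (\dim (hspan e (cofactors ls)) <= e.+1)%N.
  by apply: leq_trans (dim_span _) _; rewrite size_map size_cofactors hls.1.
have h1 := dimv_sum_cap W (hspan e (cofactors ls)); rewrite full -hW in h1.
have cap0 : (W :&: hspan e (cofactors ls))%VS = 0%VS.
  apply/eqP; rewrite -dimv_eq0; move: h1 sB.
  by move: (\dim (W :&: _)) (\dim (hspan _ _)) (\dim W) => x y z; clear; lia.
rewrite dimv_disjoint_sum; last first.
  apply/eqP; rewrite -subv0 -cap0; apply: capvS => //; exact: subvv.
rewrite leq_add2l; move: h1; rewrite cap0 dimv0.
by move: (\dim (hspan _ _)) (\dim W) => x y; clear; lia.
Qed.
End Stars.

(** Products of linear forms span all forms, so a proper subspace cannot contain all of them. If [U]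
    is everything, any product will do. *)
Lemma product_outside (k : fieldType) n e (U : {vspace dhomog n.+1 k e}) :
  exists2 ls : seq {mpoly k[n.+1]}, size ls = e /\ all (fun m => m \is 1.-homog) ls
  & (minn (\dim {:dhomog n.+1 k e}) (\dim U).+1
     <= \dim (U + hspan e [:: (\prod_(l <- ls) l)%R]))%N.
Proof.
case: (classic (exists2 ls : seq {mpoly k[n.+1]},
  size ls = e /\ all (fun m => m \is 1.-homog) ls & hp e (\prod_(l <- ls) l) \notin U)).
  case=> ls hls notU; exists ls => //; rewrite geq_min; apply/orP; right.
  rewrite /hspan /= span_seq1 ltnNge; apply: contra notU => le1.
  have /eqP E : U == (U + <[hp e (\prod_(l <- ls) l)]>)%VS by rewrite eqEdim addvSl.
  by rewrite E; apply: (subvP (addvSr _ _)); exact: memv_line.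
move=> no; exists (nseq e 'X_ord0).
  rewrite size_nseq; split=> //; apply/allP=> x /nseqP[-> _].
  by rewrite dhomogX; apply/eqP; exact: mdeg1.
rewrite geq_min; apply/orP; left; apply: dimvS; apply: subv_trans (addvSl _ _).
apply/subvP=> v _; rewrite -(valK_hp v).
apply: (@monomial_homog_ind k n e (fun p => hp e p \in U)); last exact: dhomog_is_dhomog.
- by move=> p q; rewrite linearD; exact: memvD.
- by move=> c p; rewrite linearZ; exact: memvZ.
- by rewrite linear0 mem0v.
by move=> ls sz hom; apply/negPn/negP=> h; apply: no; exists ls.
Qed.

(** * Specialisation to a hyperplane *)

Definition tangent_gens (A : comNzRingType) (ys ls : seq A) :=
  [seq b * y | b <- cofactors ls, y <- ys].
Definition multiples (A : comNzRingType) (ys ls : seq A) :=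
  [seq (\prod_(l <- ls) l) * y | y <- ys].

(* For lists of linear forms: tangent spaces to the split variety (As), spans
   of the products omitting one form (Bs), multiples of a product (Cs) and single
   products (Ds). *)
Definition config_gens (A : comNzRingType) (ys : seq A) (As Bs Cs Ds : seq (seq A)) : seq A :=
  flatten (map (tangent_gens ys) As) ++ flatten (map (@cofactors A) Bs) ++
  flatten (map (multiples ys) Cs) ++ [seq \prod_(l <- ls) l | ls <- Ds].

Section MapGen.
Variables (A B : comNzRingType) (f : {rmorphism A -> B}).

Lemma map_tangent_gens ys ls : map f (tangent_gens ys ls) = tangent_gens (map f ys) (map f ls).
Proof.
rewrite /tangent_gens -map_cofactors [LHS]map_allpairs [RHS]allpairs_mapl [RHS]allpairs_mapr.
by apply: eq_allpairs => b y; rewrite rmorphM.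
Qed.

Lemma map_multiples ys ls : map f (multiples ys ls) = multiples (map f ys) (map f ls).
Proof.
by rewrite /multiples -!map_comp big_map -rmorph_prod; apply: eq_map => y /=; rewrite rmorphM.
Qed.

Lemma map_config_gens ys As Bs Cs Ds : map f (config_gens ys As Bs Cs Ds) =
  config_gens (map f ys) (map (map f) As) (map (map f) Bs) (map (map f) Cs) (map (map f) Ds).
Proof.
rewrite /config_gens !map_cat !map_flatten -!map_comp.
congr (flatten _ ++ (flatten _ ++ (flatten _ ++ _))); apply: eq_map => ls /=.
- exact: map_tangent_gens.
- exact: map_cofactors.
- exact: map_multiples.
- by rewrite big_map rmorph_prod.
Qed.
End MapGen.

Section Lines.
Variables (k : fieldType) (n : nat).
Notation R := {mpoly k[n.+1]}.

(** Both zips truncate, so the endpoints are recovered only for configurations of equal shape; this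
    is what the hypotheses of [line_at0] and [line_at1] ensure. *)
Definition line_at (t : k) (S S' : seq (seq R)) : seq (seq R) :=
  [seq [seq q.1 + t *: (q.2 - q.1) | q <- zip p.1 p.2] | p <- zip S S'].

Definition forms e (S : seq (seq R)) :=
  all (fun ls => (size ls == e) && all (fun l => l \is 1.-homog) ls) S.

Lemma forms_line_at t e S S' : forms e S -> forms e S' -> forms e (line_at t S S').
Proof.
elim: S S' => [|s S IH] [|s' S'] //= /andP[/andP[/eqP sz hs] hS] /andP[/andP[/eqP sz' hs'] hS'].
rewrite /line_at /= IH // andbT size_map size1_zip ?sz ?sz' ?eqxx //=.
clear IH hS hS'; elim: s s' e sz sz' hs hs' => [|l s IH] [|l' s'] //= e sz sz'.
case/andP=> hl hs /andP[hl' hs'].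
rewrite rpredD ?rpredZ ?rpredB //=.
by case: e sz sz' => // e [sz] [sz']; exact: (IH _ _ sz sz' hs hs').
Qed.

Lemma size_line_at t S S' : size S = size S' -> size (line_at t S S') = size S.
Proof. by move=> h; rewrite size_map size1_zip // h. Qed.

Lemma line_at0 e S S' : size S = size S' -> forms e S -> forms e S' -> line_at 0 S S' = S.
Proof.
rewrite /line_at; elim: S S' => [|s S IH] [|s' S'] //= [szS] /andP[/andP[/eqP sz _] hS]
  /andP[/andP[/eqP sz' _] hS'].
rewrite IH //; congr (_ :: _); move: sz'; rewrite -sz; clear.
elim: s s' => [|l s IH] [|l' s'] //= [sz].
by rewrite scale0r addr0 IH.
Qed.

Lemma line_at1 e S S' : size S = size S' -> forms e S -> forms e S' -> line_at 1 S S' = S'.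
Proof.
rewrite /line_at; elim: S S' => [|s S IH] [|s' S'] //= [szS] /andP[/andP[/eqP sz _] hS]
  /andP[/andP[/eqP sz' _] hS'].
rewrite IH //; congr (_ :: _); move: sz'; rewrite -sz; clear.
elim: s s' => [|l s IH] [|l' s'] //= [sz].
by rewrite scale1r addrC subrK IH.
Qed.

Lemma config_gens_open e ys As As' Bs Bs' Cs Cs' Ds Ds' a :
  exists2 q : {poly k}, q.[a] != 0 & forall t, q.[t] != 0 ->
  (\dim (hspan e (config_gens ys (line_at a As As') (line_at a Bs Bs') (line_at a Cs Cs')
    (line_at a Ds Ds')))
   <= \dim (hspan e (config_gens ys (line_at t As As') (line_at t Bs Bs') (line_at t Cs Cs')
     (line_at t Ds Ds'))))%N.
Proof.
pose LL (S S' : seq (seq R)) : seq (seq {poly R}) :=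
  [seq [seq q.1%:P + (q.2 - q.1) *: 'X | q <- zip p.1 p.2] | p <- zip S S'].
have LLE t S S' : line_at t S S' = map (map (horner_eval t%:MP)) (LL S S').
  rewrite /LL -map_comp; apply: eq_map => p /=; rewrite -map_comp; apply: eq_map => q /=.
  by rewrite /horner_eval !hornerE [_ * t%:MP]mulrC mul_mpolyC.
have ysE t : ys = map (horner_eval t%:MP) (map polyC ys).
  by rewrite -map_comp -[LHS]map_id; apply: eq_map => y /=; rewrite /horner_eval hornerC.
have GE t : config_gens ys (line_at t As As') (line_at t Bs Bs') (line_at t Cs Cs') (line_at
  t Ds Ds')
   = [seq p.[t%:MP] | p <- config_gens (map polyC ys) (LL As As') (LL Bs Bs') (LL Cs Cs') (LL
     Ds Ds')].
  by rewrite !LLE {1}(ysE t) -map_config_gens.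
have [q q0 hq] := hspan_open e (config_gens (map polyC ys) (LL As As') (LL Bs Bs') (LL Cs
  Cs') (LL Ds Ds')) a.
by exists q => // t /hq; rewrite -!GE.
Qed.

Lemma forms_cat e S S' : forms e (S ++ S') = forms e S && forms e S'.
Proof. exact: all_cat. Qed.

Lemma line_at_cat t S1 S2 S1' S2' : size S1 = size S1' ->
  line_at t (S1 ++ S2) (S1' ++ S2') = line_at t S1 S1' ++ line_at t S2 S2'.
Proof. by move=> h; rewrite /line_at zip_cat // map_cat. Qed.

Lemma prod_homog (s : seq R) : all (fun l => l \is 1.-homog) s ->
  \prod_(l <- s) l \is (size s).-homog.
Proof.
elim: s => [|l s IH] /=; first by rewrite big_nil dhomog1.
by case/andP=> hl hs; rewrite big_cons; apply: homogS => //; exact: IH.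
Qed.

Lemma cofactors_homog e (ls : seq R) g : size ls = e.+1 -> all (fun l => l \is 1.-homog) ls ->
  g \in cofactors ls -> g \is e.-homog.
Proof.
elim: ls e g => [|l ls IH] e g //= [sz] /andP[hl hls].
rewrite inE => /predU1P[->|]; first by rewrite -sz; exact: prod_homog.
case/mapP=> g' hg' ->; case: e sz => [|e] sz; last by apply: homogS => //; exact: IH hg'.
by move: hg'; rewrite (size0nil sz).
Qed.

Lemma config_gens_homog e ys As Bs Cs Ds p : all (fun l => l \is 1.-homog) ys ->
  forms e.+1 As -> forms e.+2 Bs -> forms e Cs -> forms e.+1 Ds ->
  p \in config_gens ys As Bs Cs Ds -> p \is e.+1.-homog.
Proof.
move=> hy hA hB hC hD; rewrite /config_gens !mem_cat => /or4P[].
- case/flatten_mapP=> ls /(allP hA)/andP[/eqP sz hls] /allpairsP[[b y] [/= hb hyy ->]].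
  rewrite mulrC; apply: homogS; first exact: (allP hy).
  exact: cofactors_homog sz hls hb.
- case/flatten_mapP=> ls /(allP hB)/andP[/eqP sz hls]; exact: cofactors_homog.
- case/flatten_mapP=> ls /(allP hC)/andP[/eqP sz hls] /mapP[y hyy ->].
  rewrite mulrC; apply: homogS; first exact: (allP hy).
  by rewrite -sz; exact: prod_homog.
- by case/mapP=> ls /(allP hD)/andP[/eqP sz hls] ->; rewrite -sz; exact: prod_homog.
Qed.
End Lines.

Definition xvars (k : fieldType) n : seq {mpoly k[n]} := [seq 'X_i | i <- enum 'I_n].

Lemma xvars_homog (k : fieldType) n : all (fun l => l \is 1.-homog) (xvars k n).
Proof. by apply/allP=> l /mapP[i _ ->]; rewrite dhomogX; apply/eqP; exact: mdeg1. Qed.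

(* In degree e, some sum of m tangent spaces to the split variety and c spaces
   g R_1, g a product of e - 1 linear forms, has dimension at least r. *)
Definition rank_attained (k : fieldType) n e m c r := exists As Cs : seq (seq {mpoly k[n.+1]}),
  [/\ size As = m, size Cs = c, forms e As, forms e.-1 Cs
    & (r <= \dim (hspan e (config_gens (xvars k n.+1) As [::] Cs [::])))%N].

Lemma zip_map2 (A B : Type) (f : A -> B) s s' :
  zip (map f s) (map f s') = [seq (f q.1, f q.2) | q <- zip s s'].
Proof. by elim: s s' => [|x s IH] [|x' s'] //=; rewrite IH. Qed.

Section Subst.
Variables (k : fieldType).

Lemma lrmorph_mpolyE n (A : comAlgType k) (f : {lrmorphism {mpoly k[n]} -> A}) p :
  f p = \sum_(m <- msupp p) p@_m *: \prod_i f 'X_i ^+ m i.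
Proof.
rewrite {1}[p]mpolyE linear_sum; apply: eq_bigr => m _.
rewrite linearZ /= mpolyXE_id rmorph_prod; congr (_ *: _).
by apply: eq_bigr => i _; rewrite rmorphXn.
Qed.

Lemma lrmorph_homog n m (f : {lrmorphism {mpoly k[n]} -> {mpoly k[m]}}) r p :
  (forall i, f 'X_i \is 1.-homog) -> p \is r.-homog -> f p \is r.-homog.
Proof.
move=> hf hp0; rewrite lrmorph_mpolyE big_seq rpred_sum // => u up.
rewrite rpredZ //; have <- : mdeg u = r by exact: (dhomog_mf hp0 up).
rewrite mdegE; elim/big_rec2: _ => [|i s q _ hq]; first exact: dhomog1.
by apply: dhomogM => //; have := dhomogMn (u i) (hf i); rewrite mul1n.
Qed.
End Subst.

Section Restriction.
Variables (k : fieldType) (n : nat).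
Notation R1 := {mpoly k[n.+1]}.
Notation R2 := {mpoly k[n.+2]}.

Definition restr_tuple : n.+2.-tuple R1 :=
  [tuple if unlift ord0 i is Some j then 'X_j else 0 | i < n.+2].
Definition restr : {lrmorphism R2 -> R1} := comp_mpoly restr_tuple.
Definition lift_tuple : n.+1.-tuple R2 := [tuple 'X_(lift ord0 j) | j < n.+1].
Definition liftp : {lrmorphism R1 -> R2} := comp_mpoly lift_tuple.

Lemma restr_X0 : restr 'X_ord0 = 0.
Proof. by rewrite /= comp_mpolyXU -tnth_nth tnth_mktuple unlift_none. Qed.

Lemma restr_XS j : restr 'X_(lift ord0 j) = 'X_j.
Proof. by rewrite /= comp_mpolyXU -tnth_nth tnth_mktuple liftK. Qed.

Lemma liftpX j : liftp 'X_j = 'X_(lift ord0 j).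
Proof. by rewrite /= comp_mpolyXU -tnth_nth tnth_mktuple. Qed.

Lemma liftpK : cancel liftp restr.
Proof.
move=> p; rewrite [liftp p]lrmorph_mpolyE linear_sum [RHS]mpolyE.
apply: eq_bigr => m _; rewrite linearZ /= mpolyXE_id; congr (_ *: _).
rewrite rmorph_prod; apply: eq_bigr => i _; rewrite rmorphXn.
by congr (_ ^+ _); have := restr_XS i; rewrite -liftpX.
Qed.

Lemma homogX m (i : 'I_m) : ('X_i : {mpoly k[m]}) \is 1.-homog.
Proof. by rewrite dhomogX; apply/eqP; exact: mdeg1. Qed.

Lemma restr_homog r p : p \is r.-homog -> restr p \is r.-homog.
Proof.
apply: lrmorph_homog => i; case: (unliftP ord0 i) => [j ->|->].
  by rewrite restr_XS; exact: homogX.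
by rewrite restr_X0 rpred0.
Qed.

Lemma liftp_homog r p : p \is r.-homog -> liftp p \is r.-homog.
Proof. by apply: lrmorph_homog => i; rewrite liftpX; exact: homogX. Qed.

Lemma restr_line_at t S S' : map (map restr) (line_at t S S') =
  line_at t (map (map restr) S) (map (map restr) S').
Proof.
rewrite /line_at zip_map2 -!map_comp; apply: eq_map => p /=.
rewrite zip_map2 -!map_comp; apply: eq_map => q /=.
by rewrite linearD linearZ linearB.
Qed.

Lemma forms_restr e S : forms e S -> forms e (map (map restr) S).
Proof.
rewrite /forms all_map; apply: sub_all => s /= /andP[/eqP sz hs].
rewrite size_map sz eqxx all_map /=; apply: sub_all hs => l; exact: restr_homog.
Qed.

Lemma forms_liftp e S : forms e S -> forms e (map (map liftp) S).
Proof.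
rewrite /forms all_map; apply: sub_all => s /= /andP[/eqP sz hs].
rewrite size_map sz eqxx all_map /=; apply: sub_all hs => l; exact: liftp_homog.
Qed.

Lemma restr_liftp (S : seq (seq R1)) : map (map restr) (map (map liftp) S) = S.
Proof.
rewrite -map_comp -[RHS]map_id; apply: eq_map => s /=.
by rewrite -map_comp -[RHS]map_id; apply: eq_map => l /=; exact: liftpK.
Qed.

Section Combine.
Variable e : nat.
Notation H1 := (dhomog n.+1 k).
Notation H2 := (dhomog n.+2 k).

Definition resh (u : H2 e.+2) : H1 e.+2 := hp e.+2 (restr (val u)).
Lemma resh_is_linear : linear resh.
Proof. by move=> c u v; rewrite /resh !linearP. Qed.
HB.instance Definition _ :=
  GRing.isLinear.Build k (H2 e.+2) (H1 e.+2) _ resh resh_is_linear.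

(** Rank-nullity for the restriction to X_0 = 0 on [S]: the image contains the trace, and the kernel
    contains X_0 times the residue, multiplication by X_0 being injective. *)
Lemma restrict_dim (S : {vspace H2 e.+2}) (tr : seq R1) (rs : seq R2) :
  (forall g, g \in tr -> exists2 p, p \is e.+2.-homog & restr p = g /\ hp e.+2 p \in S) ->
  (forall g, g \in rs -> g \is e.+1.-homog /\ hp e.+2 ('X_ord0 * g) \in S) ->
  (\dim (hspan e.+2 tr) + \dim (hspan e.+1 rs) <= \dim S)%N.
Proof.
move=> htr hrs; pose f := linfun resh; pose h : R2 := 'X_ord0.
rewrite -(limg_ker_dim f S) addnC; apply: leq_add.
  have inj : lker (mulf e.+2 e.+1 h) == 0%VS.
    apply/lker0P=> u v; rewrite !mulfE => /(congr1 val).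
    have hom (w : H2 e.+1) : h * val w \is e.+2.-homog.
      by apply: homogS; [exact: homogX | exact: dhomog_is_dhomog].
    rewrite !hpK // => /mulfI hi; apply/val_inj/hi.
    apply/eqP=> /(congr1 (mcoeff U_(ord0))).
    by rewrite mcoeffX eqxx mcoeff0 => /eqP; rewrite oner_eq0.
  rewrite -(limg_dim_eq (f := mulf e.+2 e.+1 h)); last by rewrite (eqP inj) capv0.
  apply: dimvS; rewrite /hspan limg_span; apply/span_subvP=> v.
  case/mapP=> u /mapP[g gr ->] ->{u v}; have [hg gS] := hrs g gr.
  rewrite mulfE hpK // memv_cap gS memv_ker lfunE /= /resh hpK.
    by rewrite rmorphM /= -/(restr _) restr_X0 mul0r linear0.
  by apply: homogS => //; exact: homogX.
apply: dimvS; rewrite /hspan; apply/span_subvP=> v /mapP[g gt ->{v}].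
have [p hp0 [<- pS]] := htr g gt; apply/memv_imgP; exists (hp e.+2 p) => //.
by rewrite lfunE /= /resh hpK.
Qed.
End Combine.
End Restriction.

Section Step.
Variables (k : fieldType) (hk : [pchar k] =i pred0) (n : nat).
Notation R1 := {mpoly k[n.+1]}.
Notation R2 := {mpoly k[n.+2]}.
Notation xv1 := (xvars k n.+1).
Notation xv2 := (xvars k n.+2).
Notation H2 e := (dhomog n.+2 k e).

Lemma xvars_lift (y : R1) : y \in xv1 -> exists2 y' : R2, y' \in xv2 & restr k n y' = y.
Proof.
case/mapP=> i _ ->; exists 'X_(lift ord0 i); last exact: restr_XS.
by apply: map_f; rewrite mem_enum.
Qed.

Lemma X0_xvars : 'X_ord0 \in xv2.
Proof. by apply: map_f; rewrite mem_enum. Qed.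

Lemma forms_cons e (l : R2) S : l \is 1.-homog -> forms e S -> forms e.+1 (map (cons l) S).
Proof.
move=> hl; rewrite /forms all_map; apply: sub_all => s /= /andP[/eqP-> ->].
by rewrite eqxx hl.
Qed.

(** [gs] and [ws] are what is left of the split forms and products after removing the factor X_0.
    The generators of a form in [fs] or [cs] in the direction X_0 are X_0 times its cofactors,
    respectively X_0 times the product, which explains the second and fourth kinds of residue
    generators. *)
Lemma combine_dim e (gs fs cs ws : seq (seq R2)) :
  forms e.+1 gs -> forms e.+2 fs -> forms e.+1 cs -> forms e ws ->
  (\dim (hspan e.+2 (config_gens xv1 (map (map (restr k n)) fs) [::] (map (map (restr k n))
    (gs ++ cs)) [::]))
   + \dim (hspan e.+1 (config_gens xv2 gs fs ws cs))
   <= \dim (hspan e.+2 (config_gens xv2 (map (cons 'X_ord0) gs ++ fs) [::]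
        (cs ++ map (cons 'X_ord0) ws) [::])))%N.
Proof.
move=> hg hf hc hw.
have hX : ('X_ord0 : R2) \is 1.-homog by exact: homogX.
set L := config_gens xv2 (_ ++ fs) _ _ _.
have hL p : p \in L -> p \is e.+2.-homog.
  apply: config_gens_homog => //; first exact: xvars_homog.
    by rewrite forms_cat hf forms_cons.
  by rewrite forms_cat hc forms_cons.
have hA ls b y : ls \in map (cons 'X_ord0) gs ++ fs -> b \in cofactors ls -> y \in xv2 -> b *
  y \in L.
  move=> h1 h2 h3; rewrite /L /config_gens mem_cat; apply/orP; left; apply/flatten_mapP.
  by exists ls => //; apply/allpairsP; exists (b, y).
have hC ls y : ls \in cs ++ map (cons 'X_ord0) ws -> y \in xv2 -> \prod_(l <- ls) l * y \in L.
  move=> h1 h2; rewrite /L /config_gens !mem_cat; apply/or4P/Or43/flatten_mapP.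
  by exists ls => //; apply/mapP; exists y.
have mS p : p \in L -> hp e.+2 p \in hspan e.+2 L by move=> pL; apply/memv_span/map_f.
have hG p : p \in config_gens xv2 gs fs ws cs -> p \is e.+1.-homog.
  by apply: config_gens_homog => //; exact: xvars_homog.
apply: restrict_dim => g; rewrite {1}/config_gens !mem_cat => /or4P[] //.
- case/flatten_mapP=> _ /mapP[ls lsf ->] /allpairsP[[b y] [/= hb hy ->]].
  move: hb; rewrite -map_cofactors => /mapP[b' hb' ->]; have [y' hy' <-] := xvars_lift hy.
  have pL : b' * y' \in L by apply: (hA ls) => //; rewrite mem_cat lsf orbT.
  by exists (b' * y'); [exact: hL | split; [exact: rmorphM | exact: mS]].
- case/flatten_mapP=> _ /mapP[ls lsf ->] /mapP[y hy ->].
  have [y' hy' <-] := xvars_lift hy; rewrite big_map -rmorph_prod -rmorphM.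
  suff pL : \prod_(l <- ls) l * y' \in L by exists (\prod_(l <- ls) l * y');
    [exact: hL | split; last exact: mS].
  move: lsf; rewrite mem_cat => /orP[lsg|lsc]; last by apply: hC; rewrite ?mem_cat ?lsc.
  apply: (hA ('X_ord0 :: ls)) => //; first by rewrite mem_cat map_f.
  exact: mem_head.
- move=> hgg; split.
    by apply: hG; rewrite /config_gens !mem_cat hgg.
  apply: mS; move: hgg => /flatten_mapP[ls lsg] /allpairsP[[b y] [/= hb hy ->]].
  rewrite mulrA; apply: (hA ('X_ord0 :: ls)) => //; first by rewrite mem_cat map_f.
  by rewrite /= inE map_f // orbT.
- move=> hgg; split.
    by apply: hG; rewrite /config_gens !mem_cat hgg ?orbT.
  apply: mS; move: hgg => /flatten_mapP[ls lsg] hb.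
  by rewrite mulrC; apply: (hA ls) => //; [rewrite mem_cat lsg orbT | exact: X0_xvars].
- move=> hgg; split.
    by apply: hG; rewrite /config_gens !mem_cat hgg ?orbT.
  apply: mS; move: hgg => /flatten_mapP[ls lsg] /mapP[y hy ->].
  have -> : 'X_ord0 * (\prod_(l <- ls) l * y) = \prod_(l <- 'X_ord0 :: ls) l * y.
    by rewrite big_cons mulrA.
  by apply: hC => //; rewrite mem_cat map_f ?orbT.
move=> hgg; split.
  by apply: hG; rewrite /config_gens !mem_cat hgg ?orbT.
apply: mS; case/mapP: hgg => ls lsc ->.
by rewrite mulrC; apply: hC; [rewrite mem_cat lsc | exact: X0_xvars].
Qed.

Lemma stars_iter e (U : {vspace H2 e}) m : exists fs : seq (seq R2),
  [/\ size fs = m, forms e.+1 fs &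
   (minn (\dim {:H2 e}) (\dim U + m * e.+1)
     <= \dim (U + hspan e (flatten (map (@cofactors _) fs))))%N].
Proof.
elim: m => [|m [fs [sz hf hd]]].
  exists [::]; split=> //; rewrite geq_min; apply/orP; right.
  by rewrite mul0n addn0; exact: dimvS (addvSl _ _).
have [ls [sz1 hls] hd1] := star_general hk (U + hspan e (flatten (map (@cofactors _) fs))).
exists (ls :: fs); split; rewrite /= ?sz ?sz1 ?eqxx ?hls //.
apply: leq_trans (leq_trans _ hd1) _.
  rewrite mulSn; move: hd.
  by move: (\dim {:H2 e}) (\dim U) (\dim (_ + _)) => x y z; move: (m * _)%N; clear; lia.
by rewrite hspan_cat -addvA [(hspan _ (cofactors ls) + _)%VS]addvC.
Qed.

Lemma products_iter e (U : {vspace H2 e}) m : exists cs : seq (seq R2),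
  [/\ size cs = m, forms e cs &
   (minn (\dim {:H2 e}) (\dim U + m)
     <= \dim (U + hspan e [seq (\prod_(l <- ls) l)%R | ls <- cs]))%N].
Proof.
elim: m => [|m [cs [sz hf hd]]].
  exists [::]; split=> //; rewrite geq_min; apply/orP; right.
  by rewrite addn0; exact: dimvS (addvSl _ _).
have [ls [sz1 hls] hd1] :=
  product_outside (U + hspan e [seq (\prod_(l <- ls) l)%R | ls <- cs]).
exists (ls :: cs); split; rewrite /= ?sz ?sz1 ?eqxx ?hls //.
apply: leq_trans (leq_trans _ hd1) _.
  move: hd.
  by move: (\dim {:H2 e}) (\dim U) (\dim (_ + _)) => x y z; clear; lia.
have h x (s : seq R2) : hspan e (x :: s) = (hspan e [:: x] + hspan e s)%VS by rewrite
  -hspan_cat.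
by rewrite [hspan e (_ :: map _ _)]h -addvA [(hspan e [:: _] + _)%VS]addvC.
Qed.

Lemma span_config_gens e ys As Bs Cs Ds : hspan e (config_gens ys As Bs Cs Ds) =
  (hspan e (config_gens ys As [::] Cs [::]) + @hspan k n.+1 e (flatten (map (@cofactors _) Bs))
    + hspan e [seq \prod_(l <- ls) l | ls <- Ds])%VS.
Proof.
rewrite /config_gens /= cats0 !hspan_cat -!addvA; congr (_ + _)%VS.
by rewrite addvA [RHS]addvA [X in (X + _)%VS]addvC.
Qed.

(* The hyperplane X_0 = 0 divides w of the split forms and u of the products g.
   Its trace sees the other m split forms and w + c products; its residue sees
   w split forms, u products, m spans of cofactors and c single forms. The
   configurations good for the trace and for the residue are both open, and
   meet on the line joining a member of each. *)
Lemma step e m w c u r1 r2 :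
  rank_attained k n e.+2 m (w + c) r1 -> rank_attained k n.+1 e.+1 w u r2 ->
  rank_attained k n.+1 e.+2 (w + m) (c + u)
    (r1 + minn 'C(e.+1 + n.+1, n.+1) (r2 + m * e.+2 + c)).
Proof.
move=> [fs1 [gc1 [sf1 sgc1 hf1 hgc1 hr1]]] [gs2 [ws [sg2 sws hg2 hws hr2]]].
have [fs2 [sf2 hf2 hr3]] := stars_iter (hspan e.+1 (config_gens xv2 gs2 [::] ws [::])) m.
have [cs2 [sc2 hc2 hr4]] := products_iter (hspan e.+1 (config_gens xv2 gs2 [::] ws [::])
   + hspan e.+1 (flatten (map (@cofactors _) fs2))) c.
rewrite -span_config_gens in hr4.
have [gs1 [cs1 [gcE sg1 sc1]]] : exists gs1 cs1, [/\ gc1 = gs1 ++ cs1, size gs1 = w & size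
  cs1 = c].
  exists (take w gc1), (drop w gc1); rewrite cat_take_drop size_drop sgc1 addKn.
  by rewrite size_takel // sgc1 leq_addr.
move: hgc1; rewrite gcE forms_cat => /andP[hg1 hc1].
pose I := map (map (liftp k n)).
have IE S : map (map (restr k n)) (I S) = S by exact: restr_liftp.
have sI S : size (I S) = size S by exact: size_map.
have hI d S : forms d S -> forms d (I S) by exact: forms_liftp.
(* The end t = 0 is the lift of the configuration that is good for the trace, t = 1 the one that is
   good for the residue. [ws] is invisible to the trace and stays fixed. *)
have [q1 q10 hq1] := config_gens_open e.+2 xv1 fs1 (map (map (restr k n)) fs2) [::] [::]
  (gs1 ++ cs1) (map (map (restr k n)) (gs2 ++ cs2)) [::] [::] 0.
have [q2 q20 hq2] := config_gens_open e.+1 xv2 (I gs1) gs2 (I fs1) fs2 ws ws (I cs1) cs2 1.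
have qn0 : q1 * q2 != 0.
  rewrite mulf_neq0 //.
    by apply: contraNneq q10 => ->; rewrite horner0.
  by apply: contraNneq q20 => ->; rewrite horner0.
have [t] := poly_nonroot hk qn0.
rewrite hornerM mulf_eq0 negb_or => /andP[/hq1{}hq1 /hq2{}hq2].
pose gs := line_at t (I gs1) gs2; pose fs := line_at t (I fs1) fs2;
  pose cs := line_at t (I cs1) cs2.
have sgg : size (I gs1) = size gs2 by rewrite sI sg1.
have sff : size (I fs1) = size fs2 by rewrite sI sf1.
have scc : size (I cs1) = size cs2 by rewrite sI sc1.
have hIg1 : forms e.+1 (I gs1) by exact: hI.
have hIf1 : forms e.+2 (I fs1) by exact: hI.
have hIc1 : forms e.+1 (I cs1) by exact: hI.
have hgs : forms e.+1 gs by exact: forms_line_at.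
have hfs : forms e.+2 fs by exact: forms_line_at.
have hcs : forms e.+1 cs by exact: forms_line_at.
have linw : forall t, line_at t ws ws = ws.
  move=> t0; rewrite /line_at; elim: (ws) => //= s S ->; congr (_ :: _).
  by elim: s => //= l s ->; rewrite subrr scaler0 addr0.
exists (map (cons 'X_ord0) gs ++ fs), (cs ++ map (cons 'X_ord0) ws).
split.
- by rewrite size_cat size_map !size_line_at // !sI sg1 sf1.
- by rewrite size_cat size_map !size_line_at // sI sc1 sws.
- by rewrite forms_cat forms_cons ?homogX.
- by rewrite forms_cat forms_cons ?homogX // hcs.
have trE : map (map (restr k n)) (gs ++ cs)
    = line_at t (gs1 ++ cs1) (map (map (restr k n)) (gs2 ++ cs2)).
  by rewrite !map_cat !restr_line_at !IE line_at_cat // size_map sg1.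
have trF : map (map (restr k n)) fs = line_at t fs1 (map (map (restr k n)) fs2).
  by rewrite restr_line_at IE.
apply: leq_trans (combine_dim hgs hfs hcs hws); apply: leq_add.
  apply: (leq_trans hr1); move: hq1.
  rewrite (@line_at0 _ _ e.+2) ?(@line_at0 _ _ e.+1) //.
  - by rewrite trE trF gcE.
  - by rewrite size_map !size_cat sg1 sc1 sg2 sc2.
  - by rewrite forms_cat hg1 hc1.
  - by rewrite forms_restr // forms_cat hg2 hc2.
  - by rewrite size_map sf1 sf2.
  - exact: forms_restr.
move: hq2; rewrite !linw (@line_at1 _ _ e.+1 (I gs1)) // (@line_at1 _ _ e.+2) //.
rewrite (@line_at1 _ _ e.+1 (I cs1)) // => hq2; apply: leq_trans hq2.
apply: leq_trans hr4; rewrite -(dim_homog k n.+1 e.+1); move: hr2 hr3.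
set x := \dim {:_}; set y := \dim (hspan _ _); set z := \dim (_ + _).
by move: (m * _)%N x y z; clear; lia.
Qed.
End Step.

Section Basics.
Variables (k : fieldType).

Lemma rank_attained_le n e m c r r' : (r' <= r)%N -> rank_attained k n e m c r ->
  rank_attained k n e m c r'.
Proof.
move=> rr [As [Cs [sA sC hA hC hd]]]; exists As, Cs; split=> //.
exact: leq_trans hd.
Qed.

Lemma rank_attained0 n e : rank_attained k n e 0 0 0.
Proof. by exists [::], [::]. Qed.

Lemma hspan_sub n e (s s' : seq {mpoly k[n.+1]}) : {subset s <= s'} ->
  (\dim (hspan e s) <= \dim (hspan e s'))%N.
Proof. by move=> h; apply/dimvS/sub_span=> v /mapP[p /h ps ->]; exact: map_f. Qed.

Lemma rank_attained_more n e m c m' c' r : (m <= m')%N -> (c <= c')%N ->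
  rank_attained k n e m c r -> rank_attained k n e m' c' r.
Proof.
move=> mm cc [As [Cs [sA sC hA hC hd]]].
pose X : {mpoly k[n.+1]} := 'X_ord0.
have hX e0 i : forms e0 (nseq i (nseq e0 X)).
  apply/allP=> s /nseqP[-> _]; rewrite size_nseq eqxx; apply/allP=> l /nseqP[-> _].
  exact: homogX.
exists (As ++ nseq (m' - m) (nseq e X)), (Cs ++ nseq (c' - c) (nseq e.-1 X)); split.
- by rewrite size_cat size_nseq sA subnKC.
- by rewrite size_cat size_nseq sC subnKC.
- by rewrite forms_cat hA hX.
- by rewrite forms_cat hC hX.
apply: leq_trans hd _; apply: hspan_sub => p.
rewrite /config_gens /= !cats0 !map_cat !flatten_cat !mem_cat.
by case/orP=> ->; rewrite ?orbT.
Qed.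

Lemma dim_xvars n : \dim (hspan 1 (xvars k n.+1)) = n.+1.
Proof.
apply: anti_leq; apply/andP; split.
  by apply: leq_trans (dim_span _) _; rewrite size_map size_map size_enum_ord.
have dE : \dim {:dhomog n.+1 k 1} = n.+1 by rewrite dim_homog add1n binSn.
rewrite -[X in (X <= _)%N]dE; apply: dimvS; apply/subvP=> v _;
  rewrite -(valK_hp v) [val v]mpolyE linear_sum.
rewrite big_seq; apply: memv_suml => m mv; rewrite linearZ; apply: memvZ.
have /eqP/mdeg1P[i /eqP ->] : mdeg m = 1%N by exact: (dhomog_mf (dhomog_is_dhomog v) mv).
by apply/memv_span/map_f/map_f; rewrite mem_enum.
Qed.

Lemma rank_attained_deg1 n m c : (0 < m + c)%N -> rank_attained k n 1 m c n.+1.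
Proof.
case: m => [|m] mc.
  apply: (@rank_attained_more _ _ 0 1) => //.
  exists [::], [:: [::]]; split=> //.
  rewrite /config_gens /= !cats0 /multiples big_nil (eq_map (fun y => mul1r y)) map_id.
  by rewrite dim_xvars.
apply: (@rank_attained_more _ _ 1 0) => //.
exists [:: [:: 'X_ord0]], [::]; split=> //=; first by rewrite homogX.
rewrite /config_gens /= !cats0 /tangent_gens /= big_nil cats0 (eq_map (fun y => mul1r y))
  map_id.
by rewrite dim_xvars.
Qed.

Lemma rank_attained_point e m c : (0 < m + c)%N -> rank_attained k 0 e.+1 m c 1.
Proof.
move=> mc; pose X : {mpoly k[1]} := 'X_ord0.
have hX : X \is 1.-homog by exact: homogX.
have X0 : X != 0.
  apply/eqP=> /(congr1 (mcoeff U_(ord0))).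
  by rewrite mcoeffX eqxx mcoeff0 => /eqP; rewrite oner_eq0.
have h0 (s : seq {mpoly k[1]}) : X ^+ e.+1 \in s -> (1 <= \dim (hspan e.+1 s))%N.
  move=> sX; rewrite lt0n dimv_eq0; apply/eqP=> s0.
  have : hp e.+1 (X ^+ e.+1) \in hspan e.+1 s by apply/memv_span/map_f.
  rewrite s0 memv0 => /eqP/(congr1 val); rewrite hpK; last first.
    by have := dhomogMn e.+1 hX; rewrite mul1n.
  by move/eqP; rewrite expf_eq0 (negPf X0).
have hs j : all (fun l => l \is 1.-homog) (nseq j X) by apply/allP=> l /nseqP[->].
have pE j : \prod_(l <- nseq j X) l = X ^+ j by rewrite big_nseq iter_mulr_1.
have Xin : X \in xvars k 1 by apply: map_f; rewrite mem_enum.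
case: m mc => [|m] mc.
  apply: (@rank_attained_more _ _ 0 1) => //.
  exists [::], [:: nseq e X]; split=> //; first by rewrite /= size_nseq eqxx hs.
  apply: h0; rewrite /config_gens /= !cats0 exprSr -pE.
  by apply: (map_f (fun y => _ * y)).
apply: (@rank_attained_more _ _ 1 0) => //.
exists [:: X :: nseq e X], [::]; split=> //.
  by rewrite /= size_nseq eqxx hs hX.
apply: h0; rewrite /config_gens /= !cats0 exprSr -pE.
by apply/allpairsP; exists (\prod_(l <- nseq e X) l, X); rewrite /= mem_head.
Qed.

(** The hyperplane is a point, which lies on all products but one: that one adds a dimension to the
    trace and a single form to the residue. *)
Lemma rank_attained_line_products (hk : [pchar k] =i pred0) e c : rank_attained k 1 e.+1 0 c
  (minn (2 * c) e.+2).
Proof.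
elim: c e => [|c IH] e; first by rewrite muln0 min0n; exact: rank_attained0.
case: e => [|e].
  by apply: rank_attained_le (rank_attained_deg1 1 _) => //; exact: geq_minr.
have h1 : rank_attained k 0 e.+2 0 (0 + 1) 1 by exact: rank_attained_point.
apply: rank_attained_le (step hk h1 (IH e)).
by rewrite bin1; move: c e {IH h1}; clear; lia.
Qed.

(** No factor vanishes on the hyperplane: the trace is the case of one variable less, and the
    residue is one span of cofactors, of full dimension by [leq_binS]. *)
Lemma rank_attained_one (hk : [pchar k] =i pred0) n e : rank_attained k n e.+1 1 0 (n * e.+1
  + 1).
Proof.
elim: n e => [|n IH] e; first exact: rank_attained_point.
case: e => [|e].
  by apply: rank_attained_le (rank_attained_deg1 n.+1 _) => //; rewrite muln1 addn1.
apply: rank_attained_le (@step _ hk n e 1 0 0 0 _ 0 (IH e.+1) (rank_attained0 n.+1 e.+1)).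
have := leq_binS e.+1 n; move: ('C(_, _)) => x; clear; lia.
Qed.

Lemma rank_attained_line (hk : [pchar k] =i pred0) e m c : rank_attained k 1 e.+1 m c (if m
  is 0 then minn (2 * c) e.+2 else e.+2).
Proof.
case: m => [|m]; first exact: rank_attained_line_products.
by apply: (@rank_attained_more _ _ 1 0) => //;
  apply: rank_attained_le (rank_attained_one hk 1 e); rewrite mul1n addn1.
Qed.
End Basics.

(** * Plane configurations on tangent lines of a conic *)

(** Distinct integers starting at 2, because [block01] must avoid the parameters 0, 1 and -1. *)
Definition node (A : comNzRingType) (i : nat) : A := i.+2%:R.
Arguments node : simpl never.
(* The value at the point [1 : u + v : u v] of a product of two lines that is
   1 for t = 0 and (1 + u v) (u + v) for t = 1. *)
Definition conic (A : comNzRingType) (t u v : A) : A :=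
  (1 + t * (u * v)) * ((1 - t) + t * (u + v)).

Lemma size_addl (A : nzRingType) (p q : {poly A}) m :
  (size p <= m)%N -> (size q <= m)%N -> (size (p + q)%R <= m)%N.
Proof. by move=> hp hq; apply: leq_trans (size_polyD _ _) _; rewrite geq_max hp. Qed.

Lemma size_mull (A : nzRingType) (p q : {poly A}) m n :
  (size p <= m.+1)%N -> (size q <= n.+1)%N -> (size (p * q)%R <= (m + n).+1)%N.
Proof.
move=> hp hq; apply: leq_trans (size_polyMleq _ _) _.
by move: hp hq; move: (size p) (size q) => x y; lia.
Qed.

Lemma size_affine (A : nzRingType) (a b : A) : (size (a%:P + b *: 'X)%R <= 2)%N.
Proof.
apply: size_addl; first by apply: leq_trans (size_polyC_leq1 _) _.
by apply: leq_trans (size_scale_leq _ _) _; rewrite size_polyX.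
Qed.

Section Block.
Variables (k : fieldType) (hk : [pchar k] =i pred0).

Lemma node_inj : injective (@node k).
Proof.
move=> i j; rewrite /node; wlog le_ij : i j / (i <= j)%N => [wl|].
  by case: (leqP i j) => [/wl//|/ltnW/wl h] /esym/h.
move=> /eqP; rewrite eq_sym -subr_eq0 -natrB // ((pcharf0P k).1 hk).
by move: le_ij; clear; lia.
Qed.

Lemma natr_inj_neq0 i j : i != j -> (i%:R : k) - j%:R != 0.
Proof.
wlog le_ij : i j / (i <= j)%N => [wl|].
  case: (leqP i j) => [/wl//|/ltnW/wl h]; rewrite eq_sym => /h.
  by rewrite -opprB oppr_eq0.
by move=> ij; rewrite -opprB oppr_eq0 -natrB // ((pcharf0P k).1 hk); move: le_ij ij; clear; lia.
Qed.

Lemma quadruple_roots (p : {poly k}) (x : nat -> k) : injective x ->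
  (size p <= 5)%N -> (forall r : 'I_4, p.[x r] = 0) ->
  exists c, p = c *: \prod_(r < 4) ('X - (x r)%:P).
Proof.
move=> xi sp hp; pose rs := [seq x r | r : 'I_4].
have rsE : \prod_(z <- rs) ('X - z%:P) = \prod_(r < 4) ('X - (x r)%:P) :> {poly k}.
  by rewrite big_map big_enum.
have sP : size (\prod_(r < 4) ('X - (x r)%:P) : {poly k}) = 5.
  by rewrite -rsE (size_prod_XsubC _ id) size_map size_enum_ord.
have /dvdpP[q pE] : \prod_(r < 4) ('X - (x r)%:P) %| p.
  rewrite -rsE; apply: uniq_roots_dvdp.
    by apply/allP=> z /mapP[r _ ->]; apply/rootP.
  by rewrite uniq_rootsE map_inj_uniq ?enum_uniq // => r r' /xi h; exact: val_inj.
have P0 : \prod_(r < 4) ('X - (x r)%:P) != 0 :> {poly k} by rewrite -size_poly_gt0 sP.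
case: (eqVneq q 0) => [q0|q0]; first by exists 0; rewrite pE q0 mul0r scale0r.
move: sp; rewrite pE size_mul // sP addnS /= => sq.
have /size1_polyC -> : (size q <= 1)%N by move: sq; rewrite -[5%N]/(1 + 4)%N leq_add2r.
by exists q`_0; rewrite mul_polyC.
Qed.

Lemma vanish_at_quadruple (p : {poly k}) (x : nat -> k) : injective x ->
  (size p <= 4)%N -> (forall r : 'I_4, p.[x r] = 0) -> p = 0.
Proof.
move=> xi sp hp; apply: (@roots_geq_poly_eq0 _ p [seq x r | r : 'I_4]).
- by apply/allP=> z /mapP[r _ ->]; apply/rootP.
- rewrite map_inj_uniq ?enum_uniq // => r r' /xi h; exact: val_inj.
- by rewrite size_map size_enum_ord.
Qed.

(** The specialisation t = 0, t' = 1 of the system of 16 equations in 16 unknowns. For fixed u_r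
    both sides are cubics in v agreeing at four nodes, so the equations become the polynomial
    identities [eqp]. *)
Lemma block01 (u v : nat -> k) (A0 A1 B0 B1 : 'I_4 -> k) :
  injective u -> injective v -> (forall r, u r != 0) ->
  (forall e r, e * e = 1 -> e + u r != 0) ->
  (forall r r' : 'I_4, A0 r' + A1 r' * u r =
     (1 + u r * v r') * (u r + v r') * (B0 r + B1 r * v r')) ->
  forall r, [/\ A0 r = 0, A1 r = 0, B0 r = 0 & B1 r = 0].
Proof.
move=> ui vi un0 upm h.
pose interp (A : 'I_4 -> k) : {poly k} := \sum_r A r *: (tnth (4.-lagrange v) r : {poly k}).
have sI A : (size (interp A) <= 4)%N.
  apply: (leq_trans (size_sum _ _ _)); apply/bigmax_leqP => r _.
  by rewrite (leq_trans (size_scale_leq _ _)) // size_lagrange_.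
have hI A (r : 'I_4) : (interp A).[v r] = A r.
  rewrite /interp horner_sum (bigD1 r) //= big1 => [|r' rr'].
    by rewrite hornerZ lagrange_sample // eqxx mulr1 addr0.
  by rewrite hornerZ lagrange_sample // (negPf rr') mulr0.
pose al := interp A0; pose be := interp A1.
have eqp (r : 'I_4) : al + be * (u r)%:P =
    (1 + u r *: 'X) * ((u r)%:P + 'X) * ((B0 r)%:P + B1 r *: 'X).
  apply/eqP; rewrite -subr_eq0; apply/eqP/(vanish_at_quadruple vi) => [|r'].
    have s1 := size_affine 1 (u r); have s2 := size_affine (u r) 1.
    have s3 := size_affine (B0 r) (B1 r); rewrite scale1r in s2.
    apply: size_addl; last first.
      by rewrite size_polyN; exact: (size_mull (size_mull s1 s2) s3).
    apply: size_addl; first exact: sI.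
    exact: (@size_mull _ _ _ 3 0 (sI A1) (size_polyC_leq1 _)).
  by rewrite !hornerE !hI h subrr.
(* Both sides of eqp have to vanish at X = - u_r and X = - 1 / u_r, which
   determines al - X be and X al - be up to constants c and d; comparing these
   at X = 1 and X = -1 gives c = d = 0. *)
have [c hc] : exists c, al - 'X * be = c *: \prod_(r < 4) ('X - (- u r)%:P).
  apply: (@quadruple_roots _ (fun r => - u r)) => [a b /oppr_inj/ui//||r].
    apply: size_addl; first exact: leq_trans (sI _) _.
    by rewrite size_polyN; exact: (@size_mull _ _ _ 1 3 (eq_leq (size_polyX _)) (sI _)).
  have := congr1 (horner^~ (- u r)) (eqp r); rewrite !hornerE => hr.
  by rewrite mulNr opprK [u r * _]mulrC hr; ring.
have [d hd] : exists d, 'X * al - be = d *: \prod_(r < 4) ('X - (- (u r)^-1)%:P).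
  apply: (@quadruple_roots _ (fun r => - (u r)^-1)) => [a b /oppr_inj/invr_inj/ui//||r].
    apply: size_addl; last by rewrite size_polyN; exact: leq_trans (sI _) _.
    exact: (@size_mull _ _ _ 1 3 (eq_leq (size_polyX _)) (sI _)).
  have := congr1 (horner^~ (- (u r)^-1)) (eqp r); rewrite !hornerE => hr.
  apply: (mulfI (un0 r)); rewrite mulr0.
  have -> : u r * (- (u r)^-1 * al.[- (u r)^-1] - be.[- (u r)^-1])
     = - (al.[- (u r)^-1] + be.[- (u r)^-1] * u r) by field.
  by rewrite hr; field.
pose U := \prod_(r < 4) u r; pose P (e : k) := \prod_(r < 4) (e + u r).
have U0 : U != 0 by apply/prodf_neq0 => r _.
have P1E e : (\prod_(r < 4) ('X - (- u r)%:P)).[e] = P e.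
  by rewrite horner_prod; apply: eq_bigr => r _; rewrite !hornerE opprK.
have P2E e : e * e = 1 -> (\prod_(r < 4) ('X - (- (u r)^-1)%:P)).[e] = U^-1 * P e.
  move=> ee; rewrite horner_prod /P /U -prodfV.
  have -> : \prod_(r < 4) (e + u r) = \prod_(r < 4) (e * (e + u r)).
    by rewrite [RHS]big_split /= prodr_const card_ord !exprS expr0 mulr1 ee mulr1 ee mul1r.
  rewrite -big_split /=; apply: eq_bigr => r _; rewrite !hornerE opprK.
  transitivity ((u r)^-1 * (e * e) + e); first by rewrite ee mulr1 addrC.
  by rewrite /=; field; exact: un0.
have Pn0 e : e * e = 1 -> P e != 0.
  by move=> ee; apply/prodf_neq0 => r _; exact: upm.
have e1 : c = d * U^-1.
  have := congr1 (horner^~ 1) hc; have := congr1 (horner^~ 1) hd.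
  rewrite !hornerE P1E P2E ?mulr1 // => -> h1.
  by apply: (mulIf (Pn0 1 (mulr1 _))); rewrite -h1 mulrA.
have e2 : c = - (d * U^-1).
  have m1 : (-1) * (-1) = 1 :> k by ring.
  have := congr1 (horner^~ (-1)) hc; have := congr1 (horner^~ (-1)) hd.
  rewrite !hornerE P1E P2E // => h1 h2.
  apply: (mulIf (Pn0 _ m1)); apply/eqP; rewrite -subr_eq0; apply/eqP.
  have -> : c * P (-1) - - (d * U^-1) * P (-1) = c * P (-1) + d * (U^-1 * P (-1)) by ring.
  by rewrite -h1 -h2; ring.
have d0 : d = 0.
  have e3 : d * U^-1 = - (d * U^-1) := etrans (esym e1) e2.
  have : d * (U^-1 * 2%:R) = 0.
    by rewrite mulr_natr mulr2n mulrDr {1}e3 addNr.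
  move/eqP; rewrite !mulf_eq0 invr_eq0 (negPf U0) (negPf (natr_neq0 hk 1)) !orbF.
  by move/eqP.
have c0 : c = 0 by rewrite e1 d0 mul0r.
have alE : al = 'X * be by apply/eqP; rewrite -subr_eq0 hc c0 scale0r.
have be0 : be = 0.
  have : be * ('X^2 - 1%:P) = 0.
    by have := hd; rewrite d0 scale0r alE => <-; ring.
  move/eqP; rewrite mulf_eq0 => /orP[/eqP//|]; by rewrite -size_poly_eq0 size_XnsubC.
have al0 : al = 0 by rewrite alE be0 mulr0.
have hA (r : 'I_4) : A0 r = 0 /\ A1 r = 0.
  by rewrite -(hI A0) -(hI A1) -/al -/be al0 be0 !horner0.
have hB (r : 'I_4) : (B0 r)%:P + B1 r *: 'X = 0 :> {poly k}.
  have := eqp r; rewrite al0 be0 mul0r addr0 => /esym/eqP; rewrite !mulf_eq0 -orbA.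
  case/or3P=> [/eqP/(congr1 (coefp 0))|/eqP/(congr1 (coefp 1%N))|/eqP//] /=.
    by rewrite coefD coef1 coefZ coefX mulr0 addr0 coef0 => /eqP; rewrite oner_eq0.
  by rewrite coefD coefC coefX add0r coef0 => /eqP; rewrite oner_eq0.
move=> r; split; [exact: (hA r).1 | exact: (hA r).2 | |].
  by have := congr1 (coefp 0) (hB r); rewrite /= coefD coefC coefZ coefX mulr0 addr0 coef0.
by have := congr1 (coefp 1%N) (hB r); rewrite /= coefD coefC coefZ coefX mulr1 add0r coef0.
Qed.
End Block.

(** * Derivations, and polynomials vanishing at every point *)

Section Deriv.
Variables (k : fieldType) (hk : [pchar k] =i pred0).

(** The chain rule for an abstract Leibniz map, so that it serves both for the derivative along a
    line ([deriv] after [mmap polyC]) and for partial derivatives of a composition ([mderiv] after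
    [comp_mpoly]). *)
Lemma derivation_chain n (A : comNzRingType) (f : {rmorphism {mpoly k[n]} -> A})
  (D : {additive A -> A}) : (forall x y, D (x * y) = D x * y + x * D y) ->
  (forall c, D (f c%:MP) = 0) ->
  forall p, D (f p) = \sum_i f p^`M(i) * D (f 'X_i).
Proof.
move=> DM DC; have D1 : D (f 1) = 0 by rewrite -mpolyC1 DC.
apply: mpolyind => [|c m p _ _ IH].
  by rewrite !raddf0 big1 // => i _; rewrite mderiv0 raddf0 mul0r.
rewrite !raddfD /= IH -mul_mpolyC rmorphM DM DC mul0r add0r.
transitivity (f c%:MP * (\sum_i f ('X_[m])^`M(i) * D (f 'X_i)) + \sum_i f p^`M(i) * D (f
  'X_i)); last first.
  rewrite mulr_sumr -big_split /=; apply: eq_bigr => i _.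
  by rewrite mderivD mul_mpolyC mderivZ -mul_mpolyC rmorphD rmorphM /= mulrDl mulrA.
congr (_ * _ + _); rewrite mpolyXE_id.
elim/big_rec: _ => [|i q _ hq].
  by rewrite D1 big1 // => i _; rewrite -mpolyC1 mderivC raddf0 mul0r.
have pow j : D (f ('X_i ^+ j)) = \sum_l f ('X_i ^+ j)^`M(l) * D (f 'X_l).
  elim: j => [|j IHj].
    by rewrite expr0 D1 big1 // => l _; rewrite -mpolyC1 mderivC raddf0 mul0r.
  rewrite exprS rmorphM DM IHj mulr_sumr.
  under [RHS]eq_bigr => l _ do rewrite mderivM rmorphD !rmorphM mulrDl.
  rewrite big_split /=; congr (_ + _); last by apply: eq_bigr => l _; rewrite mulrA.
  rewrite (bigD1 i) //= big1 => [|l li].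
    rewrite mderivX mnm1E eqxx scale1r (_ : U_(i) - U_(i) = 0)%MM ?mpolyX0.
      by rewrite rmorph1 mul1r addr0 mulrC.
    by apply/mnmP=> l; rewrite mnmBE subnn mnm0E.
  by rewrite mderivX mnm1E eq_sym (negPf li) scale0r raddf0 !mul0r.
rewrite rmorphM DM hq pow mulr_sumr mulr_suml -big_split /=.
apply: eq_bigr => l _; rewrite mderivM rmorphD !rmorphM /= mulrDl; congr (_ + _).
  by rewrite mulrAC.
by rewrite mulrA.
Qed.

Lemma mderiv_eq0_const n (p : {mpoly k[n]}) : (forall i, p^`M(i) = 0) -> p = (p@_0)%:MP.
Proof.
move=> h; apply/mpolyP=> m; rewrite mcoeffC.
case: (eqVneq 0%MM m) => [<-|m0]; first by rewrite mulr1.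
rewrite mulr0; have [i mi] : exists i, m i != 0%N.
  apply/existsP; apply: contraNT m0; rewrite negb_exists => /forallP hm.
  by apply/eqP/mnmP=> i; rewrite mnm0E; apply/esym/eqP; have := hm i; rewrite negbK.
have := congr1 (mcoeff (m - U_(i))%MM) (h i); rewrite mcoeff_deriv mcoeff0.
rewrite submK ?lep1mP // => /eqP; rewrite -mulr_natr mulf_eq0.
by rewrite (negPf (natr_neq0 hk _)) orbF => /eqP.
Qed.

(** A polynomial zero at every point is zero on lines parallel to the axes, so its partial
    derivatives are zero at every point as well. By induction on the degree they are the zero
    polynomial, and p is a constant. *)
Lemma mpoly_nonroot n (p : {mpoly k[n]}) : p != 0 -> exists x, p.@[x] != 0.
Proof.
move=> p0; apply: NNPP => no; case/eqP: p0.
have : forall x, p.@[x] = 0.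
  by move=> x; apply/eqP/negPn/negP=> h; apply: no; exists x.
have [m] : exists m, (msize p <= m)%N by exists (msize p).
elim: m p {no} => [|m IH] p hp hx.
  by apply/eqP; rewrite -msize_poly_eq0 -leqn0.
have hd i : p^`M(i) = 0.
  apply: IH => [|x].
    rewrite msizeE; apply/bigmax_leqP_seq => u; rewrite mcoeff_msupp mcoeff_deriv => hu _.
    rewrite -ltnS; apply: leq_trans hp.
    have := @msize_mdeg_lt _ _ p (u + U_(i))%MM; rewrite mdegD mdeg1 addn1; apply.
    by rewrite mcoeff_msupp; apply: contraNneq hu => ->; rewrite mul0rn.
  pose h j : {poly k} := (x j)%:P + (j == i)%:R *: 'X.
  have hE (q : {mpoly k[n]}) : (mmap polyC h q).[0] = q.@[x].
    rewrite /mmap horner_sum mevalE; apply: eq_bigr => u _; rewrite hornerM hornerC;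
      congr (_ * _).
    by rewrite /mmap1 horner_prod; apply: eq_bigr => j _; rewrite horner_exp !hornerE.
  have ph0 : mmap polyC h p = 0.
    apply/eqP/negP=> /negP/(poly_nonroot hk)[t]; apply/negP; rewrite negbK.
    suff -> : (mmap polyC h p).[t] = p.@[fun j => (h j).[t]] by rewrite hx.
    rewrite /mmap horner_sum mevalE; apply: eq_bigr => u _; rewrite hornerM hornerC;
      congr (_ * _).
    by rewrite /mmap1 horner_prod; apply: eq_bigr => j _; rewrite horner_exp.
  have DC c : deriv (mmap polyC h c%:MP) = 0 by rewrite mmapC derivC.
  have := derivation_chain (f := mmap polyC h) (@derivM _) DC p; rewrite /=.
  rewrite ph0 raddf0 => /(congr1 (horner^~ 0)); rewrite horner0 horner_sum (bigD1 i) //= big1.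
    rewrite addr0 hornerM hE mmapX mmap1U derivD derivC derivZ derivX eqxx.
    by rewrite !hornerE /= ?mulr1 => <-.
  by move=> j ji; rewrite mmapX mmap1U derivD derivC derivZ derivX (negPf ji) scale0r addr0
    mulr0 horner0.
have p0 : p@_0 = 0.
  by have := hx (fun _ => 0); rewrite {1}(mderiv_eq0_const hd) mevalC.
by rewrite (mderiv_eq0_const hd) p0 mpolyC0.
Qed.
End Deriv.

Section Choice.
Variables (k : fieldType) (hk : [pchar k] =i pred0).

Local Notation S := (bool * ('I_4 * bool))%type.
Local Notation Y := ('I_4 * 'I_4)%type.

(* The two tangent-line configurations on 4-element sets of nodes impose
   independent conditions at their 16 common points. *)
Definition block (t t' : k) j j' := forall (A0 A1 B0 B1 : 'I_4 -> k),
  (forall r r' : 'I_4, let u := node k (4 * j + r) in let v := node k (4 * j' + r') in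
     conic t u v * (A0 r' + A1 r' * u) = conic t' u v * (B0 r + B1 r * v)) ->
  forall r, [/\ A0 r = 0, A1 r = 0, B0 r = 0 & B1 r = 0].

(** Rows are the unknowns: (true, (r', b)) stands for A_b r' and (false, (r, b)) for B_b r, the
    latter moved to the other side with a sign. The ring is arbitrary so that t and t' can also be
    indeterminates. *)
Definition block_entry (A : comNzRingType) (t t' : A) (j j' : nat) (s : S) (y : Y) : A :=
  let u := node A (4 * j + y.1) in let v := node A (4 * j' + y.2) in
  if s.1 then (y.2 == s.2.1)%:R * (conic t u v * (if s.2.2 then u else 1))
  else - ((y.1 == s.2.1)%:R * (conic t' u v * (if s.2.2 then v else 1))).

Definition block_mx (A : comNzRingType) (t t' : A) j j' : 'M[A]_(#|{: S}|, #|{: Y}|) :=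
  \matrix_(x, y) block_entry t t' j j' (enum_val x) (enum_val y).

Lemma block_mxP t t' j j' : block t t' j j' <-> row_free (block_mx t t' j j').
Proof.
have sumS (g : S -> k) : \sum_(x < #|{: S}|) g (enum_val x) =
    \sum_r (g (true, (r, true)) + g (true, (r, false)))
    + \sum_r (g (false, (r, true)) + g (false, (r, false))).
  have -> : \sum_(x < #|{: S}|) g (enum_val x) = \sum_s g s.
    by rewrite [RHS](reindex (@enum_val _ {: S})) //; exact/onW_bij/enum_val_bij.
  have pairE (A B : finType) (G : A * B -> k) : \sum_p G p = \sum_a \sum_b G (a, b).
    by rewrite pair_bigA /=; apply: eq_bigr => -[].
  rewrite pairE big_bool /= !pairE.
  by congr (_ + _); apply: eq_bigr => r _; rewrite big_bool.
have relE (c : S -> k) (r r' : 'I_4) : let u := node k (4 * j + r) in let v := node k (4 * j'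
  + r') in
   \sum_(x < #|{: S}|) c (enum_val x) * block_entry t t' j j' (enum_val x) (r, r') =
   conic t u v * (c (true, (r', false)) + c (true, (r', true)) * u)
   - conic t' u v * (c (false, (r, false)) + c (false, (r, true)) * v).
  rewrite /= (sumS (fun s => c s * block_entry t t' j j' s (r, r'))) /block_entry /=.
  rewrite (bigD1 r') //= eqxx [X in _ + X + _]big1 => [|i ir]; last first.
    by rewrite eq_sym (negPf ir) !(mul0r, mulr0) addr0.
  rewrite (bigD1 r) //= eqxx [X in _ + (_ + X)]big1 => [|i ir]; last first.
    by rewrite eq_sym (negPf ir) !(mul0r, oppr0, mulr0) addr0.
  rewrite ![true%:R]mulr1n; move: (conic t _ _) (conic t' _ _) => x1 x2.
  by move: (node k _) (node k _) => u v; ring.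
split=> [h|fr A0 A1 B0 B1 h].
  apply: inj_row_free => v vM; apply/rowP=> x; rewrite mxE.
  pose c (s : S) := v 0 (enum_rank s).
  have cE x' : v 0 x' = c (enum_val x') by rewrite /c enum_valK.
  have h0 (r r' : 'I_4) : \sum_(x < #|{: S}|) c (enum_val x) * block_entry t t' j j'
    (enum_val x) (r, r') = 0.
    have := congr1 (fun w : 'rV_#|{: Y}| => w 0 (enum_rank (r, r'))) vM; rewrite !mxE => h0;
      apply: etrans h0.
    by apply: eq_bigr => x' _; rewrite -cE mxE enum_rankK.
  have hh := h (fun r => c (true, (r, false))) (fun r => c (true, (r, true)))
    (fun r => c (false, (r, false))) (fun r => c (false, (r, true))).
  rewrite cE; case: (enum_val x) => [[] [r []]].
  1-4: by case: (hh _ r) => // r1 r2 /=; apply/eqP; rewrite -subr_eq0 -(relE c) h0.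
pose c (s : S) := match s with (true, (r, false)) => A0 r | (true, (r, true)) => A1 r
  | (false, (r, false)) => B0 r | (false, (r, true)) => B1 r end.
have : (\row_x c (enum_val x)) *m block_mx t t' j j' = 0.
  apply/rowP=> y; rewrite !mxE; case: (enum_val y) (enum_valK y) => r r' yE.
  have := relE c r r'; rewrite /= (h r r') subrr => h0; apply: etrans h0.
  by apply: eq_bigr => x _; rewrite !mxE -yE enum_rankK.
move/eqP; rewrite mulmx_free_eq0 // => /eqP/rowP c0.
have {}c0 s : c s = 0 by have := c0 (enum_rank s); rewrite !mxE enum_rankK.
move=> r; split; [exact: (c0 (true, (r, false))) | exact: (c0 (true, (r, true)))
  | exact: (c0 (false, (r, false))) | exact: (c0 (false, (r, true)))].
Qed.

Lemma map_block_entry (A B : comNzRingType) (f : {rmorphism A -> B}) t t' j j' s y :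
  f (block_entry t t' j j' s y) = block_entry (f t) (f t') j j' s y.
Proof.
have fsg i : f (node A i) = node B i by rewrite /node rmorph_nat.
have fc a b c : f (conic a b c) = conic (f a) (f b) (f c).
  by rewrite /conic rmorphM !rmorphD rmorphN !rmorphM rmorphD rmorph1.
have fif (c : bool) x : f (if c then x else 1) = if c then f x else 1.
  by case: c => //; exact: rmorph1.
rewrite /block_entry; case: ifP => _.
  by rewrite rmorphM rmorphM fc fif !fsg rmorph_nat.
by rewrite rmorphN rmorphM rmorphM fc fif !fsg rmorph_nat.
Qed.

(** The determinant, corrected by a fixed inverse of the matrix at t_j = 0, t_j' = 1, is a
    polynomial in the parameters that takes the value 1 at this specialisation. *)
Lemma block_open m (j j' : 'I_m) : j != j' ->
  exists2 p : {mpoly k[m]}, p != 0 & forall t, p.@[t] != 0 -> block (t j) (t j') j j'.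
Proof.
move=> jj'; pose t0 (i : 'I_m) : k := (i == j')%:R.
have /block_mxP/row_freeP[B hB] : block (t0 j) (t0 j') j j'.
  rewrite /t0 eqxx (negPf jj') => A0 A1 B0 B1 h.
  apply: (@block01 _ hk (fun r => node k (4 * j + r)) (fun r => node k (4 * j' + r))).
  - by move=> a b /(node_inj hk); lia.
  - by move=> a b /(node_inj hk); lia.
  - by move=> r; exact: natr_neq0.
  - move=> e r ee; have /eqP : (e - 1) * (e + 1) = 0.
      by transitivity (e * e - 1); [ring | rewrite ee subrr].
    rewrite mulf_eq0 subr_eq0 addr_eq0 => /orP[]/eqP->.
      by rewrite /node nat1r natr_neq0.
    by rewrite addrC; exact: (@natr_inj_neq0 _ hk _ 1%N).
  move=> r r'; have := h r r'; rewrite /= /conic.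
  set u := node k (4 * j + r); set v := node k (4 * j' + r') => hr.
  transitivity ((1 + 0 * (u * v)) * (1 - 0 + 0 * (u + v)) * (A0 r' + A1 r' * u)).
    by ring.
  by rewrite hr; ring.
pose P := \det (block_mx ('X_j : {mpoly k[m]}) 'X_j' j j' *m map_mx (@mpolyC m k) B).
have PE t : P.@[t] = \det (block_mx (t j) (t j') j j' *m B).
  rewrite /P -det_map_mx map_mxM; congr (\det (_ *m _)); apply/matrixP=> x y; rewrite !mxE.
    by rewrite map_block_entry /= !mevalXU.
  by rewrite /= mevalC.
exists P => [|t].
  by apply: contra_neq (oner_neq0 k) => P0; rewrite -(det1 k #|{: S}|) -hB -(PE t0) P0 meval0.
rewrite PE => nz; apply/block_mxP.
have : row_free (block_mx (t j) (t j') j j' *m B) by rewrite row_free_unit unitmxE unitfE.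
rewrite /row_free => /eqP rk; rewrite eqn_leq rank_leq_row -{1}rk; exact: mxrankM_maxl.
Qed.

Lemma block_choice m : exists t : 'I_m -> k, (forall j, t j != 0) /\
  forall j j' : 'I_m, j != j' -> block (t j) (t j') j j'.
Proof.
pose Q (q : 'I_m * 'I_m) (p : {mpoly k[m]}) := p != 0 /\
    forall t, p.@[t] != 0 -> q.1 != q.2 -> block (t q.1) (t q.2) q.1 q.2.
have hp q : exists p, Q q p.
  case: (eqVneq q.1 q.2) => [qq|qq]; last first.
    by have [p p0 hp] := block_open qq; exists p; split => // t /hp.
  by exists 1; split=> [|t _]; rewrite ?oner_neq0 ?qq ?eqxx.
have [F hF] := fin_all_exists hp.
have nz : (\prod_q F q) * (\prod_j 'X_j) != 0 :> {mpoly k[m]}.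
  rewrite mulf_neq0 //; apply/prodf_neq0 => i _; first exact: (hF i).1.
  apply/eqP=> /(congr1 (mcoeff U_(i)%MM)).
  by rewrite mcoeffX eqxx mcoeff0 => /eqP; rewrite oner_eq0.
have [t] := mpoly_nonroot hk nz; rewrite mevalM mulf_eq0 negb_or => /andP[h1 h2].
exists t; split=> [j|j j' jj'].
  by move: h2; rewrite rmorph_prod /= => /prodf_neq0/(_ j isT); rewrite mevalXU.
apply: (hF (j, j')).2 => //.
by move: h1; rewrite rmorph_prod /= => /prodf_neq0/(_ (j, j') isT).
Qed.
End Choice.

Section Core.
Variables (k : fieldType) (hk : [pchar k] =i pred0).

Lemma quadratic_three_roots (q0 q1 q2 x1 x2 x3 : k) : uniq [:: x1; x2; x3] ->
  all (fun v => q0 + q1 * v + q2 * v ^+ 2 == 0) [:: x1; x2; x3] ->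
  forall v, q0 + q1 * v + q2 * v ^+ 2 = 0.
Proof.
move=> hu ha v; pose p : {poly k} := Poly [:: q0; q1; q2].
have pE w : p.[w] = q0 + q1 * w + q2 * w ^+ 2 by rewrite horner_Poly /=; ring.
suff p0 : p = 0 by rewrite -pE p0 horner0.
apply: (roots_geq_poly_eq0 (rs := [:: x1; x2; x3])) => //; last exact: size_Poly.
by apply: sub_all ha => w; rewrite /root pE.
Qed.

Lemma symmetric_quadratic_zero (q0 q1 q2 q3 q4 q5 : k) :
  (forall u v, q0 + q1 * (u + v) + q2 * (u * v) + q3 * (u + v) ^+ 2
     + q4 * ((u + v) * (u * v)) + q5 * (u * v) ^+ 2 = 0) ->
  [/\ q0 = 0, q1 = 0, q3 = 0, q4 = 0 & q5 = 0].
Proof.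
move=> h; have two : (2%:R : k) != 0 by exact: natr_neq0.
have twelve : (12%:R : k) != 0 by exact: natr_neq0.
pose E u v := q0 + q1 * (u + v) + q2 * (u * v) + q3 * (u + v) ^+ 2
     + q4 * ((u + v) * (u * v)) + q5 * (u * v) ^+ 2.
have {}h u v : E u v = 0 by exact: h.
have e0 : q0 = 0 by rewrite -(h 0 0) /E; ring.
(* At v = -u only q0 - q2 u^2 + q5 u^4 is left; the combination of u = 2 and u = 1 eliminates q2 and
   leaves 12 q5. *)
have e5 : q5 = 0.
  apply: (mulfI twelve); rewrite mulr0.
  transitivity (E 2%:R (- 2%:R) - 4%:R * E 1 (- 1)); last by rewrite !h; ring.
  by rewrite /E e0; ring.
have e1 : q1 = 0.
  apply: (mulfI two); rewrite mulr0.
  transitivity (4%:R * E 1 0 - E 2%:R 0); last by rewrite !h; ring.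
  by rewrite /E e0; ring.
have e3 : q3 = 0 by rewrite -(h 1 0) /E e0 e1; ring.
have e2 : q2 = 0.
  by apply: oppr_inj; rewrite oppr0 -(h 1 (- 1)) /E e0 e1 e3 e5; ring.
by split=> //; apply: (mulfI two); rewrite mulr0 -(h 1 1) /E e0 e1 e2 e3 e5; ring.
Qed.

Variables (a N : nat) (aN : (4 * a <= N)%N) (t : 'I_a -> k).
Hypothesis t0 : forall j, t j != 0.
Hypothesis tblock : forall j j' : 'I_a, j != j' -> block (t j) (t j') j j'.

Notation s i := (node k i).
(** The tangents used by product j are all but those of its block 4j, ..., 4j + 3. Hence at the
    meeting point of tangents i1 and i2 only the products whose own block contains i1 or i2
    contribute. *)
Definition outside (j : nat) := [seq i <- iota 0 N | i %/ 4 != j]%N.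
Definition tangent_value (i : nat) (u v : k) := (u - s i) * (v - s i).
Definition partial_prod j i u v := \prod_(i' <- outside j | i' != i) tangent_value i' u v.
Definition full_prod j u v := \prod_(i' <- outside j) tangent_value i' u v.
Variables (al be : 'I_a -> nat -> k) (cA cB cC cD cc : 'I_a -> k).
Definition tau (j : 'I_a) u v :=
  (1 - t j + t j * (u + v)) * (cA j * (u + v) + cB j * (u * v))
  + (1 + t j * (u * v)) * (cC j + cD j * (u * v))
  + cc j * conic (t j) u v.
(** The value at [1 : u + v : u v] of a combination of the generators in one tangent space. [tau]
    collects those in which no tangent line has been dropped. *)
Definition relation_term (j : 'I_a) u v :=
  \sum_(i <- outside j) partial_prod j i u v * (conic (t j) u v * (al j i * (u + v) + be j i))
  + full_prod j u v * tau j u v.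

Lemma mem_outside i j : (i \in outside j) = (i < N)%N && (i %/ 4 != j)%N.
Proof. by rewrite mem_filter mem_iota /= andbC. Qed.

Lemma uniq_outside j : uniq (outside j).
Proof. exact/filter_uniq/iota_uniq. Qed.

Lemma tangent_value_l i v : tangent_value i (s i) v = 0. Proof. by rewrite /tangent_value
  subrr mul0r. Qed.
Lemma tangent_value_r i u : tangent_value i u (s i) = 0. Proof. by rewrite /tangent_value
  subrr mulr0. Qed.
Lemma node_sub_neq0 i i' : i != i' -> s i - s i' != 0.
Proof. by rewrite subr_eq0 (inj_eq (node_inj hk)). Qed.
Lemma tangent_value_neq0 i i1 i2 : i != i1 -> i != i2 -> tangent_value i (s i1) (s i2) != 0.
Proof. by move=> h1 h2; rewrite mulf_neq0 // node_sub_neq0 // eq_sym. Qed.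

Lemma full_prod_l j i v : i \in outside j -> full_prod j (s i) v = 0.
Proof. by move=> h; rewrite /full_prod (bigD1_seq i) ?uniq_outside //= tangent_value_l mul0r.
  Qed.
Lemma full_prod_r j i u : i \in outside j -> full_prod j u (s i) = 0.
Proof. by move=> h; rewrite /full_prod (bigD1_seq i) ?uniq_outside //= tangent_value_r mul0r.
  Qed.
Lemma partial_prod_l j i i' v : i \in outside j -> i != i' -> partial_prod j i' (s i) v = 0.
Proof.
move=> h ii; rewrite /partial_prod -big_filter (bigD1_seq i) /= ?tangent_value_l ?mul0r //.
  by rewrite mem_filter h ii.
exact/filter_uniq/uniq_outside.
Qed.
Lemma partial_prod_r j i i' u : i \in outside j -> i != i' -> partial_prod j i' u (s i) = 0.
Proof.
move=> h ii; rewrite /partial_prod -big_filter (bigD1_seq i) /= ?tangent_value_r ?mul0r //.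
  by rewrite mem_filter h ii.
exact/filter_uniq/uniq_outside.
Qed.

Lemma relation_term_in_in (j : 'I_a) i1 i2 : i1 \in outside j -> i2 \in outside j -> i1 != i2
  -> relation_term j (s i1) (s i2) = 0.
Proof.
move=> h1 h2 ne; rewrite /relation_term full_prod_l // mul0r addr0 big1 // => i _.
case: (eqVneq i1 i) => [<-|ii]; last by rewrite partial_prod_l // mul0r.
by rewrite partial_prod_r ?mul0r // eq_sym.
Qed.

Lemma relation_term_in_out (j : 'I_a) i1 u : i1 \in outside j ->
  relation_term j (s i1) u = partial_prod j i1 (s i1) u * (conic (t j) (s i1) u * (al j i1 *
    (s i1 + u) + be j i1)).
Proof.
move=> h1; rewrite /relation_term full_prod_l // mul0r addr0 (bigD1_seq i1) ?uniq_outside //=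
  big1 ?addr0 //.
by move=> i ii; rewrite partial_prod_l ?mul0r // eq_sym.
Qed.

Lemma relation_term_out_in (j : 'I_a) i1 u : i1 \in outside j ->
  relation_term j u (s i1) = partial_prod j i1 u (s i1) * (conic (t j) u (s i1) * (al j i1 *
    (u + s i1) + be j i1)).
Proof.
move=> h1; rewrite /relation_term full_prod_r // mul0r addr0 (bigD1_seq i1) ?uniq_outside //=
  big1 ?addr0 //.
by move=> i ii; rewrite partial_prod_r ?mul0r // eq_sym.
Qed.

Hypothesis rel : forall u v, \sum_j relation_term j u v = 0.

Lemma mem_outside_block (j j' : 'I_a) (r : 'I_4) : (4 * j + r \in outside j')%N = (j != j').
Proof.
have := ltn_ord j; have := ltn_ord r; rewrite mem_outside -(inj_eq val_inj) /=.
move: (val j) (val r) (val j') aN; clear; lia.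
Qed.

(** Tangent i belongs to every product, so at its meeting points with the four tangents of block j
    only product j contributes, through a single term. This gives a cubic in v with four roots. *)
Lemma coef_far (j : 'I_a) i : (i < N)%N -> (4 * a <= i)%N -> al j i = 0 /\ be j i = 0.
Proof.
move=> iN ai; have iS (j' : 'I_a) : i \in outside j'.
  by rewrite mem_outside iN /=; have := ltn_ord j'; move: (val j') ai; clear; lia.
have h (r : 'I_4) : let v := s (4 * j + r) in conic (t j) (s i) v * (al j i * (s i + v) + be
  j i) = 0.
  have ne : i != (4 * j + r)%N.
    by have := ltn_ord j; have := ltn_ord r; move: (val j) (val r) ai; clear; lia.
  have := rel (s i) (s (4 * j + r)); rewrite (bigD1 j) //= big1 => [|j' jj'].
    rewrite addr0 relation_term_in_out // => /eqP; rewrite mulf_eq0 => /orP[|/eqP//].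
    rewrite /partial_prod prodf_seq_eq0 => /hasP[i' i'S /andP[ii']]; apply: contraTeq => _.
    apply: tangent_value_neq0 => //; apply: contraTneq i'S => ->;
      by rewrite mem_outside_block eqxx.
  by apply: relation_term_in_in => //; rewrite mem_outside_block eq_sym.
pose p : {poly k} := (1%:P + (t j * s i) *: 'X) * ((1 - t j + t j * s i)%:P + t j *: 'X)
  * ((al j i * s i + be j i)%:P + al j i *: 'X).
have p0 : p = 0.
  apply: (@vanish_at_quadruple _ p (fun r => s (4 * j + r))).
  - by move=> r r' /(node_inj hk); lia.
  - by rewrite /p; apply: (@size_mull _ _ _ 2 1 (size_mull (size_affine _ _) (size_affine _
    _))); exact: size_affine.
  move=> r; rewrite -(h r) /p /conic; move: (s i) (node k (4 * j + r)) => u v.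
  by rewrite !hornerE /=; ring.
move/eqP: p0; rewrite !mulf_eq0 -orbA; case/or3P=> /eqP p0.
- have := congr1 (coefp 0) p0.
  by rewrite /= coefD coefC coefZ coefX mulr0 addr0 coef0 => /eqP; rewrite oner_eq0.
- have := congr1 (coefp 1%N) p0.
  by rewrite /= coefD coefC coefZ coefX mulr1 add0r coef0 => /eqP; rewrite (negPf (t0 j)).
have a0 : al j i = 0.
  by have := congr1 (coefp 1%N) p0; rewrite /= coefD coefC coefZ coefX mulr1 add0r coef0.
have := congr1 (coefp 0) p0.
by rewrite /= coefD coefC coefZ coefX mulr0 addr0 coef0 a0 mul0r add0r.
Qed.

(** At the 16 meeting points of tangents of blocks j and j' only these two products contribute. Up
    to the factor s i1 - s i2, each [partial_prod] is a function of i1 times a function of i2 ([PE],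
    [PE']). Rescaling the unknowns by the ratios [ka] absorbs these functions and leaves the system
    [block]. *)
Lemma coef_near (j j' : 'I_a) (r0 : 'I_4) : j != j' ->
  al j (4 * j' + r0)%N = 0 /\ be j (4 * j' + r0)%N = 0.
Proof.
move=> jj'; pose Nn j i := \prod_(i' <- outside j) (s i - s i').
pose Mm j i := \prod_(i' <- outside j | i' != i) (s i - s i').
have Nn0 (l : 'I_a) (r : 'I_4) : Nn l (4 * l + r)%N != 0.
  rewrite /Nn prodf_seq_neq0; apply/allP=> i iS /=; apply: node_sub_neq0.
  by apply: contraTneq iS => <-; rewrite mem_outside_block eqxx.
have Mm0 l i : Mm l i != 0.
  rewrite /Mm prodf_seq_neq0; apply/allP=> i' iS /=; apply/implyP=> ii.
  by apply: node_sub_neq0; rewrite eq_sym.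
pose ka (l l' : 'I_a) (r : 'I_4) := Mm l (4 * l' + r)%N / Nn l' (4 * l' + r)%N.
have ka0 l l' r : ka l l' r != 0 by rewrite mulf_neq0 // invr_neq0.
have PE l i1 i2 : i2 \in outside l -> (s i1 - s i2) * partial_prod l i2 (s i1) (s i2) = Nn l
  i1 * Mm l i2.
  move=> h; rewrite /partial_prod /tangent_value big_split /= /Nn (bigD1_seq i2)
    ?uniq_outside //=.
  by rewrite mulrA.
have PE' l i1 i2 : i1 \in outside l -> (s i2 - s i1) * partial_prod l i1 (s i1) (s i2) = Nn l
  i2 * Mm l i1.
  move=> h; rewrite /partial_prod /tangent_value big_split /= /Nn [in RHS](bigD1_seq i1)
    ?uniq_outside //=.
  by rewrite -mulrA; congr (_ * _); rewrite mulrC.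
pose A0 (r : 'I_4) := let i := (4 * j' + r)%N in ka j j' r * (al j i * s i + be j i).
pose A1 (r : 'I_4) := ka j j' r * al j (4 * j' + r)%N.
pose B0 (r : 'I_4) := let i := (4 * j + r)%N in ka j' j r * (al j' i * s i + be j' i).
pose B1 (r : 'I_4) := ka j' j r * al j' (4 * j + r)%N.
have H (r r' : 'I_4) : let u := s (4 * j + r) in let v := s (4 * j' + r') in
    conic (t j) u v * (A0 r' + A1 r' * u) = conic (t j') u v * (B0 r + B1 r * v).
  rewrite /=; set i1 := (4 * j + r)%N; set i2 := (4 * j' + r')%N.
  have h1 : i1 \in outside j' by rewrite mem_outside_block.
  have h2 : i2 \in outside j by rewrite mem_outside_block eq_sym.
  have ne : i1 != i2.
    by apply: contraTneq h2 => <-; rewrite mem_outside_block eqxx.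
  have := rel (s i1) (s i2);
    rewrite (bigD1 j) //= (bigD1 j') 1?eq_sym //= big1 => [|l /andP[lj lj']]; last first.
    by apply: relation_term_in_in => //; rewrite mem_outside_block eq_sym.
  rewrite addr0 relation_term_out_in // relation_term_in_out // => hr.
  rewrite /A0 /A1 /B0 /B1 /ka -/i1 -/i2.
  have n1 : Nn j i1 != 0 by exact: Nn0.
  have n2 : Nn j' i2 != 0 by exact: Nn0.
  apply: (mulfI n1); apply: (mulfI n2).
  have e1 := PE j i1 i2 h2; have e2 := PE' j' i1 i2 h1.
  apply/eqP; rewrite -subr_eq0; apply/eqP.
  have -> : Nn j' i2 * (Nn j i1 * (conic (t j) (s i1) (s i2) *
     (Mm j i2 / Nn j' i2 * (al j i2 * s i2 + be j i2) + Mm j i2 / Nn j' i2 * al j i2 * s i1)))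
     - Nn j' i2 * (Nn j i1 * (conic (t j') (s i1) (s i2) *
     (Mm j' i1 / Nn j i1 * (al j' i1 * s i1 + be j' i1) + Mm j' i1 / Nn j i1 * al j' i1 * s
       i2)))
     = (Nn j i1 * Mm j i2) * (conic (t j) (s i1) (s i2) * (al j i2 * (s i1 + s i2) + be j i2))
     - (Nn j' i2 * Mm j' i1) * (conic (t j') (s i1) (s i2) * (al j' i1 * (s i1 + s i2) + be
       j' i1)).
    set x1 := conic (t j) _ _; set x2 := conic (t j') _ _.
    by move: x1 x2 (s i1) (s i2) => x1 x2 u v; field; rewrite n1 n2.
  rewrite -e1 -e2 -[RHS](mulr0 (s i1 - s i2)) -hr.
  set x1 := conic (t j) _ _; set x2 := conic (t j') _ _.
  set y1 := partial_prod j _ _ _; set y2 := partial_prod j' _ _ _.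
  by move: x1 x2 y1 y2 (s i1) (s i2) => x1 x2 y1 y2 u v; ring.
have [e0 e1 _ _] := tblock jj' H r0.
have a0 : al j (4 * j' + r0)%N = 0.
  by apply: (mulfI (ka0 j j' r0)); rewrite mulr0.
split=> //; apply: (mulfI (ka0 j j' r0)); rewrite mulr0 -[RHS]e0 /A0 a0.
by rewrite mul0r add0r.
Qed.

Lemma coef_zero (j : 'I_a) i : i \in outside j -> al j i = 0 /\ be j i = 0.
Proof.
rewrite mem_outside => /andP[iN ij]; case: (leqP (4 * a) i) => ia; first exact: coef_far.
have i4 : (i %/ 4 < a)%N by move: ia; clear; lia.
have ir : (i %% 4 < 4)%N by exact: ltn_pmod.
have := @coef_near j (Ordinal i4) (Ordinal ir).
have -> : (4 * Ordinal i4 + Ordinal ir)%N = i by rewrite /= mulnC -divn_eq.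
by apply; rewrite -(inj_eq val_inj) /= eq_sym.
Qed.

(** With the other coefficients gone, the meeting points of two tangents of the same block j give
    tau_j = 0 there. tau_j is symmetric and quadratic in each variable; each node has three partners
    in its block, so tau_j vanishes for u at a node and any v, and then identically by symmetry. *)
Lemma tau_zero (j : 'I_a) : [/\ cA j = 0, cB j = 0, cC j = 0, cD j = 0 & cc j = 0].
Proof.
have RE l u v : relation_term l u v = full_prod l u v * tau l u v.
  rewrite /relation_term big1_seq ?add0r // => i /= /coef_zero[-> ->].
  by rewrite mul0r add0r !mulr0.
have h1 (r r' : 'I_4) : r != r' -> tau j (s (4 * j + r)) (s (4 * j + r')) = 0.
  move=> rr; have := rel (s (4 * j + r)) (s (4 * j + r')).
  rewrite (bigD1 j) //= big1 => [|l lj];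
    last by rewrite RE full_prod_l ?mul0r // mem_outside_block eq_sym.
  rewrite addr0 RE => /eqP; rewrite mulf_eq0 => /orP[|/eqP//].
  rewrite /full_prod prodf_seq_eq0 => /hasP[i iS /=]; apply: contraTeq => _.
  by apply: tangent_value_neq0; apply: contraTneq iS => ->; rewrite mem_outside_block eqxx.
pose E u v : k := tau j u v.
have quad u : exists q : k * k * k, forall v, E u v = q.1.1 + q.1.2 * v + q.2 * v ^+ 2.
  exists ((1 - t j + t j * u) * cA j * u + cC j + cc j * (1 - t j + t j * u),
    (1 - t j + t j * u) * (cA j + cB j * u) + t j * cA j * u + cD j * u + t j * u * cC j
      + cc j * (t j + t j * u * (1 - t j + t j * u)),
    t j * (cA j + cB j * u) + t j * cD j * u ^+ 2 + cc j * t j ^+ 2 * u) => v.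
  by rewrite /E /tau /conic /=; ring.
have Esym u v : E u v = E v u by rewrite /E /tau /conic; ring.
have three u (r1 r2 r3 : 'I_4) : uniq [:: r1; r2; r3] ->
    all (fun r : 'I_4 => E u (s (4 * j + r)) == 0) [:: r1; r2; r3] -> forall v, E u v = 0.
  move=> hu ha v; have [q hq] := quad u; rewrite hq.
  apply: (@quadratic_three_roots _ _ _ (s (4 * j + r1)) (s (4 * j + r2)) (s (4 * j + r3))).
    move: hu; rewrite /= !inE !(inj_eq (node_inj hk)) !eqn_add2l.
    by rewrite !(inj_eq val_inj).
  by move: ha; rewrite /= !hq.
have h2 (r : 'I_4) v : E (s (4 * j + r)) v = 0.
  have [r1 [r2 [r3 [u1 n1 n2 n3]]]] : exists r1 r2 r3 : 'I_4,
      [/\ uniq [:: r1; r2; r3], r != r1, r != r2 & r != r3].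
    pose o i := inord i : 'I_4.
    case: r => [[|[|[|[|//]]]] lt].
    - by exists (o 1%N), (o 2%N), (o 3%N); rewrite /= !inE -!(inj_eq val_inj) /= !inordK.
    - by exists (o 0%N), (o 2%N), (o 3%N); rewrite /= !inE -!(inj_eq val_inj) /= !inordK.
    - by exists (o 0%N), (o 1%N), (o 3%N); rewrite /= !inE -!(inj_eq val_inj) /= !inordK.
    - by exists (o 0%N), (o 1%N), (o 2%N); rewrite /= !inE -!(inj_eq val_inj) /= !inordK.
  by apply: (three _ r1 r2 r3) => //=; rewrite /E !h1 ?eqxx.
have h3 u v : E u v = 0.
  apply: (three _ (inord 0) (inord 1) (inord 2)).
    by rewrite /= !inE -!(inj_eq val_inj) /= !inordK.
  by rewrite /= ![E u _]Esym !h2 eqxx.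
have tj := t0 j; have [] := @symmetric_quadratic_zero (cC j + cc j * (1 - t j))
  ((1 - t j) * cA j + cc j * t j)
  ((1 - t j) * cB j + cD j + t j * cC j + cc j * (t j * (1 - t j)))
  (t j * cA j) (t j * cB j + cc j * t j ^+ 2) (t j * cD j).
  by move=> u v; rewrite -(h3 u v) /E /tau /conic; ring.
move=> e0 e1 e3 e4 e5.
have A0 : cA j = 0 by apply: (mulfI tj); rewrite mulr0.
have D0 : cD j = 0 by apply: (mulfI tj); rewrite mulr0.
have c0 : cc j = 0 by apply: (mulIf tj); rewrite mul0r -[RHS]e1 A0 mulr0 add0r.
have B0 : cB j = 0 by apply: (mulfI tj); rewrite mulr0 -[RHS]e4 c0 mul0r addr0.
by split=> //; rewrite -[RHS]e0 c0 mul0r addr0.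
Qed.
End Core.

Lemma dim_span_indep (k : fieldType) (V : vectType k) (T : eqType) (idx : seq T) (G : T -> V) :
  uniq idx -> (forall c : T -> k, \sum_(x <- idx) c x *: G x = 0 ->
    forall x, x \in idx -> c x = 0) -> \dim <<map G idx>> = size idx.
Proof.
move=> hu h; pose n := size idx; pose I := in_tuple idx.
suff : free (map_tuple G I) by rewrite /free /= size_map => /eqP.
apply/freeP=> b hb i.
pose c x := if insub (index x idx) : option 'I_n is Some l then b l else 0.
have cE l : c (tnth I l) = b l.
  by rewrite /c (tnth_nth (tnth I l)) index_uniq ?insubT //= => hl; congr (b _); apply: val_inj.
rewrite -cE; apply: h; last exact: mem_tnth.
rewrite big_tnth -[RHS]hb; apply: eq_bigr => l _.
by rewrite cE -tnth_nth tnth_map.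
Qed.

Lemma cofactors_mem_map (A : comNzRingType) (f : nat -> A) (S : seq nat) (r : seq A) i :
  uniq S -> i \in S ->
  (\prod_(i' <- S | i' != i) f i') * (\prod_(l <- r) l) \in cofactors (map f S ++ r).
Proof.
elim: S => //= i0 S IH /andP[i0S uS]; rewrite inE big_cons => /predU1P[->|iS].
  rewrite eqxx inE big_cat big_map /= -big_filter; apply/orP; left; apply/eqP.
  congr (_ * _); rewrite big_filter big_seq_cond [RHS]big_seq; apply: eq_bigl => i'.
  by apply: andb_idr => iS'; apply: contraNneq i0S => <-.
have -> : i0 != i by apply: contraNneq i0S => ->.
by rewrite inE -mulrA map_f ?orbT // IH.
Qed.

Section Plane.
Variables (k : fieldType) (hk : [pchar k] =i pred0).
Notation R := {mpoly k[3]}.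
Let z : R := 'X_(Ordinal (isT : 0 < 3)%N).
Let x : R := 'X_(Ordinal (isT : 1 < 3)%N).
Let y : R := 'X_(Ordinal (isT : 2 < 3)%N).
Variables (e a : nat) (ae : (4 * a <= e.+2)%N).
Let N := e.+2.
Variable (t : 'I_a -> k).
Hypothesis t0 : forall j, t j != 0.
Hypothesis tblock : forall j j' : 'I_a, j != j' -> block (t j) (t j') j j'.

(* The tangent line at parameter s of the conic of points [1 : 2s : s^2]; the
   point [1 : u+v : uv] is the intersection of the tangents at u and v. *)
Definition tangent i : R := y - node k i *: x + node k i ^+ 2 *: z.
Definition mu1 (j : 'I_a) : R := z + t j *: y.
Definition mu2 (j : 'I_a) : R := (1 - t j) *: z + t j *: x.
(** The number of lines is (e + 2) - 4 + 2 = e. On the parametrised points the product of the two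
    added lines is [conic]. *)
Definition plane_lines (j : 'I_a) : seq R := map tangent (outside N j) ++ [:: mu1 j; mu2 j].

(** Labels for a basis of the tangent space: for each factor l, the product of the other factors
    times two linear forms complementary to l, and finally the product itself, 2e + 1 elements in
    all. The labels [N] and [N.+1] stand for dropping [mu1] and [mu2]. *)
Definition plane_index (j : 'I_a) : seq (nat * bool) :=
  [seq (i, b) | i <- outside N j ++ [:: N; N.+1], b <- [:: true; false]] ++ [:: (N.+2, true)].

Definition plane_gen (j : 'I_a) (p : nat * bool) : R :=
  if (p.1 < N)%N then
    (\prod_(i' <- outside N j | i' != p.1) tangent i') * (mu1 j * mu2 j) * (if p.2 then x
      else z)
  else if p.1 == N then (\prod_(i' <- outside N j) tangent i') * mu2 j * (if p.2 then x else y)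
  else if p.1 == N.+1 then (\prod_(i' <- outside N j) tangent i') * mu1 j * (if p.2 then z
    else y)
  else (\prod_(i' <- outside N j) tangent i') * (mu1 j * mu2 j).

Lemma size_outside (j : 'I_a) : size (outside N j) = (e.+2 - 4)%N.
Proof.
have jN : (4 * j + 4 <= N)%N.
  by have := ltn_ord j; move: (val j) ae; rewrite /N; clear; lia.
have -> : (e.+2 - 4 = 4 * j + (N - (4 * j + 4)))%N.
  by move: jN; rewrite /N; move: (4 * j)%N; clear; lia.
rewrite /outside -{1}(subnKC jN) -addnA (iotaD 0 (4 * j)) (iotaD _ 4) !filter_cat !size_cat.
rewrite [X in (_ + (X + _))%N](_ : _ = 0%N); last first.
  apply/eqP; rewrite size_eq0 -(negbK (_ == _)) -has_filter -all_predC.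
  apply/allP=> i; rewrite mem_iota /= negbK; move: (val j) => j'; clear; lia.
have hall (P : pred nat) m l : (forall i, (m <= i < m + l)%N -> P i) ->
    size [seq i <- iota m l | P i] = l.
  move=> hP; rewrite size_filter; rewrite -[RHS](size_iota m) (eq_in_count (a2 := predT)).
    by rewrite count_predT.
  by move=> i; rewrite mem_iota => /hP ->.
rewrite !add0n !hall //.
  by move=> i; move: (nat_of_ord j) => j'; clear; lia.
by move=> i; move: (nat_of_ord j) => j'; clear; lia.
Qed.

Lemma plane_index_uniq j : uniq (plane_index j).
Proof.
rewrite /plane_index cat_uniq; apply/and3P; split=> //.
  apply: allpairs_uniq => //; last by move=> [i b] [i' b'].
  rewrite cat_uniq uniq_outside /= !inE !mem_outside ltnn ltnNge leqnSn /=.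
  by rewrite neq_ltn leqnn.
apply/hasP=> -[p]; rewrite inE => /eqP -> /allpairsP[[i b] [/= ]];
  rewrite mem_cat mem_outside !inE.
by move=> h _ [iE _]; move: h; rewrite -iE /N; lia.
Qed.

Lemma size_plane_index (j : 'I_a) : (2 <= e)%N -> size (plane_index j) = (2 * e + 1)%N.
Proof.
move=> e2; rewrite size_cat size_allpairs size_cat size_outside /=; lia.
Qed.

Lemma tangent_homog i : tangent i \is 1.-homog.
Proof. by rewrite rpredD ?rpredB ?rpredZ // homogX. Qed.
Lemma mu1_homog j : mu1 j \is 1.-homog.
Proof. by rewrite rpredD ?rpredZ // homogX. Qed.
Lemma mu2_homog j : mu2 j \is 1.-homog.
Proof. by rewrite rpredD ?rpredZ // homogX. Qed.

Lemma plane_lines_forms (j : 'I_a) : (2 <= e)%N ->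
  (size (plane_lines j) == e) && all (fun l => l \is 1.-homog) (plane_lines j).
Proof.
move=> e2; rewrite size_cat size_map size_outside all_cat [all _ [:: _;
  _]]/= mu1_homog mu2_homog andbT.
apply/andP; split; first by apply/eqP; rewrite /=; move: e2; clear; lia.
by rewrite ?andbT; apply/allP=> l /mapP[i _ ->]; exact: tangent_homog.
Qed.

Let As := [seq plane_lines j | j <- enum 'I_a].
Let W := hspan e (config_gens (xvars k 3) As [::] [::] [::]).

Lemma plane_gen_mem (j : 'I_a) p : p \in plane_index j -> hp e (plane_gen j p) \in W.
Proof.
have jA : plane_lines j \in As by apply: map_f; rewrite mem_enum.
have hm b i : b \in cofactors (plane_lines j) -> hp e (b * 'X_i) \in W.
  move=> hb; apply/memv_span/map_f; rewrite /config_gens mem_cat; apply/orP; left.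
  apply/flatten_mapP; exists (plane_lines j) => //; apply/allpairsP; exists (b, 'X_i).
  by rewrite /= hb; split=> //; apply: map_f; rewrite mem_enum.
have b3 : (\prod_(i' <- outside N j) tangent i') * mu2 j \in cofactors (plane_lines j).
  rewrite /plane_lines; elim: (outside N j) => [|i S IH] /=.
    by rewrite !big_nil big_cons big_nil mulr1 mul1r inE eqxx.
  by rewrite big_cons -mulrA inE map_f ?orbT.
have b4 : (\prod_(i' <- outside N j) tangent i') * mu1 j \in cofactors (plane_lines j).
  rewrite /plane_lines; elim: (outside N j) => [|i S IH] /=.
    by rewrite !big_nil mulr1 mul1r !inE eqxx orbT.
  by rewrite big_cons -mulrA inE map_f ?orbT.
have b5 i : i \in outside N j ->
   (\prod_(i' <- outside N j | i' != i) tangent i') * (mu1 j * mu2 j) \in cofactors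
     (plane_lines j).
  move=> iS; have := cofactors_mem_map tangent [:: mu1 j; mu2 j] (uniq_outside N j) iS.
  by rewrite !big_cons big_nil mulr1.
rewrite /plane_index mem_cat => /orP[/allpairsP[[i b] [/= hi _ ->]]|].
  move: hi; rewrite mem_cat !inE => /or3P[iS|/eqP->|/eqP->]; rewrite /plane_gen /=.
  - have -> : (i < N)%N by move: iS; rewrite mem_outside => /andP[].
    by case: b; apply/hm/b5.
  - by rewrite ltnn eqxx; case: b; exact: hm.
  - by rewrite ltnNge leqnSn eqxx -[_ == N]/(N.+1 == N) eqn_leq ltnn; case: b; exact: hm.
rewrite inE => /eqP ->; rewrite /plane_gen /=.
have -> : (N.+2 < N)%N = false by lia.
have -> : (N.+2 == N) = false by lia.
have -> : (N.+2 == N.+1) = false by lia.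
set F := \prod_(i' <- _) _.
have -> : F * (mu1 j * mu2 j) = F * mu2 j * z + t j *: (F * mu2 j * y).
  by rewrite scalerAr -mulrDr -/(mu1 j) mulrA mulrAC.
by rewrite linearD linearZ; apply: memvD; [exact: hm | apply/memvZ/hm].
Qed.

Definition at_point (u v : k) : R -> k := meval (fun i : 'I_3 => [:: 1; u + v; u * v]`_i).

Lemma tangent_at i u v : at_point u v (tangent i) = tangent_value i u v.
Proof.
rewrite /at_point /tangent mevalD mevalB !mevalZ !mevalXU /= /tangent_value.
by move: (node k i) => s; ring.
Qed.

Lemma mu_at j u v : at_point u v (mu1 j) * at_point u v (mu2 j) = conic (t j) u v.
Proof. by rewrite /at_point /mu1 /mu2 !mevalD !mevalZ !mevalXU /= /conic; ring. Qed.

Lemma plane_gen_homog (j : 'I_a) p : (2 <= e)%N -> p \in plane_index j -> plane_gen j p \is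
  e.-homog.
Proof.
move=> e2; have hF : \prod_(i' <- outside N j) tangent i' \is (e - 2).-homog.
  rewrite -[\prod_(i' <- _) _](big_map tangent predT id).
  have -> : (e - 2)%N = size (map tangent (outside N j)) by rewrite size_map size_outside;
    move: e2; clear; lia.
  by apply: prod_homog; apply/allP=> l /mapP[i _ ->]; exact: tangent_homog.
have hP i : i \in outside N j -> \prod_(i' <- outside N j | i' != i) tangent i' \is (e -
  3).-homog.
  move=> iS; rewrite -big_filter -[\prod_(i' <- _) _](big_map tangent predT id).
  have -> : (e - 3)%N = size (map tangent [seq i' <- outside N j | i' != i]).
    rewrite size_map; have := size_rem iS;
      rewrite (rem_filter _ (uniq_outside N j)) size_outside.
    by rewrite (eq_filter (a2 := predC1 i)) // => ->; move: e2; clear; lia.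
  by apply: prod_homog; apply/allP=> l /mapP[i' _ ->]; exact: tangent_homog.
have hif (b : bool) i i' : (if b then 'X_i else 'X_i' : R) \is 1.-homog by case: b;
  exact: homogX.
have h1 := mu1_homog j; have h2 := mu2_homog j.
rewrite /plane_index mem_cat => /orP[/allpairsP[[i b] [/= hi _ ->]]|].
  move: hi; rewrite mem_cat !inE => /or3P[iS|/eqP->|/eqP->]; rewrite /plane_gen /=.
  - have -> : (i < N)%N by move: iS; rewrite mem_outside => /andP[].
    have := dhomogM (dhomogM (hP _ iS) (dhomogM h1 h2)) (hif b _ _).
    have -> : (e - 3 + (1 + 1) + 1 = e)%N.
      have : (0 < size (outside N j))%N by case: (outside N j) iS.
      by rewrite size_outside; move: e2; clear; lia.
    by apply.
  - rewrite ltnn eqxx; have := dhomogM (dhomogM hF h2) (hif b _ _).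
    have -> : (e - 2 + 1 + 1 = e)%N by move: e2; clear; lia.
    by apply.
  - have -> : (N.+1 < N)%N = false by lia.
    have -> : (N.+1 == N) = false by lia.
    rewrite eqxx; have := dhomogM (dhomogM hF h1) (hif b _ _).
    have -> : (e - 2 + 1 + 1 = e)%N by move: e2; clear; lia.
    by apply.
rewrite inE => /eqP ->; rewrite /plane_gen /=.
have -> : (N.+2 < N)%N = false by lia.
have -> : (N.+2 == N) = false by lia.
have -> : (N.+2 == N.+1) = false by lia.
have := dhomogM hF (dhomogM h1 h2).
have -> : (e - 2 + (1 + 1) = e)%N by move: e2; clear; lia.
by apply.
Qed.

Lemma plane_gen_at (c : nat * bool -> k) (j : 'I_a) u v :
  \sum_(p <- plane_index j) c p * at_point u v (plane_gen j p) =
  relation_term N t (fun _ i => c (i, true)) (fun _ i => c (i, false))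
    (fun _ => c (N, true)) (fun _ => c (N, false)) (fun _ => c (N.+1, true))
    (fun _ => c (N.+1, false)) (fun _ => c (N.+2, true)) j u v.
Proof.
have atM f g : at_point u v (f * g) = at_point u v f * at_point u v g by exact: mevalM.
have atP P : at_point u v (\prod_(i' <- outside N j | P i') tangent i') = \prod_(i' <-
  outside N j | P i') tangent_value i' u v.
  by rewrite /at_point rmorph_prod; apply: eq_bigr => i _; exact: tangent_at.
have atX : [/\ at_point u v x = u + v, at_point u v y = u * v & at_point u v z = 1].
  by split; rewrite /at_point mevalXU.
have m1 : at_point u v (mu1 j) = 1 + t j * (u * v).
  by rewrite /at_point mevalD mevalZ !mevalXU.
have m2 : at_point u v (mu2 j) = (1 - t j) + t j * (u + v).
  by rewrite /at_point mevalD !mevalZ !mevalXU /= mulr1.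
case: atX => ax ay az.
rewrite /plane_index big_cat big_seq1 big_allpairs big_cat /= /relation_term -addrA;
  congr (_ + _).
  rewrite big_seq [RHS]big_seq; apply: eq_bigr => i iS.
  have iN : (i < N)%N by move: iS; rewrite mem_outside => /andP[].
  rewrite !big_cons big_nil /plane_gen /= iN !atM atP mu_at ax az /partial_prod.
  by move: (\prod_(_ <- _ | _) _) (conic _ _ _) => P C; ring.
rewrite !big_cons !big_nil /plane_gen /=.
have -> : (N < N)%N = false by lia.
have -> : (N.+1 < N)%N = false by lia.
have -> : (N.+2 < N)%N = false by lia.
have -> : (N.+1 == N) = false by lia.
have -> : (N.+2 == N) = false by lia.
have -> : (N.+2 == N.+1) = false by lia.
rewrite !eqxx !atM (atP predT) ax ay az /tau /conic m1 m2 /full_prod.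
by move: (\prod_(_ <- _) _) => P; ring.
Qed.

Lemma plane_independent : (2 <= e)%N -> rank_attained k 2 e a 0 (a * (2 * e + 1)).
Proof.
move=> e2; exists As, [::]; split=> //.
- by rewrite size_map size_enum_ord.
- by apply/allP=> ls /mapP[j _ ->]; exact: plane_lines_forms.
rewrite -/W; pose idx := [seq (j, p) | j <- enum 'I_a, p <- plane_index j].
have sidx : size idx = (a * (2 * e + 1))%N.
  rewrite size_allpairs_dep (eq_map (g := fun=> (2 * e + 1)%N)) => [|j];
    last exact: size_plane_index.
  by rewrite sumnE big_map big_enum sum_nat_const card_ord.
rewrite -sidx.
rewrite -(@dim_span_indep k _ _ idx (fun q => hp e (plane_gen q.1 q.2))).
- apply: dimvS; apply/span_subvP=> w /mapP[q /allpairsPdep[j [p [_ pK ->]]] ->] /=.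
  exact: plane_gen_mem.
- apply: allpairs_uniq_dep; first exact: enum_uniq.
    by move=> j _; exact: plane_index_uniq.
  by move=> [j p] [j' p'] _ _ /= [-> ->].
move=> c hc q /allpairsPdep[j [p [_ pK ->]]].
have rel u v : \sum_j relation_term N t (fun j i => c (j, (i, true))) (fun j i => c (j, (i,
  false)))
    (fun j => c (j, (N, true))) (fun j => c (j, (N, false))) (fun j => c (j, (N.+1, true)))
    (fun j => c (j, (N.+1, false))) (fun j => c (j, (N.+2, true))) j u v = 0.
  move/(congr1 (fun w => at_point u v (val w))): hc.
  rewrite [at_point u v (val 0)]meval0 => h0; apply: etrans h0.
  rewrite linear_sum /at_point rmorph_sum big_allpairs_dep /= big_enum /=.
  apply: eq_bigr => l _; apply: (etrans (esym (plane_gen_at (fun p => c (l, p)) l u v))).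
  rewrite big_seq [RHS]big_seq.
  by apply: eq_bigr => p' p'K; rewrite [RHS]mevalZ pihomog_dE // plane_gen_homog.
move: pK; rewrite /plane_index mem_cat => /orP[/allpairsP[[i b] [/= hi _ ->]]|].
  have [c1 c2 c3 c4 _] := tau_zero hk ae t0 tblock rel j.
  move: hi; rewrite mem_cat !inE => /or3P[iS|/eqP->|/eqP->]; try by case: b.
  by have [] := coef_zero hk ae t0 tblock rel iS; case: b.
rewrite inE => /eqP ->; by have [] := tau_zero hk ae t0 tblock rel j.
Qed.
End Plane.

Lemma rank_attained_plane_split (k : fieldType) (hk : [pchar k] =i pred0) e a :
  (4 * a <= e.+2)%N -> rank_attained k 2 e a 0 (a * (2 * e + 1)).
Proof.
case: a => [|a] ae; first exact: rank_attained0.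
have [t [t0 tb]] := block_choice hk a.+1.
by apply: (plane_independent hk ae t0 tb); lia.
Qed.

(** * Numerical induction in P^2 and P^3 *)

Lemma bin2_double n : ('C(n.+1, 2) * 2 = n.+1 * n)%N.
Proof. by rewrite mulnC -mul_bin_diag bin1. Qed.

Lemma bin3_six n : ('C(n.+2, 3) * 6 = n.+2 * n.+1 * n)%N.
Proof.
rewrite -[6%N]/(3 * 2)%N mulnA [('C(_, _) * 3)%N]mulnC -mul_bin_diag /=.
by rewrite -mulnA bin2_double mulnA.
Qed.

Section Plane.
Variables (k : fieldType) (hk : [pchar k] =i pred0).

(** Every split form contains the line; g products do not. On the line these g and the a residual
    products span 2 dimensions each, as far as there is room. *)
Lemma row_step0 e a c g r : rank_attained k 2 e.+1 a c r ->
  rank_attained k 2 e.+2 a (g + c) (minn (2 * (a + g)) e.+3 + minn 'C(e.+3, 2) (r + g)).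
Proof.
move=> h; have h1 := rank_attained_line_products hk e.+1 (a + g).
have E : (e.+1 + 2 = e.+3)%N by rewrite addn2.
by have := step hk h1 h; rewrite [(a + 0)%N]addn0 mul0n addn0 E.
Qed.

(** One split form does not contain the line; its trace alone is everything, and it leaves e + 2
    cofactors to the residue. *)
Lemma row_step1 e a c g r : rank_attained k 2 e.+1 a c r ->
  rank_attained k 2 e.+2 a.+1 (g + c) (e.+3 + minn 'C(e.+3, 2) (r + e.+2 + g)).
Proof.
move=> h; have h1 := rank_attained_line hk e.+1 1 (a + g).
have E : (e.+1 + 2 = e.+3)%N by rewrite addn2.
by have := step hk h1 h; rewrite [(a + 1)%N]addn1 mul1n E.
Qed.

(** With x = e + 1 - 2a, at most x / 2 products can miss the line in degree e, and x falls by one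
    with the degree. The second condition says that c is at most the sum of the integer parts of y /
    2 for y from 2a to x, so that no product is left in degree 4a - 2, the lowest degree where the a
    split forms are known to be independent. The third is the dimension count, with one unit to
    spare when e + 1 is odd, as spaces of dimension 2 then cannot fill the trace. *)
Definition plane_numerics e a c :=
  [/\ 4 * a <= e.+2, 4 * (c + a * a.-1) <= (e.+1 - 2 * a) ^ 2 &
   2 * (a * (2 * e + 1) + 3 * c + odd e.+1) <= e.+2 * e.+1]%N.

Lemma rank_attained_plane_mixed e a c : plane_numerics e.+1 a c ->
  rank_attained k 2 e.+1 a c (a * (2 * e.+1 + 1) + 3 * c).
Proof.
elim: e a c => [|e IH] a c [h1 h2 h3].
  have a0 : a = 0%N by lia.
  rewrite a0 in h1 h2 h3 *; case: c h2 h3 => [|c] h2 h3; first exact: rank_attained0.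
  have -> : c = 0%N by move: h2; clear; lia.
  exact: rank_attained_deg1.
case: (posnP c) => [c0|cpos].
  by rewrite c0 muln0 addn0; exact: rank_attained_plane_split.
pose x := (e.+3 - 2 * a)%N; rewrite -/x in h2.
have hx : (x + 2 * a = e.+3)%N by rewrite /x; lia.
(* As many products as fit are kept off the line; the others pass to the residue. *)
pose g := minn c x./2.
have ha : (4 * a <= e.+3)%N.
  rewrite leqNgt; apply/negP=> h.
  have xE : x = (2 * a - 1)%N by lia.
  case: (a) xE h2 hx h => [|a'] xE h2 hx h; first by move: h; clear; lia.
  have E : (x ^ 2 = 4 * (a'.+1 * a') + 1)%N by rewrite xE -mulnn; clear; lia.
  by move: h2 cpos; rewrite E /=; move: (a'.+1 * a')%N => y; clear; lia.
have xg2 : (2 <= x)%N.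
  rewrite leqNgt; apply/negP=> xlt; have : (x ^ 2 <= 1)%N by move: xlt; case: (x) => [|[|]].
  by move: h2 cpos; move: (a * a.-1)%N (x ^ 2)%N => y z; clear; lia.
have oE : odd x = odd e.+3 by rewrite -hx oddD oddM addbF.
have xE : (x = odd x + 2 * x./2)%N by rewrite mul2n odd_double_half.
have gx : (g <= x./2)%N by exact: geq_minr.
have gc : (g <= c)%N by exact: geq_minl.
have gp : (0 < g)%N by rewrite leq_min cpos; move: xg2 xE; clear; lia.
have hr : rank_attained k 2 e.+1 a (c - g) (a * (2 * e.+1 + 1) + 3 * (c - g)).
  case: (posnP (c - g)) => [->|cg]; first by rewrite muln0 addn0;
    exact: rank_attained_plane_split.
  have gE : g = x./2 by move: cg; rewrite /g; clear; lia.
  apply: IH; split=> //.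
  - have -> : (e.+2 - 2 * a = x.-1)%N by move: hx xg2; clear; lia.
    rewrite gE; move: h2 xE xg2 cg; rewrite gE.
    by case: (odd x); move: (a * a.-1)%N (x./2) => q y; clear; nia.
  - move: h3 hx xE oE gp; rewrite !oddS gE.
    by case: (odd x); case: (odd e) => //=; move: (x./2) cg => y cg; rewrite gE in cg;
      move: cg; clear; nia.
have := row_step0 g hr; rewrite subnKC //; apply: rank_attained_le.
have l1 : (2 * (a + g) <= e.+3)%N by move: gx xE hx; clear; lia.
have l2 : (a * (2 * e.+1 + 1) + 3 * (c - g) + g <= 'C(e.+3, 2))%N.
  rewrite -(leq_pmul2r (isT : 0 < 2)%N) bin2_double.
  case: (leqP c x./2) => [cx|xc].
    have gE : g = c by exact/minn_idPl.
    have hm : (4 * a * e.+1 <= e.+3 * e.+1)%N by rewrite leq_mul2r ha orbT.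
    rewrite gE subnn; move: hm cx xE hx; move: (x) (x./2) => X y; clear; nia.
  have gE : g = x./2 by exact/minn_idPr/ltnW.
  rewrite gE; move: h3 xc xE hx; rewrite -oE.
  by move: (x) (x./2) (odd x) => X y b; clear; lia.
by rewrite (minn_idPl l1) (minn_idPr l2); move: gc; clear; nia.
Qed.

(** Here c' of the products contain the line. The second hypothesis makes the trace everything; by
    the last one, the residue together with the c - c' single forms is everything too. *)
Lemma rank_attained_plane_span e a c c' : (c' <= c)%N -> (e.+3 <= 2 * (a + c - c'))%N ->
  plane_numerics e.+1 a c' ->
  (e.+3 * e.+2 <= 2 * (a * (2 * e.+1 + 1) + 2 * c' + c))%N ->
  rank_attained k 2 e.+2 a c 'C(e.+4, 2).
Proof.
move=> cc h1 h2 h3; have := row_step0 (c - c') (rank_attained_plane_mixed h2).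
rewrite subnK //; apply: rank_attained_le.
have l1 : (e.+3 <= 2 * (a + (c - c')))%N by rewrite addnBA.
have l2 : ('C(e.+3, 2) <= a * (2 * e.+1 + 1) + 3 * c' + (c - c'))%N.
  rewrite -(leq_pmul2r (isT : 0 < 2)%N) bin2_double.
  by move: h3 cc; move: (a * _)%N (_ * _)%N => y z; clear; lia.
by rewrite (minn_idPr l1) (minn_idPl l2) binS bin1 addnC.
Qed.
End Plane.

Section NumericsTables.
Local Open Scope nat_scope.

(* Along d = 18 j + r, the bounds s1 and s2 and the parameters of the induction
   are polynomials in j; the tables give their constant terms. The parameters
   are the number of split forms with no factor in the hyperplane (minus one in
   active_table), the number of those with such a factor (waiting_table), and
   d + 1 minus twice the former (gap_table). *)
Definition s1_table := [:: 0; 1; 1; 2; 2; 3; 4; 5; 6; 7; 9; 10; 12; 13; 15; 17; 19; 21; 23; 26].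
Definition s2_table := [:: 1; 1; 2; 2; 3; 4; 5; 6; 7; 8; 10; 12; 13; 15; 17; 18; 21; 23; 25].
Definition s1_nat d := let j := d %/ 18 in let r := d %% 18 in
  18 * (j * j) + (2 * r + 5) * j + nth 0 s1_table r.
Definition s2_slopes := [:: 6; 7; 7; 6; 7; 7; 6; 7; 7; 6; 7; 7; 6; 7; 7; 6; 7; 7; 6].
Definition s2_nat d := let j := d %/ 18 in let r := d %% 18 in
  18 * (j * j) + (2 * r + nth 0 s2_slopes r) * j + nth 0 s2_table r.
Definition active_table := [:: 0; 0; 0; 0; 0; 0; 0; 0; 0; 0; 1; 1; 1; 1; 1; 1; 1; 1; 1; 2].
Definition waiting_table := [:: 0; 0; 0; 1; 1; 2; 3; 4; 5; 6; 7; 8; 10; 11; 13; 15; 17; 19;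
  21; 23].
Definition gap_table := [:: 0; 0; 1; 2; 3; 4; 5; 6; 7; 8; 7; 8; 9; 10; 11; 12; 13; 14; 15; 14].

Lemma s1_natE j r : r < 20 -> s1_nat (18 * j + r) = 18 * (j * j) + (2 * r + 5) * j + nth 0
  s1_table r.
Proof.
rewrite /s1_nat => r20; case: (ltnP r 18) => r18.
  have -> : (18 * j + r) %/ 18 = j by lia.
  by have -> : (18 * j + r) %% 18 = r by lia.
have -> : (18 * j + r) %/ 18 = j.+1 by lia.
have -> : (18 * j + r) %% 18 = r - 18 by lia.
have [->|->] : r = 18 \/ r = 19 by lia.
all: rewrite /=; lia.
Qed.

(** [K] forms miss the plane and [A] contain it. Up to bounded terms A = d^2 / 18 + d / 6 and K = d
    / 9, so the residue A (3d - 2) + K d equals C(d + 2, 3) up to a term linear in d, whereas the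
    trace has room left. The range 2 to 19 for r lets d and d - 1 share the same j. *)
Lemma s1_params j r : 2 <= r -> r < 20 ->
  let d := 18 * j + r in let K := (2 * j + nth 0 active_table r).+1 in
  let A := 18 * (j * j) + (2 * r + 3) * j + nth 0 waiting_table r in
  [/\ A + K = s1_nat d, A <= s1_nat d.-1, plane_numerics d K A &
    6 * (A * (3 * d.-1 + 1) + K * d) <= d.+2 * d.+1 * d].
Proof.
move=> r2 r20 d K A; rewrite /d.
have -> : (18 * j + r).-1 = 18 * j + r.-1 by lia.
rewrite !s1_natE //; last by lia.
have : r \in iota 2 18 by rewrite mem_iota r2.
have xE : r \in iota 2 18 -> (18 * j + r).+1 - 2 * K = 14 * j + nth 0 gap_table r.
  by rewrite /K /= !inE; repeat (case/orP); move/eqP=> -> /=; lia.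
move=> ri; rewrite /plane_numerics xE // -mulnn /K /A; move: ri {d K A xE r2 r20}.
have oE : odd (18 * j + r).+1 = ~~ odd r by rewrite oddS oddD oddM.
rewrite oE {oE} /= !inE.
by repeat (case/orP); move/eqP=> -> /=; split; first [lia | split; first [lia | nia] | nia].
Qed.

Definition span_active_table := [:: 0; 1; 1; 1; 1; 2; 2; 2; 2; 2; 3; 3; 3; 3; 4; 3; 4; 4; 4].

Lemma s2_natE j r : r < 19 -> s2_nat (18 * j + r) =
  18 * (j * j) + (2 * r + nth 0 s2_slopes r) * j + nth 0 s2_table r.
Proof.
rewrite /s2_nat => r20; case: (ltnP r 18) => r18.
  have -> : (18 * j + r) %/ 18 = j by lia.
  by have -> : (18 * j + r) %% 18 = r by lia.
have -> : (18 * j + r) %/ 18 = j.+1 by lia.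
have -> : (18 * j + r) %% 18 = 0 by lia.
have -> : r = 18 by lia.
by rewrite /=; lia.
Qed.

(** [A] forms contain the plane, [a] do not, and c' of the traces of the former in turn contain the
    line. The trace is now the tight side: for it to be everything, 3 A + (2d + 1) a must reach C(d
    + 2, 2), which for A near d^2 / 18 takes a at least about d / 6. *)
Definition span_params d A a := [/\ A + a = s2_nat d, A <= s1_nat d.-1,
    d.+2 * d.+1 * d <= 6 * (A * (3 * d.-1 + 1) + a * d) &
  exists c', [/\ c' <= A, d.+1 <= 2 * (a + A - c'), plane_numerics d.-1 a c' &
    d.+1 * d <= 2 * (a * (2 * d.-1 + 1) + 2 * c' + A)]].

Lemma s2_params j r : 1 <= j -> 1 <= r -> r < 19 ->
  let d := 18 * j + r in exists A a, span_params d A a.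
Proof.
move=> j1 r1 r20 d; pose a := (nth 0 s2_slopes r - 3) * j + nth 0 span_active_table r.
pose A := 18 * (j * j) + (2 * r + 3) * j + nth 0 s1_table r.-1; exists A, a.
have ri : r \in iota 1 18 by rewrite mem_iota r1.
have dE : d.-1 = 18 * j + r.-1 by rewrite /d; lia.
have S1d : s1_nat d.-1 = A.
  rewrite dE s1_natE; last by lia.
  by rewrite /A; congr (_ + _ * _ + _); lia.
have S2d : A + a = s2_nat d.
  rewrite /d s2_natE // /A /a; move: ri; rewrite /= !inE; clear.
  by repeat (case/orP); move/eqP=> -> /=; lia.
have xE : d.-1.+1 - 2 * a = ((24 - 2 * nth 0 s2_slopes r) * j + r) - 2 * nth 0
  span_active_table r.
  rewrite dE /a; move: ri; rewrite /= !inE; clear -j1.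
  by repeat (case/orP); move/eqP=> -> /=; lia.
split; rewrite ?S1d //.
  rewrite dE /d /A /a; move: ri; rewrite /= !inE; clear -j1.
  by repeat (case/orP); move/eqP=> -> /=; nia.
(* Four times c' has to make up for the deficit [T] of the residue in the plane; the least such c'
   is taken. *)
pose T := d.+1 * d - 2 * (a * (2 * d.-1 + 1) + A).
have [c' [h1 h2]] : exists c', T <= 4 * c' /\ 4 * c' <= T + 3.
  by exists ((T + 3) %/ 4); lia.
exists c'.
have h3 : c' <= A /\ d.+1 <= 2 * (a + A - c').
  move: h2; rewrite /T dE /d /A /a; move: c' ri {h1 T S1d S2d xE dE A a d} => c'.
  rewrite /= !inE; clear -j1.
  by repeat (case/orP); move/eqP=> -> /= h; split; nia.
case: h3 => h3 h4; split=> //; last by move: h1; rewrite /T; clear; lia.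
rewrite /plane_numerics xE -mulnn.
have oE : odd d.-1.+1 = odd r by rewrite dE -addnS prednK // oddD oddM.
rewrite oE; move: h2; rewrite /T dE /d /A /a.
move: c' ri {h1 T S1d S2d xE dE A a d h3 h4 oE} => c'.
rewrite /= !inE; clear -j1.
by repeat (case/orP); move/eqP=> -> /= h; split; nia.
Qed.

End NumericsTables.

Section NumericsSpace.
Local Open Scope nat_scope.

Lemma plane_numerics_mono e a c a' c' : a' <= a -> c' <= c ->
  plane_numerics e a c -> plane_numerics e a' c'.
Proof.
move=> aa cc [h1 h2 h3]; split.
- by apply: leq_trans h1; rewrite leq_mul2l.
- apply: leq_trans (leq_trans h2 _).
    by rewrite leq_mul2l leq_add // leq_mul // -!subn1 leq_sub2r.
  by rewrite leq_exp2r // leq_sub2l // leq_mul2l.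
apply: leq_trans h3; apply: leq_mul => //; rewrite leq_add2r.
by apply: leq_add; rewrite ?leq_mul2r ?leq_mul2l ?aa ?cc ?orbT.
Qed.

Section Space.
Variables (k : fieldType) (hk : [pchar k]%R =i pred0).

Lemma space_step e A K r : rank_attained k 3 e.+1 A 0 (A * (3 * e.+1 + 1)) -> rank_attained k
  2 e.+2 K A r ->
  rank_attained k 3 e.+2 (A + K) 0 (r + minn 'C(e.+4, 3) (A * (3 * e.+1 + 1) + K * e.+2)).
Proof.
move=> h1 h2; rewrite -[A in rank_attained _ _ _ _ A _]addn0 in h2.
have E : e.+1 + 3 = e.+4 by rewrite addn3.
by have := step hk h2 h1; rewrite [X in minn _ X]addn0 E.
Qed.

Lemma rank_attained_space_independent d s : 0 < d -> s <= s1_nat d -> rank_attained k 3 d s 0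
  (s * (3 * d + 1)).
Proof.
elim: d s => // d IH s _; case: d IH => [|e] IH sS.
  have : s <= 1 by [].
  by case: s {sS} => [|[|//]] _; [exact: rank_attained0 | exact: rank_attained_deg1].
have [j [r [dE r2 r20]]] : exists j r, [/\ e.+2 = 18 * j + r, 2 <= r & r < 20].
  by exists (e %/ 18), (e %% 18 + 2); split; lia.
have /= := s1_params j r2 r20; rewrite -dE.
set K := (2 * j + _).+1; set A := 18 * _ + _ + _ => -[h1 h2 h3 h4].
(* When s is below the bound, the forms containing the plane are used up first. *)
pose A' := minn s A; have A's : A' <= s by exact: geq_minl.
have A'A : A' <= A by exact: geq_minr.
have K'K : s - A' <= K by move: sS A'A A's; rewrite -h1 /A'; move: (K) (A) => x y; clear; lia.
have hA' : rank_attained k 3 e.+1 A' 0 (A' * (3 * e.+1 + 1)).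
  by apply: IH => //; exact: leq_trans A'A h2.
have := space_step hA' (rank_attained_plane_mixed hk (plane_numerics_mono K'K A'A h3)).
rewrite subnKC //; apply: rank_attained_le.
have l1 : A' * (3 * e.+1 + 1) + (s - A') * e.+2 <= 'C(e.+4, 3).
  rewrite -(leq_pmul2r (isT : 0 < 6)) bin3_six mulnC; apply: leq_trans h4.
  by rewrite leq_mul2l leq_add // leq_mul2r ?A'A ?K'K ?orbT.
by rewrite (minn_idPr l1); move: A's; clear; nia.
Qed.

Lemma space_span_step e A K : A <= s1_nat e.+1 -> rank_attained k 2 e.+2 K A 'C(e.+4, 2) ->
  e.+4 * e.+3 * e.+2 <= 6 * (A * (3 * e.+1 + 1) + K * e.+2) ->
  rank_attained k 3 e.+2 (A + K) 0 'C(e.+1.+4, 3).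
Proof.
move=> hA hK h; apply: rank_attained_le (space_step (rank_attained_space_independent _ hA)
  hK) => //.
have l1 : 'C(e.+4, 3) <= A * (3 * e.+1 + 1) + K * e.+2.
  by rewrite -(leq_pmul2r (isT : 0 < 6)) bin3_six [X in _ <= X]mulnC.
by rewrite (minn_idPl l1) [X in X <= _]binS addnC.
Qed.

Lemma span_params_ok d A a : 3 <= d -> span_params d A a -> rank_attained k 3 d (s2_nat d) 0
  'C(d + 3, 3).
Proof.
case: d => [|[|[|e]]] // _ [<- h1 h2 [c' [h3 h4 h5 h6]]].
rewrite addn3; apply: space_span_step => //.
exact: (rank_attained_plane_span hk h3 h4 h5 h6).
Qed.

Lemma rank_attained_space_span_min d : 0 < d -> rank_attained k 3 d (s2_nat d) 0 'C(d + 3, 3).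
Proof.
move=> d0; case: (leqP 19 d) => d19.
  have [j [r [dE j1 r1 r19]]] : exists j r, [/\ d = 18 * j + r, 1 <= j, 1 <= r & r < 19].
    by exists (d.-1 %/ 18), (d.-1 %% 18 + 1); split; lia.
  have [A [a h]] := s2_params j1 r1 r19; rewrite -dE in h.
  by apply: span_params_ok h; lia.
have plane e a c g r v : v = minn (2 * (a + g)) e.+3 + minn 'C(e.+3, 2) (r + g) ->
    rank_attained k 2 e.+1 a c r -> rank_attained k 2 e.+2 a (g + c) v by move=> ->;
      exact: row_step0.
have plane1 e a c g r v : v = e.+3 + minn 'C(e.+3, 2) (r + e.+2 + g) ->
    rank_attained k 2 e.+1 a c r -> rank_attained k 2 e.+2 a.+1 (g + c) v by move=> ->;
      exact: row_step1.
have span e A K : A <= s1_nat e.+1 -> A + K = s2_nat e.+2 -> rank_attained k 2 e.+2 K A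
  'C(e.+4, 2) ->
    e.+4 * e.+3 * e.+2 <= 6 * (A * (3 * e.+1 + 1) + K * e.+2) ->
    rank_attained k 3 e.+2 (s2_nat e.+2) 0 'C(e.+2 + 3, 3).
  by move=> h1 <- h2 h3; rewrite addn3; exact: space_span_step.
have easy c' A a e : A <= s1_nat e.+2 -> A + a = s2_nat e.+3 ->
    e.+1.+4 * e.+4 * e.+3 <= 6 * (A * (3 * e.+2 + 1) + a * e.+3) ->
    [&& c' <= A, e.+4 <= 2 * (a + A - c'), 4 * a <= e.+4,
      4 * (c' + a * a.-1) <= (e.+3 - 2 * a) ^ 2,
      2 * (a * (2 * e.+2 + 1) + 3 * c' + odd e.+3) <= e.+4 * e.+3 &
      e.+4 * e.+3 <= 2 * (a * (2 * e.+2 + 1) + 2 * c' + A)] ->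
    rank_attained k 3 e.+3 (s2_nat e.+3) 0 'C(e.+3 + 3, 3).
  move=> h1 h2 h3 /and5P[h4 h5 h6 h7 /andP[h8 h9]];
    apply: (span_params_ok (A := A) (a := a)) => //.
  by split=> //; exists c'.
(* Degrees 1 to 18, where the polynomial tables do not apply. In degrees 4, 5, 6, 10 and 14 a split
   form missing the line is used as well, through [row_step1]. *)
case: d d0 d19 => [//|[|[|[|[|[|[|[|[|[|[|[|[|[|[|[|[|[|[|d]]]]]]]]]]]]]]]]]]] // _ _.
- exact: rank_attained_deg1.
- by apply: (@span 0 1 1) => //; apply: (@plane 0 1 0 1 3) => //; exact: rank_attained_deg1.
- by apply: (@easy 0 1 1).
- apply: (@span 2 2 1) => //; apply: (@plane1 2 0 2 0 6) => //.
  by apply: (@plane 1 0 0 2 0) => //; exact: rank_attained0.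
- apply: (@span 3 2 2) => //; apply: (@plane 3 2 0 2 15) => //.
  by apply: (@plane1 2 1 0 0 7) => //; exact: rank_attained_one.
- apply: (@span 4 3 2) => //; apply: (@plane 4 2 0 3 20) => //.
  by apply: (@plane1 3 1 0 0 9) => //; exact: rank_attained_one.
- by apply: (@easy 0 4 2).
- by apply: (@easy 1 5 2).
- by apply: (@easy 3 6 2).
- apply: (@span 8 7 3) => //; apply: (@plane 8 3 0 7 53) => //.
  by apply: (@plane1 7 2 0 0 34) => //; exact: (@rank_attained_plane_split _ hk 8 2).
- by apply: (@easy 0 9 3).
- by apply: (@easy 0 10 3).
- by apply: (@easy 2 12 3).
- apply: (@span 12 13 4) => //; apply: (@plane 12 4 0 13 102) => //.
  by apply: (@plane1 11 3 0 0 75) => //; exact: (@rank_attained_plane_split _ hk 12 3).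
- by apply: (@easy 9 15 3).
- by apply: (@easy 0 17 4).
- by apply: (@easy 1 19 4).
- by apply: (@easy 5 21 4).
Qed.
End Space.

End NumericsSpace.

(** * From P^3 to P^n *)

Section NumericsExtension.
Local Open Scope nat_scope.

Lemma rank_attained_bound (k : fieldType) n e m c r : rank_attained k n e m c r -> r <= 'C(e
  + n, n).
Proof.
case=> As [Cs [_ _ _ _ h]]; apply: leq_trans h _; rewrite -(dim_homog k).
by apply: dimvS; exact: subvf.
Qed.

Section Extend.
Variables (k : fieldType) (hk : [pchar k]%R =i pred0).

(** The residue consists of s spans of cofactors only. There is room for them: independence in [n]
    bounds s (n d + 1), hence s (n + 1), by C(d + n, n), and (n + 1) C(d + n, n + 1) = d C(d + n,
    n). *)
Lemma rank_attained_extend n e s : rank_attained k n e.+1 s 0 (s * (n * e.+1 + 1)) ->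
  rank_attained k n.+1 e.+1 s 0 (s * (n.+1 * e.+1 + 1)).
Proof.
move=> h; have hb := rank_attained_bound h; case: e h hb => [|e] h hb.
  have : s <= 1.
    move: hb; rewrite muln1 addn1 add1n binSn; case: s {h} => [|[|s]] //; nia.
  by case: s {h hb} => [|[|//]] _; [exact: rank_attained0 | rewrite mul1n;
    exact: rank_attained_one].
have := @step _ hk n e s 0 0 0 _ 0 h (rank_attained0 k n.+1 e.+1); apply: rank_attained_le.
have l1 : s * e.+2 <= 'C(e.+1 + n.+1, n.+1).
  have e1 : n.+1 * 'C(e.+1 + n.+1, n.+1) = e.+2 * 'C(e.+2 + n, n).
    by rewrite mul_bin_left -[e.+1 + n.+1]addSnnS addnK.
  rewrite -(leq_pmul2l (ltn0Sn n)) e1; move: hb; move: ('C(_, _)) => y; clear; nia.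
by rewrite addn0 add0n (minn_idPr l1); clear; nia.
Qed.

Lemma rank_attained_independent n d s : 0 < d -> s <= s1_nat d -> 3 <= n ->
  rank_attained k n d s 0 (s * (n * d + 1)).
Proof.
case: d => // e _ hs; elim: n => // n IH; rewrite leq_eqVlt => /predU1P[<-|n3].
  exact: rank_attained_space_independent.
exact: rank_attained_extend (IH n3).
Qed.

Lemma rank_attained_space_span d s : 0 < d -> s2_nat d <= s -> rank_attained k 3 d s 0 'C(d +
  3, 3).
Proof. by move=> d0 hs; apply: rank_attained_more (rank_attained_space_span_min hk d0). Qed.
End Extend.

End NumericsExtension.

Import Num.Theory.

Lemma s1E d : s1 d = (s1_nat d)%:R.
Proof.
have [j [r [dE r18]]] : exists j r, d = (18 * j + r)%N /\ (r < 18)%N.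
  by exists (d %/ 18)%N, (d %% 18)%N; split; lia.
rewrite dE s1_natE; last by lia.
rewrite /s1; have -> : ((18 * j + r) %% 9 = r %% 9)%N by lia.
have : r \in iota 0 18 by rewrite mem_iota.
rewrite /= !inE; repeat (case/orP); move/eqP=> -> /=; rewrite !natrD !natrM.
all: by field.
Qed.

Lemma s2E d : s2 d = (s2_nat d)%:R.
Proof.
have [j [r [dE r18]]] : exists j r, d = (18 * j + r)%N /\ (r < 18)%N.
  by exists (d %/ 18)%N, (d %% 18)%N; split; lia.
rewrite dE s2_natE; last by lia.
rewrite /s2; have -> : ((18 * j + r) %% 9 = r %% 9)%N by lia.
have -> : ((18 * j + r) %% 6 = r %% 6)%N by lia.
have : r \in iota 0 18 by rewrite mem_iota.
rewrite /= !inE; repeat (case/orP); move/eqP=> -> /=; rewrite !natrD !natrM.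
all: by field.
Qed.

(** * From ranks to the dimension of the secant variety *)

Section Generic.
Variables (k : fieldType) (hk : [pchar k] =i pred0).

Lemma meval_homog_scale n e (F : {mpoly k[n]}) (c : k) (y : 'I_n -> k) :
  F \is e.-homog -> F.@[fun i => c * y i] = c ^+ e * F.@[y].
Proof.
move=> hF; rewrite !mevalE mulr_sumr big_seq [RHS]big_seq; apply: eq_bigr => m mF.
have <- : mdeg m = e by exact: (dhomog_mf hF mF).
rewrite mulrCA; congr (_ * _); rewrite mdegE -prodrXr -big_split /=.
by apply: eq_bigr => i _; rewrite exprMn.
Qed.

(** This reads a partial derivative off values along a line parallel to an axis, with no symbolic
    differentiation of [P]. *)
Lemma directional_derivative n (P : {mpoly k[n]}) (x : 'I_n -> k) h a b :
  (forall t, P.@[fun i => x i + (i == h)%:R * t] = a + b * t) -> P^`M(h).@[x] = b.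
Proof.
move=> hP; pose l j : {poly k} := (x j)%:P + (j == h)%:R *: 'X.
have hE (q : {mpoly k[n]}) t : (mmap polyC l q).[t] = q.@[fun i => x i + (i == h)%:R * t].
  rewrite /mmap horner_sum mevalE; apply: eq_bigr => u _; rewrite hornerM hornerC;
    congr (_ * _).
  by rewrite /mmap1 horner_prod; apply: eq_bigr => j _; rewrite horner_exp !hornerE.
have lP : mmap polyC l P = a%:P + b *: 'X.
  apply/eqP; rewrite -subr_eq0; apply/negP=> /negP/(poly_nonroot hk)[t]; apply/negP;
    rewrite negbK.
  by rewrite hornerD hornerN hE hP !hornerE subrr.
have DC c : deriv (mmap polyC l c%:MP) = 0 by rewrite mmapC derivC.
have := derivation_chain (f := mmap polyC l) (@derivM _) DC P.
rewrite /= lP derivD derivC derivZ derivX add0r => /(congr1 (horner^~ 0)).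
rewrite hornerZ hornerC mulr1 => ->; rewrite horner_sum (bigD1 h) //= big1.
  rewrite addr0 hornerM hE mmapX mmap1U derivD derivC derivZ derivX eqxx.
  rewrite !hornerE /= ?mulr1; apply: meval_eq => i; by rewrite mulr0 addr0.
by move=> j ji; rewrite mmapX mmap1U derivD derivC derivZ derivX (negPf ji) scale0r addr0
  mulr0 horner0.
Qed.

(** For a relation P of least degree, the chain rule makes the gradient of P, composed with g, a
    left kernel vector of the Jacobian matrix, which has full row rank. So the partial derivatives
    of P are relations of lower degree, hence zero, and P is constant. *)
Lemma jacobian_criterion m n (g : m.-tuple {mpoly k[n]}) (x : 'I_n -> k) :
  row_free (\matrix_(c < m, h < n) (tnth g c)^`M(h).@[x]) ->
  forall P : {mpoly k[m]}, P != 0 -> P \mPo g != 0.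
Proof.
move=> /row_freeP[B hB] P; have [w] : exists w, (msize P <= w)%N by exists (msize P).
elim: w P => [|w IH] P hP.
  by rewrite -msize_poly_eq0 -leqn0 hP.
apply: contraNneq => Pg0; pose Jm := \matrix_(c < m, h < n) (tnth g c)^`M(h).
have wJ : (\row_c (P^`M(c) \mPo g)) *m Jm = 0.
  apply/rowP=> h; rewrite !mxE.
  have DC c : mderiv h (comp_mpoly g c%:MP) = 0 by rewrite comp_mpolyC mderivC.
  have := derivation_chain (f := comp_mpoly g) (D := mderiv h) (@mderivM _ _ h) DC P.
  rewrite /= Pg0 mderiv0 => h0; apply: etrans (esym h0); apply: eq_bigr => c _.
  by rewrite !mxE /= comp_mpolyXU -tnth_nth.
pose D := Jm *m map_mx (@mpolyC n k) B.
have D0 : \det D != 0.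
  apply/eqP=> /(congr1 (meval x)); rewrite meval0 -det_map_mx map_mxM.
  suff -> : map_mx (meval x) Jm *m map_mx (meval x) (map_mx (@mpolyC n k) B) = 1%:M.
    by rewrite det1 => /eqP; rewrite oner_eq0.
  rewrite -hB; congr (_ *m _); apply/matrixP=> i j; rewrite !mxE //=.
  by rewrite mevalC.
have w0 c : P^`M(c) \mPo g = 0.
  have : (\row_c (P^`M(c) \mPo g)) *m D *m \adj D = 0 by rewrite mulmxA wJ !mul0mx.
  rewrite -mulmxA mul_mx_adj mul_mx_scalar => /rowP/(_ c); rewrite !mxE => /eqP.
  by rewrite mulf_eq0 (negPf D0) => /eqP.
have d0 c : P^`M(c) = 0.
  apply/eqP/negPn/negP=> nz; have /negP[] : P^`M(c) \mPo g != 0; last by rewrite w0.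
  apply: IH => //; rewrite msizeE; apply/bigmax_leqP_seq => u.
  rewrite mcoeff_msupp mcoeff_deriv => hu _; rewrite -ltnS; apply: leq_trans hP.
  have := @msize_mdeg_lt _ _ P (u + U_(c))%MM; rewrite mdegD mdeg1 addn1; apply.
  by rewrite mcoeff_msupp; apply: contraNneq hu => ->; rewrite mul0rn.
have PE := mderiv_eq0_const hk d0.
have : P@_0 = 0 by move: Pg0; rewrite {1}PE comp_mpolyC => /eqP; rewrite mpolyC_eq0 => /eqP.
by move=> P0; rewrite PE P0 mpolyC0.
Qed.

(* There are D^(m+1) monomials in the F i with exponents below D, and for large
   D more of them than coefficients of polynomials in m variables of the degree
   that they have after homogenisation by G. *)
Lemma too_many_forms m (F : 'I_m.+1 -> {mpoly k[m]}) (G : {mpoly k[m]}) :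
  exists (P : {mpoly k[m.+1]}) (c : nat), [/\ P != 0,
    forall u, u \in msupp P -> (mdeg u <= c)%N &
    \sum_(u <- msupp P) P@_u *: ((\prod_i F i ^+ u i) * G ^+ (c - mdeg u)) = 0].
Proof.
have [B [hF hG]] : exists B, (forall i, (msize (F i) <= B.+1)%N) /\ (msize G <= B.+1)%N.
  exists (maxn (\max_i msize (F i)) (msize G)); split=> [i|].
    by apply/leqW; rewrite leq_max; apply/orP; left; exact: leq_bigmax.
  by apply/leqW; rewrite leq_max leqnn orbT.
(* With c = (m + 1) D one has (c B + 1)^m <= D^m ((m + 1) B + 1)^m < D^(m + 1). *)
pose D := ((m.+1 * B).+1 ^ m).+1; pose c := (m.+1 * D)%N.
pose T1 := {ffun 'I_m.+1 -> 'I_D}; pose T2 := {ffun 'I_m -> 'I_(c * B).+1}.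
pose ex (f : T1) : 'X_{1..m.+1} := [multinom f i : nat | i < m.+1].
pose ey (f : T2) : 'X_{1..m} := [multinom f i : nat | i < m].
have exc f : (mdeg (ex f) <= c)%N.
  rewrite mdegE; apply: leq_trans (_ : \sum_(i < m.+1) D <= _)%N.
    by apply: leq_sum => i _; rewrite mnmE ltnW.
  by rewrite sum_nat_const card_ord.
pose Y f := (\prod_i F i ^+ ex f i) * G ^+ (c - mdeg (ex f)).
pose Mx : 'M[k]_(#|{: T1}|, #|{: T2}|) := \matrix_(a, b) (Y (enum_val a))@_(ey (enum_val b)).
have card : (#|{: T2}| < #|{: T1}|)%N.
  rewrite !card_ffun !card_ord.
  apply: (@leq_ltn_trans ((D * (m.+1 * B).+1) ^ m)).
    have : ((c * B).+1 <= D * (m.+1 * B).+1)%N.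
      by have : (0 < D)%N by []; rewrite /c mulnS; move: (D) => z; nia.
    by move: (c * B).+1 (D * _)%N => x y; case: (m) => // m' xy; rewrite leq_exp2r.
  by rewrite expnMn expnS mulnC ltn_pmul2r ?expn_gt0 // /D ltnS leqnn.
have [v vM v0] : exists2 v : 'rV_#|{: T1}|, v *m Mx = 0 & v != 0.
  have : kermx Mx != 0.
    rewrite kermx_eq0 /row_free; apply/eqP=> h.
    by have := rank_leq_col Mx; rewrite h leqNgt card.
  by case/rowV0Pn=> v /sub_kermxP; exists v.
have degY f : (msize (Y f) <= (c * B).+1)%N.
  have dM (p q : {mpoly k[m]}) i j : (msize p <= i.+1)%N -> (msize q <= j.+1)%N ->
      (msize (p * q)%R <= (i + j).+1)%N.
    move=> hp hq; case: (eqVneq p 0) => [->|p0]; first by rewrite mul0r msize0.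
    case: (eqVneq q 0) => [->|q0]; first by rewrite mulr0 msize0.
    rewrite msizeM //.
    by move: hp hq; move: (msize p) (msize q) => x y; lia.
  have dX (p : {mpoly k[m]}) i : (msize p <= B.+1)%N -> (msize (p ^+ i)%R <= (i * B).+1)%N.
    by move=> hp; elim: i => [|i IHi]; rewrite ?expr0 ?msize1 // exprS mulSn; exact: dM.
  have -> : (c * B = (\sum_i ex f i) * B + (c - mdeg (ex f)) * B)%N.
    by rewrite -mulnDl -mdegE subnKC // exc.
  apply: (dM); last exact: (dX).
  rewrite big_distrl /=; elim/big_rec2: _ => [|i x p _ h]; first by rewrite msize1.
  by apply: (dM) h; exact: (dX).
have ex_inj : injective ex.
  move=> f f' /mnmP h; apply/ffunP=> i; apply: val_inj.
  by have := h i; rewrite !mnmE.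
pose P : {mpoly k[m.+1]} := \sum_a v 0 a *: 'X_[ex (enum_val a)].
have Pc a : P@_(ex (enum_val a)) = v 0 a.
  rewrite /P raddf_sum (bigD1 a) //= mcoeffZ mcoeffX eqxx mulr1 big1 ?addr0 // => b ba.
  rewrite mcoeffZ mcoeffX (inj_eq ex_inj) (inj_eq enum_val_inj) (negPf ba) mulr0 //.
have supp u : u \in msupp P -> exists a : 'I_#|{: T1}|, u = ex (enum_val a).
  rewrite mcoeff_msupp => h; apply: NNPP => no; case/eqP: h.
  rewrite /P raddf_sum big1 //= => a _; rewrite mcoeffZ mcoeffX.
  by case: eqP => [E|_]; rewrite ?mulr0 //; case: no; exists a; rewrite E.
exists P, c; split.
- have /rV0Pn[a va] := v0; apply/eqP=> P0; move: va.
  by rewrite -Pc P0 mcoeff0 eqxx.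
- by move=> u /supp[a ->]; exact: exc.
have -> : \sum_(u <- msupp P) P@_u *: ((\prod_i F i ^+ u i) * G ^+ (c - mdeg u))
   = \sum_a v 0 a *: Y (enum_val a).
  pose r := [seq a <- enum 'I_#|{: T1}| | ex (enum_val a) \in msupp P].
  rewrite (perm_big [seq ex (enum_val a) | a <- r]) /=; last first.
    apply: uniq_perm; first exact: msupp_uniq.
      rewrite map_inj_uniq; last by move=> a a' /ex_inj; exact: enum_val_inj.
      exact/filter_uniq/enum_uniq.
    move=> u; apply/idP/mapP => [uP|[a]]; last by rewrite mem_filter => /andP[h _] ->.
    by have [a uE] := supp u uP; exists a; rewrite // mem_filter -uE uP mem_enum.
  rewrite big_map big_filter big_enum_cond /= [RHS](bigID (fun a => ex (enum_val a) \in msupp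
    P)) /=.
  rewrite [X in _ = _ + X]big1 ?addr0 => [|a ha].
    by apply: eq_bigr => a _; rewrite Pc.
  by rewrite -Pc memN_msupp_eq0 // scale0r.
apply/mpolyP=> u; rewrite mcoeff0 raddf_sum /=.
case: (ltnP (mdeg u) (c * B).+1) => hu; last first.
  rewrite big1 // => a _; rewrite mcoeffZ memN_msupp_eq0 ?mulr0 //.
  by apply/negP=> /msize_mdeg_lt; rewrite ltnNge (leq_trans (degY _) hu).
pose b : T2 := [ffun i => inord (u i)].
have uE : ey b = u.
  apply/mnmP=> i; rewrite mnmE ffunE inordK //; apply: leq_ltn_trans hu.
  by rewrite mdegE (bigD1 i) //= leq_addr.
have := congr1 (fun w : 'rV_#|{: T2}| => w 0 (enum_rank b)) vM; rewrite !mxE => h0;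
  apply: etrans h0.
by apply: eq_bigr => a _; rewrite mxE enum_rankK uE mcoeffZ.
Qed.
End Generic.

Section Points.
Variables (k : fieldType) (V : vectType k).
Notation N := (\dim {:V}).
(** Unlike [hcoord], which reads the representative picked by [vpick], this is linear in v. On a
    line the two differ by a nonzero scalar, which (multi)homogeneous equations do not see. *)
Definition coords (v : V) : 'I_N -> k := fun c => coord (vbasis {:V}) c v.

Lemma coords_inj (v w : V) : coords v =1 coords w -> v = w.
Proof.
move=> h; rewrite (coord_vbasis (memvf v)) (coord_vbasis (memvf w)).
by apply: eq_bigr => c _; congr (_ *: _); exact: h.
Qed.

Lemma hcoord_line (p : ppoint V) v : val p = <[v]>%VS ->
  exists2 a : k, a != 0 & forall c, hcoord p c = a * coords v c.
Proof.
move=> pv; have : vpick (val p) \in <[v]>%VS by rewrite pv memv_pick.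
case/vlineP=> a aE; exists a; last by move=> c; rewrite /hcoord aE /coords linearZ.
apply: contraNneq (oner_neq0 k) => a0; exfalso.
have : vpick (val p) == 0 by rewrite aE a0 scale0r.
by rewrite vpick0 -dimv_eq0; have /eqP -> : \dim (val p) == 1%N by exact: (valP p).
Qed.

Lemma line_point (v : V) : v != 0 -> exists p : ppoint V, val p = <[v]>%VS.
Proof.
move=> v0; have h : \dim <[v]> == 1%N by rewrite dim_vline v0.
by exists (exist (fun L : {vspace V} => \dim L == 1%N) <[v]>%VS h).
Qed.

Lemma line_nonzero (p : ppoint V) v : val p = <[v]>%VS -> v != 0.
Proof.
move=> pv; have : \dim (val p) == 1%N by exact: (valP p).
by rewrite pv dim_vline eqb1.
Qed.

Lemma meval_line e (F : {mpoly k[N]}) p v : F \is e.-homog -> val p = <[v]>%VS ->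
  (F.@[hcoord p] == 0) = (F.@[coords v] == 0).
Proof.
move=> hF /hcoord_line[a a0 hp]; rewrite (meval_eq _ hp) (meval_homog_scale _ _ hF).
by rewrite mulf_eq0 expf_eq0 (negPf a0) andbF.
Qed.

Lemma multihomog_scale s (F : {mpoly k[s * N]}) (a : 'I_s -> k) (Y : 'M[k]_(s, N)) :
  multihomog (V := V) F -> (forall i, a i != 0) ->
  (F.@[fun h => mxvec (\matrix_(i, j) (a i * Y i j)) 0 h] == 0) = (F.@[fun h => mxvec Y 0 h]
    == 0).
Proof.
case=> e he a0.
have -> : F.@[fun h => mxvec (\matrix_(i, j) (a i * Y i j)) 0 h] =
    (\prod_i a i ^+ e i) * F.@[fun h => mxvec Y 0 h].
  rewrite !mevalE mulr_sumr big_seq [RHS]big_seq; apply: eq_bigr => m mF.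
  rewrite mulrCA; congr (_ * _).
  have E (Z : 'M[k]_(s, N)) : \prod_h mxvec Z 0 h ^+ m h = \prod_i \prod_j Z i j ^+ m
    (mxvec_index i j).
    rewrite (reindex _ (curry_mxvec_bij s N)) /= pair_bigA /=.
    by apply: eq_bigr => -[i j] _ /=; rewrite mxvecE.
  rewrite !E -big_split /=; apply: eq_bigr => i _.
  rewrite -(he m mF i) -prodrXr -big_split /=; apply: eq_bigr => j _.
  by rewrite mxE exprMn.
rewrite mulf_eq0 -[RHS]orFb; congr (_ || _); apply/negbTE/prodf_neq0 => i _.
by rewrite expf_neq0.
Qed.
End Points.

Section Param.
Variables (k : fieldType) (hk : [pchar k] =i pred0) (n d' s : nat).
Notation d := d'.+1.
Notation V := (dhomog n.+1 k d).
Notation N := (\dim {:V}).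
Notation I := ('I_s * 'I_d * 'I_n.+1)%type.
Notation M := #|{: I}|.
Implicit Types x : 'I_M -> k.

Definition idx i j m : 'I_M := enum_rank ((i, j, m) : I).
Definition lin_form x i j : {mpoly k[n.+1]} := \sum_m x (idx i j m) *: 'X_m.
Definition split_form x i : V := hp d (\prod_j lin_form x i j).
(** The polynomial map from an affine space onto the sums of s split forms. Genericity conditions on
    the s points pull back to nonvanishing of polynomials in x. *)
Definition split_sum x : V := \sum_i split_form x i.

Lemma lin_form_homog x i j : lin_form x i j \is 1.-homog.
Proof.
rewrite rpred_sum // => m _; rewrite rpredZ //.
by rewrite dhomogX; apply/eqP; exact: mdeg1.
Qed.

Lemma prod_lin_homog x i : \prod_j lin_form x i j \is d.-homog.
Proof.
rewrite (_ : \prod_j _ = \prod_(l <- map (lin_form x i) (enum 'I_d)) l); last first.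
  by rewrite big_map big_enum.
have sz : size (map (lin_form x i) (enum 'I_d)) = d'.+1 by rewrite size_map size_enum_ord.
have := @prod_homog _ _ (map (lin_form x i) (enum 'I_d)).
rewrite sz; apply; apply/allP=> l /mapP[j _ ->]; exact: lin_form_homog.
Qed.

Lemma val_split_form x i : val (split_form x i) = \prod_j lin_form x i j.
Proof. by rewrite /split_form hpK // prod_lin_homog. Qed.

Definition Phi i (c : 'I_N) : {mpoly k[M]} :=
  \sum_(phi : {ffun 'I_d -> 'I_n.+1})
    coords (hp d (\prod_j 'X_(phi j)) : V) c *: \prod_j 'X_(idx i j (phi j)).

Lemma PhiE i c x : (Phi i c).@[x] = coords (split_form x i) c.
Proof.
rewrite /split_form bigA_distr_bigA /= linear_sum /coords linear_sum /Phi raddf_sum /=.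
apply: eq_bigr => phi _; rewrite mevalZ rmorph_prod /=.
under [in RHS]eq_bigr => j _ do idtac.
rewrite scaler_prod !linearZ /= mulrC; congr (_ * _).
by apply: eq_bigr => j _; rewrite mevalXU.
Qed.

Definition Psi := [tuple \sum_i Phi i c | c < N].

Lemma PsiE x (F : {mpoly k[N]}) : (F \mPo Psi).@[x] = F.@[coords (split_sum x)].
Proof.
rewrite comp_mpoly_meval; apply: meval_eq => c; rewrite tnth_mktuple raddf_sum /=.
by rewrite /coords /split_sum linear_sum; apply: eq_bigr => i _; rewrite PhiE.
Qed.

Notation X := (@split_variety k n d).

Lemma linear_formE (l : dhomog n.+1 k 1) : val l = \sum_m (val l)@_U_(m) *: 'X_m.
Proof.
apply/mpolyP=> u; rewrite raddf_sum /=.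
case: (eqVneq (mdeg u) 1%N) => [/eqP/mdeg1P[m /eqP->]|hu].
  rewrite (bigD1 m) //= big1 => [|m' mm]; first by rewrite mcoeffZ mcoeffX eqxx mulr1 addr0.
  rewrite mcoeffZ mcoeffX; case: eqP => [/mnmP/(_ m)|]; rewrite ?mulr0 //.
  by rewrite !mnm1E eqxx (negPf mm).
rewrite big1 => [|m _].
  apply: memN_msupp_eq0; apply: contraNN hu => hu.
  by apply/eqP; exact: (dhomog_mf (dhomog_is_dhomog l) hu).
rewrite mcoeffZ mcoeffX; case: eqP => [E|]; rewrite ?mulr0 //.
by move: hu; rewrite -E mdeg1 eqxx.
Qed.

Lemma split_param (p : 'I_s -> ppoint V) : (forall i, X (p i)) ->
  exists x, forall i, val (p i) = <[split_form x i]>%VS.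
Proof.
move=> hX; have h i : exists l : {ffun 'I_d -> dhomog n.+1 k 1},
    val (p i) = <[hp d (\prod_j val (l j)) : V]>%VS.
  have [f [l [pf fl]]] := hX i; exists [ffun j => l j].
  by rewrite pf; under eq_bigr => j _ do rewrite ffunE; rewrite -fl valK_hp.
have [l hl] := fin_all_exists h.
pose x (h : 'I_M) : k := let q : I := enum_val h in (val (l q.1.1 q.1.2))@_U_(q.2).
exists x => i; rewrite hl /split_form; congr <[hp d _]>%VS; apply: eq_bigr => j _.
rewrite [LHS]linear_formE; apply: eq_bigr => m _.
by rewrite /x /idx enum_rankK.
Qed.

Lemma param_split x i (p : ppoint V) : val p = <[split_form x i]>%VS -> X p.
Proof.
move=> pv; exists (split_form x i), (fun j => hp 1 (lin_form x i j)); split=> //.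
rewrite val_split_form; apply: eq_bigr => j _.
by rewrite hpK // lin_form_homog.
Qed.

(** The coefficients of a linear combination are absorbed into the first factor of each product. *)
Lemma span_param x w : w \in (\sum_i <[split_form x i]>)%VS -> exists x', w = split_sum x'.
Proof.
case/memv_sumP=> u hu ->.
have h i : exists a : k, u i = a *: split_form x i by have /vlineP := hu i isT.
have [a ha] := fin_all_exists h.
pose x' (h : 'I_M) : k := let q : I := enum_val h in (if q.1.2 == ord0 then a q.1.1 else 1) *
  x h.
exists x'; rewrite /split_sum; apply: eq_bigr => i _; rewrite ha -linearZ /=; congr (hp d _).
have linE j : lin_form x' i j = (if j == ord0 then a i else 1) *: lin_form x i j.
  rewrite /lin_form scaler_sumr; apply: eq_bigr => m _.
  by rewrite scalerA /x' /idx enum_rankK.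
rewrite !big_ord_recl linE eqxx -scalerAl; congr (_ *: (_ * _)).
by apply: eq_bigr => j _; rewrite linE scale1r.
Qed.
End Param.

Section Secant.
Variables (k : fieldType) (hk : [pchar k] =i pred0) (n d' s : nat).
Notation d := d'.+1.
Notation V := (dhomog n.+1 k d).
Notation N := (\dim {:V}).
Notation I := ('I_s * 'I_d * 'I_n.+1)%type.
Notation M := #|{: I}|.
Notation X := (@split_variety k n d).
Implicit Types x : 'I_M -> k.

Definition Phi_tuple : (s * N).-tuple {mpoly k[M]} :=
  [tuple mxvec (\matrix_(i < s, c < N) Phi (n := n) (d' := d') i c) 0 h | h < s * N].

Lemma Phi_tupleE (G : {mpoly k[s * N]}) x :
  (G \mPo Phi_tuple).@[x] = G.@[fun h => mxvec (\matrix_(i < s, c < N) coords (split_form x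
    i) c) 0 h].
Proof.
rewrite comp_mpoly_meval; apply: meval_eq => h; rewrite tnth_mktuple.
have := map_mxvec (meval x) (\matrix_(i < s, c < N) Phi (n := n) (d' := d') i c).
move/(congr1 (fun A : 'rV_(s * N) => A 0 h)); rewrite mxE => ->.
by congr (mxvec _ 0 h); apply/matrixP=> i c; rewrite !mxE PhiE.
Qed.

Lemma hcoord_prod_split_form (p : 'I_s -> ppoint V) x (G : {mpoly k[s * N]}) :
  multihomog (V := V) G -> (forall i, val (p i) = <[split_form x i]>%VS) ->
  (G.@[hcoord_prod p] == 0) = ((G \mPo Phi_tuple).@[x] == 0).
Proof.
move=> hG hp; have h i : exists a : k, a != 0 /\ forall c, hcoord (p i) c = a * coords
  (split_form x i) c.
  by have [a a0 ha] := hcoord_line (hp i); exists a.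
have [a ha] := fin_all_exists h.
rewrite Phi_tupleE -(multihomog_scale _ hG (fun i => (ha i).1)); congr (_ == _).
apply: meval_eq => l; rewrite /hcoord_prod; congr (mxvec _ 0 l).
by apply/matrixP=> i c; rewrite !mxE (ha i).2.
Qed.

Hypothesis s0 : (0 < s)%N.

Lemma power_nonzero : hp d ('X_ord0 ^+ d) != 0 :> V.
Proof.
apply/eqP=> /(congr1 val); rewrite hpK.
  move/eqP; rewrite expf_eq0 /= => /eqP/(congr1 (mcoeff U_(ord0)%MM)).
  by rewrite mcoeffX eqxx mcoeff0 => /eqP; rewrite oner_eq0.
by have := dhomogMn d (homogX k (ord0 : 'I_n.+1)); rewrite mul1n.
Qed.

Lemma Psi_nonzero : exists c x, coords (split_sum (n := n) (d' := d') (s := s) x) c != 0.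
Proof.
pose x0 (h : 'I_M) : k := let q : I := enum_val h in ((q.1.1 == Ordinal s0) && (q.2 ==
  ord0))%:R.
have fE i : split_form x0 i = (i == Ordinal s0)%:R *: hp d ('X_ord0 ^+ d).
  have lE j : lin_form x0 i j = (i == Ordinal s0)%:R *: 'X_ord0.
    rewrite /lin_form (bigD1 ord0) //= big1 => [|m m0].
      by rewrite /x0 /idx enum_rankK /= eqxx andbT addr0.
    by rewrite /x0 /idx enum_rankK /= (negPf m0) andbF scale0r.
  rewrite /split_form (eq_bigr _ (fun j _ => lE j)) prodr_const card_ord exprZn linearZ /=.
  by case: (i == _); rewrite ?expr1n // expr0n.
have pE : split_sum x0 = hp d ('X_ord0 ^+ d).
  rewrite /split_sum (bigD1 (Ordinal s0)) //= big1 => [|i i0];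
    rewrite fE ?eqxx ?scale1r ?addr0 //.
  by rewrite (negPf i0) scale0r.
have nz : split_sum x0 != 0 by rewrite pE power_nonzero.
apply: NNPP => no; case/eqP: nz; apply: coords_inj => c.
rewrite [RHS]/coords linear0; apply/eqP/negPn/negP=> h; apply: no; by exists c, x0.
Qed.

(** The summands at x may coincide, vanish or miss the open set [O]. If an equation F of a closed
    set did not vanish at q, its pullback would be nonzero, and so would be its product with an
    equation witnessing [O] and with coordinates of each summand and of the sum. A point where this
    product is nonzero gives a generic span not contained in the closed set. *)
Lemma secant_split_sum x (q : ppoint V) : val q = <[split_sum x]>%VS -> secant X s q.
Proof.
move=> qx O [Oopen Odense] C [S [Shom SC]] hAll; apply/SC => F SF.
have [e hF] := Shom F SF; apply/eqP; rewrite (meval_line hF qx).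
rewrite -PsiE; apply/eqP; suff -> : F \mPo Psi k n d' s = 0 by rewrite meval0.
apply/eqP/negPn/negP=> FPsi.
have [p0 [Xp0 Op0 _]] : exists p, [/\ forall i, X (p i), O p & True].
  have [||p [h1 h2 _]] := Odense (fun _ => True); last by exists p.
  - exists (fun G => G = 1); split=> [G ->|p].
      exists (fun _ => 0%N) => m; rewrite msupp1 inE => /eqP -> i.
      by rewrite big1 // => j _; rewrite mnm0E.
    split=> // h; have := h _ (erefl 1); rewrite meval1 => /eqP.
    by rewrite oner_eq0.
  - have [p pE] := line_point power_nonzero; exists (fun _ => p); split=> // i.
    exists (hp d ('X_ord0 ^+ d)), (fun _ => hp 1 'X_ord0); split=> //.
    have h1 : ('X_ord0 : {mpoly k[n.+1]}) \is 1.-homog by exact: homogX.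
    rewrite prodr_const card_ord [in RHS]hpK // hpK //.
    by have := dhomogMn d h1; rewrite mul1n.
have [T [Tmh TO]] := Oopen.
have [G TG Gp0] : exists2 G, T G & G.@[hcoord_prod p0] != 0.
  apply: NNPP => no; have : ~ O p0; last by [].
  apply/TO => G TG; apply/eqP/negPn/negP=> h; apply: no; by exists G.
have [x0 hx0] := split_param Xp0.
rewrite (hcoord_prod_split_form (Tmh G TG) hx0) in Gp0.
have hfc i : exists c, (Phi (n := n) (d' := d') (s := s) i c).@[x0] != 0.
  have nz := line_nonzero (hx0 i); apply: NNPP => no; case/eqP: nz; apply: coords_inj => c.
  rewrite [RHS]/coords linear0 -PhiE; apply/eqP/negPn/negP=> h; apply: no; by exists c.
have [cf hcf] := fin_all_exists hfc.
have [c1 [x1 hx1]] := Psi_nonzero.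
pose Pall := (F \mPo Psi k n d' s) * (G \mPo Phi_tuple) * (\prod_i Phi (n := n) (d' := d') i
  (cf i))
  * ('X_c1 \mPo Psi k n d' s).
have Pn0 : Pall != 0.
  rewrite !mulf_neq0 //.
  - by apply: contraNneq Gp0 => ->; rewrite meval0.
  - by apply/prodf_neq0 => i _; apply: contraNneq (hcf i) => ->; rewrite meval0.
  - by apply: contraNneq hx1 => h; have := PsiE x1 'X_c1; rewrite h meval0 mevalXU => <-.
have [y] := mpoly_nonroot hk Pn0.
rewrite !mevalM !mulf_eq0 !negb_or -!andbA => /and4P[yF yG yf yc].
rewrite PsiE mevalXU in yc.
have fy i : split_form y i != 0.
  move: yf; rewrite rmorph_prod /= => /prodf_neq0/(_ i isT); rewrite PhiE.
  by apply: contraNneq => ->; rewrite /coords linear0.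
have h i : exists p : ppoint V, val p = <[split_form y i]>%VS by exact: line_point.
have [p hp] := fin_all_exists h.
have ptn0 : split_sum y != 0 by apply: contraNneq yc => ->; rewrite /coords linear0.
have [r hr] := line_point ptn0.
have Cr : C r.
  apply: hAll; exists p; split.
  - by move=> i; exact: param_split (hp i).
  - apply: NNPP => /TO/(_ G TG)/eqP; rewrite (hcoord_prod_split_form (Tmh G TG) hp).
    by rewrite (negPf yG).
  rewrite hr -memvE; apply: memv_suml => i _.
  have sub : (val (p i) <= \sum_(i0 < s) val (p i0))%VS by exact: (sumv_sup i).
  by apply: (subvP sub); rewrite hp memv_line.
move/SC/(_ F SF)/eqP: Cr; rewrite (meval_line hF hr) -PsiE.
by rewrite (negPf yF).
Qed.

(** The trivial genericity condition suffices: the zero locus of F is closed and contains all spans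
    of s points by [span_param]. *)
Lemma vanish_secant e (F : {mpoly k[N]}) (q : ppoint V) : F \is e.-homog ->
  F \mPo Psi k n d' s = 0 -> secant X s q -> F.@[hcoord q] = 0.
Proof.
move=> hF F0 hq.
have dense : dense_open_power X (fun _ : 'I_s -> ppoint V => True).
  split; last by move=> O' _ [p [h1 h2]]; exists p.
  exists (fun G => G = 1); split=> [G ->|p].
    exists (fun _ => 0%N) => m; rewrite msupp1 inE => /eqP -> i.
    by rewrite big1 // => j _; rewrite mnm0E.
  split=> // h; have := h _ (erefl 1); rewrite meval1 => /eqP.
  by rewrite oner_eq0.
apply: (hq _ dense (fun p => F.@[hcoord p] = 0)).
  exists (fun G => G = F); split=> [G ->|p]; first by exists e.
  by split=> [h G ->|h] //; exact: h.
move=> r [p [Xp _ rp]]; have [x hx] := split_param Xp.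
have [v [rE v0]] : exists v, val r = <[v]>%VS /\ v != 0.
  have /eqP dr : \dim (val r) == 1%N by exact: (valP r).
  exists (vpick (val r)).
  have v0 : vpick (val r) != 0 by rewrite vpick0 -dimv_eq0 dr.
  split=> //; apply/esym/eqP; rewrite eqEdim -memvE memv_pick dr dim_vline v0.
  by [].
have : v \in (\sum_i <[split_form x i]>)%VS.
  have <- : (\sum_i val (p i) = \sum_i <[split_form x i]>)%VS by apply: eq_bigr => i _;
    exact: hx.
  by apply: (subvP rp); rewrite rE memv_line.
case/span_param=> y vE; apply/eqP; rewrite (meval_line hF rE) vE -PsiE F0 meval0.
by rewrite eqxx.
Qed.
End Secant.

Lemma dim_span_coords (k : fieldType) (V : vectType k) m (w : 'I_m -> V) :
  (\dim <<[seq w h | h <- enum 'I_m]>> <= \rank (\matrix_(c, h) coords (w h) c))%N.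
Proof.
rewrite -mxrank_tr dim_span_mx; set A := \matrix_(i < _) _.
pose E : 'M[k]_(\dim {:V}, dim V) := \matrix_(c, j) v2r (vbasis {:V})`_c 0 j.
set B := (_)^T; apply: leq_trans (mxrankM_maxl B E); apply: mxrankS.
apply/row_subP=> i; have im : (i < m)%N by have := ltn_ord i; rewrite {2}size_map size_enum_ord.
suff -> : row i A = row (Ordinal im) (B *m E) by exact: row_sub.
apply/rowP=> j; rewrite !mxE (nth_map (Ordinal im)) ?size_enum_ord //.
have -> : nth (Ordinal im) (enum 'I_m) i = Ordinal im by apply: val_inj;
  rewrite /= nth_enum_ord.
rewrite {1}(coord_vbasis (memvf (w (Ordinal im)))) linear_sum summxE.
by apply: eq_bigr => c _; rewrite linearZ !mxE.
Qed.

Lemma cofactors_memP (A : comNzRingType) (ls : seq A) e b : size ls = e -> b \in cofactors ls ->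
  exists j : 'I_e, b = \prod_(j' | j' != j) ls`_j'.
Proof.
elim: ls e b => // l ls IH [//|e] b [sz]; rewrite inE => /predU1P[->|].
  exists ord0; rewrite [RHS]big_mkcond [RHS]big_ord_recl /= mul1r.
  by rewrite (big_nth 0) big_mkord sz; apply: eq_bigr.
case/mapP=> b' /(IH _ _ sz)[j ->] ->; exists (lift ord0 j).
rewrite [RHS]big_mkcond big_ord_recl /=; congr (_ * _).
by rewrite big_mkcond; apply: eq_bigr => i _; rewrite (inj_eq (@lift_inj _ _)).
Qed.

Lemma row_free_sub (k : fieldType) m m' n (A : 'M[k]_(m, n)) (f : 'I_m' -> 'I_m) :
  injective f -> row_free A -> row_free (rowsub f A).
Proof.
move=> fi fr; apply: inj_row_free => v.
rewrite -[A in rowsub f A]mul1mx -mul_rowsub_mx mulmxA => /eqP.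
rewrite mulmx_free_eq0 // => /eqP/rowP h; apply/rowP=> i.
have := h (f i); rewrite !mxE (bigD1 i) //= big1 => [|j ji].
  by rewrite !mxE eqxx mulr1 addr0.
by rewrite !mxE (inj_eq fi) (negPf ji) mulr0.
Qed.

(** * Lower bound for the dimension *)

Section Lower.
Variables (k : fieldType) (hk : [pchar k] =i pred0) (n d' s : nat).
Notation d := d'.+1.
Notation V := (dhomog n.+1 k d).
Notation N := (\dim {:V}).
Notation I := ('I_s * 'I_d * 'I_n.+1)%type.
Notation M := #|{: I}|.
Notation X := (@split_variety k n d).
Implicit Types x : 'I_M -> k.

Definition tangent_vector x (h : 'I_M) : V := let q : I := enum_val h in
  hp d ((\prod_(j | j != q.1.2) lin_form x q.1.1 j) * 'X_(q.2)).

(** Each coefficient occurs in just one factor of one summand, so the sum is affine in it; the slope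
    is a generator of the tangent space. *)
Lemma split_sum_derivative x h t :
  split_sum (fun l => x l + (l == h)%:R * t) = split_sum x + t *: tangent_vector x h :> V.
Proof.
rewrite /tangent_vector; case: (enum_val h) (enum_valK h) => [[i j] m] /= hE.
have idxE i' j' m' : (idx i' j' m' == h) = [&& i' == i, j' == j & m' == m].
  rewrite -hE (inj_eq enum_rank_inj) -pair_eqE /= /pair_eq /= -pair_eqE /= /pair_eq /=.
  by rewrite andbA.
have linE i' j' : lin_form (fun l => x l + (l == h)%:R * t) i' j' =
    lin_form x i' j' + ((i' == i) && (j' == j))%:R *: (t *: 'X_m).
  rewrite /lin_form; under eq_bigr => m' _ do rewrite scalerDl idxE.
  rewrite big_split /=; congr (_ + _); rewrite (bigD1 m) //= big1 => [|m' mm].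
    by rewrite eqxx andbT addr0 scalerA.
  by rewrite (negPf mm) !andbF mul0r scale0r.
rewrite /split_sum (bigD1 i) //= [in RHS](bigD1 i) //= addrAC; congr (_ + _).
  rewrite /split_form -linearZ -linearD /=; congr (hp d _).
  rewrite (bigD1 j) //= [in RHS](bigD1 j) //= linE !eqxx scale1r mulrDl.
  rewrite (eq_bigr (lin_form x i)) => [|j' jj];
    last by rewrite linE (negPf jj) andbF scale0r addr0.
  by congr (_ + _); rewrite -scalerAl [RHS]scalerAr scalerAr mulrC -scalerAl -scalerAr.
apply: eq_bigr => i' ii; rewrite /split_form; congr (hp d _); apply: eq_bigr => j' _.
by rewrite linE (negPf ii) scale0r addr0.
Qed.

Lemma Psi_derivative x h c : (tnth (Psi k n d' s) c)^`M(h).@[x] = coords (tangent_vector x h) c.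
Proof.
apply: (directional_derivative hk (a := coords (split_sum x) c)) => t.
have := PsiE (n := n) (d' := d') (s := s) (fun l => x l + (l == h)%:R * t) 'X_c.
rewrite comp_mpolyXU -tnth_nth mevalXU => ->.
by rewrite split_sum_derivative /coords linearD linearZ /= mulrC.
Qed.

Lemma tangents_span r : rank_attained k n d s 0 r ->
  exists x, (r <= \dim <<[seq tangent_vector x h | h <- enum 'I_M]>>)%N.
Proof.
case=> As [Cs [sA sC hA _]]; have {sC} -> : Cs = [::] by exact: size0nil.
move=> hr; pose x (h : 'I_M) : k := let q : I := enum_val h in ((nth [::] As
  q.1.1)`_(q.1.2))@_U_(q.2).
exists x; apply: leq_trans hr _; apply: dimvS; rewrite /hspan; apply/span_subvP=> v.
case/mapP=> g; rewrite /config_gens /= !cats0 => /flatten_mapP[ls lsA] /allpairsP[[b y] [/=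
  hb hy ->]] ->.
have [sz hls] : size ls = d /\ all (fun l => l \is 1.-homog) ls.
  by have /andP[/eqP h1 h2] := allP hA _ lsA.
have iA : (index ls As < s)%N by rewrite -sA index_mem.
have [j ->] := cofactors_memP sz hb; case/mapP: hy => m _ ->.
pose i := Ordinal iA; have Ai : nth [::] As i = ls by rewrite /= nth_index.
have linE j' : lin_form x i j' = ls`_j'.
  have l1 : ls`_j' \is 1.-homog by apply: (allP hls); rewrite mem_nth // sz.
  rewrite -[RHS](hpK l1) linear_formE hpK //.
  by apply: eq_bigr => m' _; rewrite /x /idx enum_rankK /= -/i Ai.
have -> : hp d ((\prod_(j' < d | j' != j) ls`_j') * 'X_m) = tangent_vector x (idx i j m).
  rewrite /tangent_vector /idx enum_rankK /=; congr (hp d (_ * _)).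
  by apply: eq_bigr => j' _; rewrite linE.
by apply/memv_span/map_f; rewrite mem_enum.
Qed.

(** Rank r > m yields m + 1 coordinates of the cone with independent differentials; dividing by one
    of them leaves m independent rational functions. *)
Lemma secant_independent m r : (0 < s)%N -> (m < r)%N -> rank_attained k n d s 0 r ->
  alg_indep_on (secant X s) m.
Proof.
move=> s0 mr /tangents_span[x hx].
pose Jm : 'M[k]_(N, M) := \matrix_(c, h) coords (tangent_vector x h) c.
have rJ : (r <= \rank Jm)%N by apply: leq_trans hx _; exact: dim_span_coords.
have mJ : (m.+1 <= \rank Jm)%N by exact: leq_trans mr rJ.
pose f (i : 'I_m.+1) : 'I_N := maxrankfun Jm (widen_ord mJ i).
have fr : row_free (rowsub f Jm).
  have -> : rowsub f Jm = rowsub (widen_ord mJ) (rowsub (maxrankfun Jm) Jm).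
    by apply/matrixP=> i j; rewrite !mxE.
  apply: row_free_sub (maxrowsub_free Jm) => i j /(congr1 val) /= h; exact: val_inj.
pose g : m.+1.-tuple {mpoly k[M]} := [tuple tnth (Psi k n d' s) (f i) | i < m.+1].
have gind := @jacobian_criterion k hk m.+1 M g x.
have {}gind (P : {mpoly k[m.+1]}) : P != 0 -> P \mPo g != 0.
  apply: gind; suff -> : \matrix_(c, h) (tnth g c)^`M(h).@[x] = rowsub f Jm by [].
  by apply/matrixP=> c h; rewrite !mxE tnth_mktuple Psi_derivative.
exists 1%N, 'X_(f ord0), (fun i => 'X_(f (lift ord0 i))); split.
- exact: homogX.
- by move=> i; exact: homogX.
move=> P P0; pose D := msize P.
(* [P] homogenised in degree [msize P], which exceeds its degree by one; this adds only powers of a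
   coordinate that is nonzero at the chosen point. *)
pose Ph : {mpoly k[m.+1]} := \sum_(u <- msupp P)
   P@_u *: ((\prod_i 'X_(lift ord0 i) ^+ u i) * 'X_ord0 ^+ (D - mdeg u)).
have PhE (y : 'I_m.+1 -> k) : y ord0 != 0 ->
    Ph.@[y] = y ord0 ^+ D * P.@[fun i => y (lift ord0 i) / y ord0].
  move=> y0; rewrite /Ph raddf_sum mevalE mulr_sumr big_seq [RHS]big_seq.
  apply: eq_bigr => u uP; rewrite /= mevalZ mevalM rmorphXn rmorph_prod /= mevalXU [RHS]mulrCA.
  congr (_ * _); have uD : (mdeg u <= D)%N by apply/ltnW/msize_mdeg_lt.
  rewrite -[in RHS](subnK uD) exprD -[RHS]mulrA [LHS]mulrC; congr (_ * _).
  rewrite mdegE -prodrXr -big_split /=; apply: eq_bigr => i _.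
  by rewrite rmorphXn /= mevalXU exprMn exprVn mulrCA mulfV ?mulr1 // expf_neq0.
have Ph0 : Ph != 0.
  have [z hz] := mpoly_nonroot hk P0.
  pose y i := if unlift ord0 i is Some i' then z i' else 1.
  have y0 : y ord0 = 1 by rewrite /y unlift_none.
  have := PhE y; rewrite y0 oner_neq0 expr1n mul1r => /(_ isT) E.
  apply: contraNneq hz => h; rewrite h meval0 in E.
  rewrite E; apply/eqP/meval_eq => i; by rewrite /y liftK divr1.
have X0 : ('X_ord0 : {mpoly k[m.+1]}) != 0.
  apply/eqP=> /(congr1 (mcoeff U_(ord0)%MM)).
  by rewrite mcoeffX eqxx mcoeff0 => /eqP; rewrite oner_eq0.
have nz : (Ph \mPo g) * ('X_ord0 \mPo g) != 0 by rewrite mulf_neq0 // gind.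
have [y] := mpoly_nonroot hk nz; rewrite mevalM mulf_eq0 negb_or => /andP[y1 y2].
have gE (Q : {mpoly k[m.+1]}) : (Q \mPo g).@[y] = Q.@[fun i => coords (split_sum y) (f i)].
  rewrite comp_mpoly_meval; apply: meval_eq => i; rewrite tnth_mktuple.
  by have := PsiE y 'X_(f i); rewrite comp_mpolyXU -tnth_nth mevalXU.
rewrite gE mevalXU in y2; rewrite gE PhE // mulf_eq0 negb_or in y1.
have {y1} /andP[_ y1] := y1.
have pn0 : split_sum y != 0 by apply: contraNneq y2 => ->; rewrite /coords linear0.
have [q hq] := line_point pn0; have [a a0 ha] := hcoord_line hq.
exists q; split; first exact: secant_split_sum hq.
- by rewrite mevalXU ha mulf_neq0.
apply: contraNneq y1 => h; rewrite -[X in _ == X]h; apply/eqP/meval_eq => i.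
by rewrite !mevalXU !ha invfM mulrACA mulfV // mul1r.
Qed.
End Lower.

(** * Upper bound for the dimension *)

Section Upper.
Variables (k : fieldType) (hk : [pchar k] =i pred0).

(** A relation between the pullbacks to the m parameters, homogenised by [G], is a form that
    vanishes on [Y]. Divided by G^c it becomes a relation between the F_i / G. *)
Lemma parametrized_dependent (V : vectType k) (Y : ppoint V -> Prop) m
  (th : (\dim {:V}).-tuple {mpoly k[m]}) :
  (forall e H, H \is e.-homog -> H \mPo th = 0 -> forall q, Y q -> H.@[hcoord q] = 0) ->
  ~ alg_indep_on Y m.+1.
Proof.
move=> hth [e [G [F [hG hF hP]]]].
have [P [c [P0 Pc rel]]] := too_many_forms (fun i => F i \mPo th) (G \mPo th).
pose H := \sum_(u <- msupp P) P@_u *: ((\prod_i F i ^+ u i) * G ^+ (c - mdeg u)).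
have hH : H \is (e * c)%N.-homog.
  rewrite /H big_seq rpred_sum // => u uP; rewrite rpredZ //.
  have -> : (e * c = e * mdeg u + e * (c - mdeg u))%N by rewrite -mulnDr subnKC // Pc.
  apply: dhomogM; last exact: dhomogMn.
  rewrite mdegE big_distrr /=; elim/big_rec2: _ => [|i x p _ h]; first exact: dhomog1.
  by apply: dhomogM => //; exact: dhomogMn.
have H0 : H \mPo th = 0.
  rewrite -[RHS]rel /H raddf_sum /=; apply: eq_bigr => u _.
  rewrite linearZ /= rmorphM rmorphXn rmorph_prod /=; congr (_ *: (_ * _)).
  by apply: eq_bigr => i _; rewrite rmorphXn.
have [q [Yq Gq Pq]] := hP P P0.
have := hth _ _ hH H0 q Yq; apply/eqP.
suff -> : H.@[hcoord q] = G.@[hcoord q] ^+ c * P.@[fun i => (F i).@[hcoord q] / G.@[hcoord q]].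
  by rewrite mulf_neq0 // expf_neq0.
rewrite /H raddf_sum mevalE mulr_sumr big_seq [RHS]big_seq.
apply: eq_bigr => u uP; rewrite /= mevalZ mevalM rmorphXn rmorph_prod /= [RHS]mulrCA.
congr (_ * _); rewrite -[in RHS](subnK (Pc u uP)) exprD -[RHS]mulrA [LHS]mulrC; congr (_ * _).
rewrite mdegE -prodrXr -big_split /=; apply: eq_bigr => i _.
by rewrite rmorphXn exprMn exprVn mulrCA mulfV ?mulr1 // expf_neq0.
Qed.

Lemma mpolyXn0 m (i : 'I_m) : ('X_i : {mpoly k[m]}) != 0.
Proof.
apply/eqP=> /(congr1 (mcoeff U_(i)%MM)).
by rewrite mcoeffX eqxx mcoeff0 => /eqP; rewrite oner_eq0.
Qed.

(** The chart where one coordinate is 1 parametrises a dense subset; multiplying by that coordinate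
    confines the argument to it. *)
Lemma ambient_dependent (V : vectType k) (Y : ppoint V -> Prop) : (0 < \dim {:V})%N ->
  ~ alg_indep_on Y (\dim {:V}).-1.+1.
Proof.
move=> N0; pose c0 := Ordinal N0.
pose th := [tuple if unlift c0 c is Some c' then 'X_c' else 1 : {mpoly k[(\dim {:V}).-1]} | c
  < \dim {:V}].
apply: (@parametrized_dependent _ _ _ th) => e H hH H0.
suff -> : H = 0 by move=> q _; rewrite meval0.
have : H * 'X_c0 == 0.
  apply/negPn/negP=> /(mpoly_nonroot hk)[y]; rewrite mevalM mevalXU mulf_eq0 negb_or.
  case/andP=> Hy y0; move: Hy.
  rewrite -(meval_eq (v1 := fun c => y c0 * (y c / y c0))); last by move=> c;
    rewrite mulrC divfK.
  rewrite (meval_homog_scale _ _ hH) mulf_eq0 negb_or => /andP[_].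
  have := congr1 (meval (fun c' => y (lift c0 c') / y c0)) H0.
  rewrite meval0 comp_mpoly_meval => h; rewrite -[X in _ == X]h => /eqP; apply.
  apply: meval_eq => c; rewrite tnth_mktuple; case: unliftP => [c' ->|->].
    by rewrite mevalXU.
  by rewrite meval1 divff.
by rewrite mulf_eq0 (negPf (mpolyXn0 _)) orbF => /eqP.
Qed.

Section Normalized.
Variables (n d' s' : nat).
Notation d := d'.+1.
Notation s := s'.+1.
Notation V := (dhomog n.+1 k d).
Notation N := (\dim {:V}).
Notation I := ('I_s * 'I_d * 'I_n.+1)%type.
Notation M := #|{: I}|.
Notation X := (@split_variety k n d).
Notation Q := ('I_s' + 'I_s * 'I_d * 'I_n)%type.
Notation m := #|{: Q}|.

(* Linear factors are normalised to have X_0-coefficient 1, except the first one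
   of each summand but the first summand; the omitted overall scalar makes one
   parameter fewer than the affine dimension. *)
Definition norm_point (A : comNzRingType) (y : 'I_m -> A) (h : 'I_M) : A :=
  let q : I := enum_val h in
  (if q.1.2 == ord0 then
     (if unlift ord0 q.1.1 is Some i' then y (enum_rank (inl i' : Q)) else 1) else 1)
  * (if unlift ord0 q.2 is Some l then y (enum_rank (inr (q.1, l) : Q)) else 1).

Definition norm_tuple : M.-tuple {mpoly k[m]} := [tuple norm_point (fun j => 'X_j) h | h < M].

Lemma norm_tupleE (P : {mpoly k[M]}) y : (P \mPo norm_tuple).@[y] = P.@[norm_point y].
Proof.
rewrite comp_mpoly_meval; apply: meval_eq => h; rewrite tnth_mktuple /norm_point mevalM.
congr (_ * _); first case: ifP => _; rewrite ?meval1 //.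
  by case: unlift => [i'|]; rewrite ?mevalXU ?meval1.
by case: unlift => [i'|]; rewrite ?mevalXU ?meval1.
Qed.

(** Dividing each linear form by its X_0-coefficient leaves one scalar b_i per summand; b_0 is
    pulled out of the sum and the ratios b_i / b_0 are put on the first factors. *)
Lemma normalize (x : 'I_M -> k) : (forall i j, x (idx i j ord0) != 0) ->
  exists y b, split_sum x = b *: split_sum (norm_point y) :> V.
Proof.
move=> x0; pose b i := \prod_j x (idx i j ord0).
have b0 i : b i != 0 by apply/prodf_neq0 => j _.
pose y (h : 'I_m) : k := match (enum_val h : Q) with
  | inl i' => b (lift ord0 i') / b ord0
  | inr q => x (idx q.1.1 q.1.2 (lift ord0 q.2)) / x (idx q.1.1 q.1.2 ord0) end.
exists y, (b ord0); rewrite /split_sum scaler_sumr; apply: eq_bigr => i _.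
pose a := if unlift ord0 i is Some i' then b (lift ord0 i') / b ord0 else 1.
have aE : b ord0 * a = b i.
  by rewrite /a; case: unliftP => [i' ->|->]; rewrite ?mulr1 // mulrC divfK.
have linE j : lin_form (norm_point y) i j =
    ((if j == ord0 then a else 1) / x (idx i j ord0)) *: lin_form x i j.
  rewrite /lin_form scaler_sumr; apply: eq_bigr => l _; rewrite scalerA; congr (_ *: _).
  rewrite /norm_point /idx enum_rankK /=.
  have -> : (if j == ord0 then (if unlift ord0 i is Some i' then y (enum_rank (inl i' : Q))
    else 1) else 1)
     = (if j == ord0 then a else 1).
    by rewrite /a; case: (j == ord0) => //; case: unlift => // i'; rewrite /y enum_rankK.
  rewrite -mulrA; congr (_ * _); case: unliftP => [l' ->|->].
    by rewrite /y enum_rankK /= mulrC.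
  by rewrite mulVf ?x0.
rewrite /split_form -linearZ /=; congr (hp d _).
under [in RHS]eq_bigr => j _ do rewrite linE.
rewrite scaler_prod scalerA big_split /= prodfV -/(b i).
rewrite [X in _ * (X / _)](_ : _ = a); first by rewrite mulrA aE divff // scale1r.
by rewrite big_ord_recl eqxx big1 ?mulr1.
Qed.

Lemma secant_dependent : ~ alg_indep_on (secant X s) m.+1.
Proof.
pose th := [tuple tnth (Psi k n d' s) c \mPo norm_tuple | c < N].
apply: (@parametrized_dependent _ _ _ th) => e H hH H0 q; apply: (vanish_secant hH).
(* The extra factor restricts to the dense set where [normalize] applies. *)
have : (H \mPo Psi k n d' s) * \prod_i \prod_j 'X_(idx i j ord0) == 0.
  apply/negPn/negP=> /(mpoly_nonroot hk)[x]; rewrite mevalM mulf_eq0 negb_or.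
  case/andP=> Hx x0; move: Hx; rewrite PsiE.
  have [i j|y [b ->]] := @normalize x.
    move: x0; rewrite rmorph_prod /= => /prodf_neq0/(_ i isT); rewrite rmorph_prod /=.
    by move/prodf_neq0/(_ j isT); rewrite mevalXU.
  rewrite (meval_eq (v2 := fun c => b * coords (split_sum (norm_point y)) c)); last first.
    by move=> c; rewrite /coords linearZ.
  rewrite (meval_homog_scale _ _ hH) mulf_eq0 negb_or => /andP[_].
  have := congr1 (meval y) H0; rewrite meval0 comp_mpoly_meval => h.
  rewrite -[X in _ == X]h => /eqP; apply; apply: meval_eq => c; rewrite tnth_mktuple.
  rewrite norm_tupleE; have := PsiE (norm_point y) ('X_c : {mpoly k[N]}).
  by rewrite comp_mpolyXU -tnth_nth mevalXU => ->.
rewrite mulf_eq0 => /orP[/eqP//|]; rewrite prodf_seq_eq0 => /hasP[i _ /=].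
rewrite prodf_seq_eq0 => /hasP[j _ /=]; by rewrite (negPf (mpolyXn0 _)).
Qed.

Lemma card_params : m = (s * (d * n + 1) - 1)%N.
Proof. by rewrite card_sum !card_prod !card_ord mulnDr muln1 addnS subn1 /= addnC mulnA. Qed.
End Normalized.

Lemma nondefective_of_rank n d s r : (0 < d)%N -> (0 < s)%N -> rank_attained k n d s 0 r ->
  (minn (s * (d * n + 1)) 'C(n + d, d) <= r)%N -> nondefective k n d s.
Proof.
case: d => // d' _; case: s => // s' _ hRK hr; split.
  apply: (secant_independent hk (r := r)) => //.
  have : (0 < minn (s'.+1 * (d'.+1 * n + 1)) 'C(n + d'.+1, d'.+1))%N.
    by rewrite leq_min muln_gt0 addn1 bin_gt0 leq_addl.
  by move: hr; move: (minn _ _) => v; clear; lia.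
case: (leqP (s'.+1 * (d'.+1 * n + 1)) 'C(n + d'.+1, d'.+1)) => h.
  by rewrite -card_params; exact: secant_dependent.
have dE : \dim {: dhomog n.+1 k d'.+1} = 'C(n + d'.+1, d'.+1).
  by rewrite dim_homog addnC -bin_sub ?leq_addr // addKn.
rewrite -dE subn1; apply: ambient_dependent.
by rewrite dE bin_gt0 leq_addl.
Qed.
End Upper.

Theorem theorem1p1p5 (k : closedFieldType) (hk : [pchar k] =i pred0)
    (s d : nat) (hs : (0 < s)%N) (hd : (0 < d)%N) :
  (s%:R <= s1 d -> forall n : nat, (3 <= n)%N -> nondefective k n d s) /\
  (s2 d <= s%:R -> nondefective k 3 d s).
Proof.
split=> [|]; rewrite ?s1E ?s2E ler_nat => sd.
  move=> n n3; apply: (nondefective_of_rank hk hd hs (rank_attained_independent hk hd sd n3)).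
  by rewrite geq_min [(d * n)%N]mulnC leqnn.
apply: (nondefective_of_rank hk hd hs (rank_attained_space_span hk hd sd)).
have -> : 'C(3 + d, d) = 'C(d + 3, 3) by rewrite -bin_sub ?leq_addl // addnK addnC.
by rewrite geq_min leqnn orbT.
Qed.
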